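(* Let $C$ be an artinian coalgebra over $\mathbf{k}$ and $n$ an integer. Then $C$ is (left) CY-$n$ if and only if its dual algebra $C^*$ is (left) CY-$n$.
   Context: $\mathbf{k}$ is an algebraically closed field of characteristic zero. A coalgebra $C$ is artinian if it is both left and right artinian (as a left and as a right comodule over itself). A $\mathbf{k}$-linear category is Hom-finite if all its Hom-spaces are finite dimensional. A Hom-finite $\mathbf{k}$-linear triangulated category $\mathcal{T}$ is a Calabi-Yau category of dimension $n$ if for any objects $X,Y$ there is a natural isomorphism $\mathrm{Hom}_{\mathcal{T}}(X,Y)\cong\mathrm{Hom}_{\mathcal{T}}(Y,X[n])^*$, where $(\ )^*$ is the $\mathbf{k}$-linear dual. An algebra $A$ is (left) CY-$n$ (Calabi-Yau of dimension $n$) if $\mathcal{D}^b_{fd}({}_A\mathcal{M})$, the derived category of bounded complexes of left $A$-modules with finite dimensional cohomology, is Hom-finite and is a Calabi-Yau category of dimension $n$. A coalgebra $C$ is (left) CY-$n$ if $\mathcal{D}^b_{fd}({}^C\mathcal{M})$, the derived category of bounded complexes of left $C$-comodules with finite dimensional cohomology, is Hom-finite and is a Calabi-Yau category of dimension $n$. *)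

(* Defs.v *)
From HB Require Import structures.
From mathcomp Require Import all_boot all_order all_algebra.
From mathcomp Require Import boolp.

Set Implicit Arguments.
Unset Strict Implicit.
Unset Printing Implicit Defensive.

Import Order.TTheory GRing.Theory Num.Theory.
Local Open Scope ring_scope.
Local Open Scope quotient_scope.

Lemma linear_ext (k : fieldType) (V W : lmodType k) (f g : {linear V -> W}) :
  f =1 g -> f = g.
Proof.
case: f g => [f [[fD] [fZ]]] [g [[gD] [gZ]]] /= /funext fg.
case: _ / fg in gD gZ *.
by rewrite (Prop_irrelevance fD gD) (Prop_irrelevance fZ gZ).
Qed.

(* An element of the tensor product of V and W is a class of formal sums of
   pairs; two formal sums are identified when no bilinear map distinguishes
   them. *)

Section Tensor.
Variables (k : fieldType) (V W : lmodType k).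

Definition tsum (U : lmodType k) (b : V -> W -> U) (s : seq (V * W)) : U :=
  \sum_(p <- s) b p.1 p.2.

Definition tens_eq (s t : seq (V * W)) : bool :=
  `[< forall (U : lmodType k) (b : {bilinear V -> W -> U}), tsum b s = tsum b t >].

Lemma tens_eq_refl : reflexive tens_eq.
Proof. by move=> s; apply/asboolP. Qed.

Lemma tens_eq_sym : symmetric tens_eq.
Proof.
by move=> s t; apply/asboolP/asboolP => st U b; rewrite st.
Qed.

Lemma tens_eq_trans : transitive tens_eq.
Proof.
move=> t s r /asboolP st /asboolP tr; apply/asboolP => U b.
by rewrite st tr.
Qed.

Canonical tens_equiv :=
  EquivRel tens_eq tens_eq_refl tens_eq_sym tens_eq_trans.

Definition tensor := {eq_quot tens_equiv}.
HB.instance Definition _ := Choice.on tensor.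

Definition tlift (U : lmodType k) (b : {bilinear V -> W -> U}) (t : tensor) : U :=
  tsum b (repr t).

Lemma tlift_pi U b s : @tlift U b (\pi_tensor s) = tsum b s.
Proof.
rewrite /tlift; case: piP => t /eqquotP /asboolP st.
by rewrite st.
Qed.

Lemma tlift_inj (x y : tensor) : (forall U b, @tlift U b x = tlift b y) -> x = y.
Proof.
rewrite -[x]reprK -[y]reprK => xy; apply/eqquotP/asboolP => U b.
by have := xy U b; rewrite !tlift_pi.
Qed.

Definition tens0 : tensor := \pi_tensor [::].
Definition tens_add (x y : tensor) : tensor := \pi_tensor (repr x ++ repr y)%SEQ.
Definition tens_scale (a : k) (x : tensor) : tensor :=
  \pi_tensor [seq (a *: p.1, p.2) | p <- repr x].
Definition tens (v : V) (w : W) : tensor := \pi_tensor [:: (v, w)].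

Lemma tlift0 U b : @tlift U b tens0 = 0.
Proof. by rewrite tlift_pi /tsum big_nil. Qed.

Lemma tlift_add U b x y : @tlift U b (tens_add x y) = tlift b x + tlift b y.
Proof. by rewrite tlift_pi /tsum big_cat. Qed.

Lemma tlift_scale U b a x : @tlift U b (tens_scale a x) = a *: tlift b x.
Proof.
rewrite tlift_pi /tsum big_map scaler_sumr; apply: eq_bigr => p _ /=.
by rewrite linearZl_LR.
Qed.

Lemma tlift_tens U b v w : @tlift U b (tens v w) = b v w.
Proof. by rewrite tlift_pi /tsum big_seq1. Qed.

Fact tens_addA : associative tens_add.
Proof. by move=> x y z; apply: tlift_inj => U b; rewrite !tlift_add addrA. Qed.

Fact tens_addC : commutative tens_add.
Proof. by move=> x y; apply: tlift_inj => U b; rewrite !tlift_add addrC. Qed.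

Fact tens_add0 : left_id tens0 tens_add.
Proof. by move=> x; apply: tlift_inj => U b; rewrite tlift_add tlift0 add0r. Qed.

Fact tens_addN : left_inverse tens0 (tens_scale (-1)) tens_add.
Proof.
move=> x; apply: tlift_inj => U b.
by rewrite tlift_add tlift_scale tlift0 scaleN1r addNr.
Qed.

HB.instance Definition _ :=
  GRing.isZmodule.Build tensor tens_addA tens_addC tens_add0 tens_addN.

Fact tens_scaleA a b x : tens_scale a (tens_scale b x) = tens_scale (a * b) x.
Proof. by apply: tlift_inj => U c; rewrite !tlift_scale scalerA. Qed.

Fact tens_scale1 : left_id 1 tens_scale.
Proof. by move=> x; apply: tlift_inj => U c; rewrite tlift_scale scale1r. Qed.

Fact tens_scaleDr : right_distributive tens_scale +%R.
Proof.
by move=> a x y; apply: tlift_inj => U c; rewrite !(tlift_scale, tlift_add) scalerDr.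
Qed.

Fact tens_scaleDl x : {morph tens_scale^~ x : a b / a + b}.
Proof.
by move=> a b; apply: tlift_inj => U c; rewrite !(tlift_scale, tlift_add) scalerDl.
Qed.

HB.instance Definition _ := GRing.Zmodule_isLmodule.Build k tensor
  tens_scaleA tens_scale1 tens_scaleDr tens_scaleDl.

Fact tlift_linear U b : linear (@tlift U b).
Proof. by move=> a x y; rewrite tlift_add tlift_scale. Qed.

HB.instance Definition _ (U : lmodType k) (b : {bilinear V -> W -> U}) :=
  GRing.isLinear.Build k tensor U *:%R (@tlift U b) (@tlift_linear U b).

Fact tens_bilinear : bilinear_for *:%R *:%R tens.
Proof.
split=> [w a v v'|v a w w']; apply: tlift_inj => U b;
  rewrite tlift_add tlift_scale !tlift_tens.
  by rewrite linearPl.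
by rewrite linearPr.
Qed.

HB.instance Definition _ := bilinear_isBilinear.Build
  k V W tensor *:%R *:%R tens tens_bilinear.

Lemma tensE (x : tensor) : x = \sum_(p <- repr x) tens p.1 p.2.
Proof.
apply: tlift_inj => U b; rewrite linear_sum.
by apply: eq_bigr => p _; rewrite /= tlift_tens.
Qed.

Lemma tens_ext (U : lmodType k) (f g : {linear tensor -> U}) :
  (forall v w, f (tens v w) = g (tens v w)) -> f =1 g.
Proof.
by move=> fg x; rewrite (tensE x) !linear_sum; apply: eq_bigr => p _.
Qed.

(* t lies in the image of P ⊗ Q, for subspaces P of V and Q of W. *)
Definition in_tens (P : V -> Prop) (Q : W -> Prop) (t : tensor) : Prop :=
  exists2 s : seq (V * W), forall p, p \in s -> P p.1 /\ Q p.2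
                         & t = \sum_(p <- s) tens p.1 p.2.

End Tensor.

Section TensorMaps.
Variable k : fieldType.

Section Map.
Variables (V V' W W' : lmodType k) (f : {linear V -> V'}) (g : {linear W -> W'}).

Definition tmap_fun (v : V) (w : W) : tensor V' W' := tens (f v) (g w).

Fact tmap_fun_bilinear : bilinear_for *:%R *:%R tmap_fun.
Proof.
by split=> [w a v v'|v a w w']; rewrite /tmap_fun linearP ?linearPl ?linearPr.
Qed.

HB.instance Definition _ := bilinear_isBilinear.Build
  k V W (tensor V' W') *:%R *:%R tmap_fun tmap_fun_bilinear.

Definition tmap : {linear tensor V W -> tensor V' W'} := tlift tmap_fun.

Lemma tmapE v w : tmap (tens v w) = tens (f v) (g w).
Proof. exact: tlift_tens. Qed.

End Map.

Section Assoc.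
Variables (U V W : lmodType k).

Definition tassoc_in (w : W) (u : U) (v : V) : tensor U (tensor V W) :=
  tens u (tens v w).

Fact tassoc_in_bilinear w : bilinear_for *:%R *:%R (tassoc_in w).
Proof.
by split=> [v a u u'|u a v v']; rewrite /tassoc_in ?linearPl ?linearPr.
Qed.

HB.instance Definition _ w := bilinear_isBilinear.Build
  k U V (tensor U (tensor V W)) *:%R *:%R (tassoc_in w) (tassoc_in_bilinear w).

Definition tassoc_out (t : tensor U V) (w : W) : tensor U (tensor V W) :=
  tlift (tassoc_in w) t.

Fact tassoc_out_bilinear : bilinear_for *:%R *:%R tassoc_out.
Proof.
split=> [w a t t'|t a w w']; first by rewrite /tassoc_out linearP.
rewrite /tassoc_out /tlift /tsum /= scaler_sumr -big_split; apply: eq_bigr => p _ /=.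
by rewrite /tassoc_in linearPr linearPr.
Qed.

HB.instance Definition _ := bilinear_isBilinear.Build
  k (tensor U V) W (tensor U (tensor V W)) *:%R *:%R tassoc_out tassoc_out_bilinear.

Definition tassoc : {linear tensor (tensor U V) W -> tensor U (tensor V W)} :=
  tlift tassoc_out.

Lemma tassocE u v w : tassoc (tens (tens u v) w) = tens u (tens v w).
Proof. by transitivity (tassoc_out (tens u v) w); apply: tlift_tens. Qed.

End Assoc.

Lemma tens_ext3 (U V W X : lmodType k)
    (f g : {linear tensor (tensor U V) W -> X}) :
  (forall u v w, f (tens (tens u v) w) = g (tens (tens u v) w)) -> f =1 g.
Proof.
move=> fg; apply: tens_ext => t w; rewrite (tensE t) linear_sumlz !linear_sum.
by apply: eq_bigr => p _ ; exact: fg.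
Qed.

Section Unit.
Variable V : lmodType k.

Definition tunitl_fun (a : k^o) (v : V) : V := (a : k) *: v.
Definition tunitr_fun (v : V) (a : k^o) : V := (a : k) *: v.

Fact tunitl_fun_bilinear : bilinear_for *:%R *:%R tunitl_fun.
Proof.
split=> [v a b b'|b a v v'] /=; rewrite /tunitl_fun.
  by rewrite scalerDl; congr (_ + _); rewrite scalerA.
by rewrite scalerDr !scalerA mulrC.
Qed.

Fact tunitr_fun_bilinear : bilinear_for *:%R *:%R tunitr_fun.
Proof.
by split=> [a b v v'|v a b b'] /=;
  [exact: tunitl_fun_bilinear.2|exact: tunitl_fun_bilinear.1].
Qed.

HB.instance Definition _ := bilinear_isBilinear.Build
  k k^o V V *:%R *:%R tunitl_fun tunitl_fun_bilinear.
HB.instance Definition _ := bilinear_isBilinear.Build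
  k V k^o V *:%R *:%R tunitr_fun tunitr_fun_bilinear.

Definition tunitl : {linear tensor k^o V -> V} := tlift tunitl_fun.
Definition tunitr : {linear tensor V k^o -> V} := tlift tunitr_fun.

End Unit.
End TensorMaps.

Notation idlin V := (idfun : {linear V -> V}) (only parsing).

Record coalgebra (k : fieldType) := Coalgebra {
  coalg_car :> lmodType k;
  comul : {linear coalg_car -> tensor coalg_car coalg_car};
  counit : {linear coalg_car -> k^o};
  comulA : forall c,
    tassoc _ _ _ (tmap comul (idlin coalg_car) (comul c)) =
    tmap (idlin coalg_car) comul (comul c);
  counitl : forall c, tunitl _ (tmap counit (idlin coalg_car) (comul c)) = c;
  counitr : forall c, tunitr _ (tmap (idlin coalg_car) counit (comul c)) = c }.

Section Comodules.
Variables (k : fieldType) (C : coalgebra k).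

Record lcomodule := LComodule {
  lcomod_car :> lmodType k;
  lcoact : {linear lcomod_car -> tensor C lcomod_car};
  lcoactA : forall m,
    tassoc _ _ _ (tmap (comul C) (idlin lcomod_car) (lcoact m)) =
    tmap (idlin C) lcoact (lcoact m);
  lcoact1 : forall m, tunitl _ (tmap (counit C) (idlin lcomod_car) (lcoact m)) = m }.

Record rcomodule := RComodule {
  rcomod_car :> lmodType k;
  rcoact : {linear rcomod_car -> tensor rcomod_car C};
  rcoactA : forall m,
    tassoc _ _ _ (tmap rcoact (idlin C) (rcoact m)) =
    tmap (idlin rcomod_car) (comul C) (rcoact m);
  rcoact1 : forall m, tunitr _ (tmap (idlin rcomod_car) (counit C) (rcoact m)) = m }.

Definition lregular : lcomodule := LComodule (@comulA k C) (@counitl k C).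
Definition rregular : rcomodule := RComodule (@comulA k C) (@counitr k C).

Definition lcomod_hom (M N : lcomodule) (f : {linear M -> N}) : Prop :=
  forall m, lcoact N (f m) = tmap (idlin C) f (lcoact M m).

Definition subspace (V : lmodType k) (P : V -> Prop) : Prop :=
  P 0 /\ forall a u v, P u -> P v -> P (a *: u + v).

Definition lsubcomodule (M : lcomodule) (P : M -> Prop) : Prop :=
  subspace P /\ forall m, P m -> in_tens (fun=> True) P (lcoact M m).

Definition rsubcomodule (M : rcomodule) (P : M -> Prop) : Prop :=
  subspace P /\ forall m, P m -> in_tens P (fun=> True) (rcoact M m).

Definition descending_chain_condition (T : Type) (sub : (T -> Prop) -> Prop) : Prop :=
  forall P : nat -> T -> Prop,
    (forall i, sub (P i)) -> (forall i x, P i.+1 x -> P i x) ->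
    exists i0, forall i, (i0 <= i)%N -> forall x, P i0 x -> P i x.

Definition lartinian (M : lcomodule) := descending_chain_condition (@lsubcomodule M).
Definition rartinian (M : rcomodule) := descending_chain_condition (@rsubcomodule M).

Definition artinian_coalgebra : Prop := lartinian lregular /\ rartinian rregular.

End Comodules.

(* A k-algebra is a ring with a central ring morphism from k.  The
   library's algType is not used because it excludes the zero ring, which
   is the dual algebra of the zero coalgebra. *)
Record algebra (k : fieldType) := Algebra {
  alg_car :> pzRingType;
  alg_in : {rmorphism k -> alg_car};
  alg_inC : forall a x, alg_in a * x = x * alg_in a }.

Section DualAlgebra.
Variables (k : fieldType) (C : coalgebra k).

Definition dual := {linear C -> k^o}.

Lemma dual_ext (f g : dual) : f =1 g -> f = g.
Proof. exact: linear_ext. Qed.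

HB.instance Definition _ := gen_eqMixin dual.
HB.instance Definition _ := gen_choiceMixin dual.

Definition dual0 : dual := \0.
Definition dual_opp (f : dual) : dual := \- f.
Definition dual_add (f g : dual) : dual := f \+ g.

Fact dual_addA : associative dual_add.
Proof. by move=> f g h; apply: dual_ext => c /=; rewrite addrA. Qed.
Fact dual_addC : commutative dual_add.
Proof. by move=> f g; apply: dual_ext => c /=; rewrite addrC. Qed.
Fact dual_add0 : left_id dual0 dual_add.
Proof. by move=> f; apply: dual_ext => c /=; rewrite add0r. Qed.
Fact dual_addN : left_inverse dual0 dual_opp dual_add.
Proof. by move=> f; apply: dual_ext => c /=; rewrite addNr. Qed.

HB.instance Definition _ :=
  GRing.isZmodule.Build dual dual_addA dual_addC dual_add0 dual_addN.

Section Convolution.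
Variables (V W : lmodType k) (f : {linear V -> k^o}) (g : {linear W -> k^o}).

Definition prod_fun (v : V) (w : W) : k^o := f v * g w.

Fact prod_fun_bilinear : bilinear_for *:%R *:%R prod_fun.
Proof.
split=> [w a v v'|v a w w']; rewrite /prod_fun linearP /=.
  by rewrite mulrDl -scalerAl.
by rewrite mulrDr -scalerAr.
Qed.

HB.instance Definition _ := bilinear_isBilinear.Build
  k V W k^o *:%R *:%R prod_fun prod_fun_bilinear.

Definition tprod : {linear tensor V W -> k^o} := tlift prod_fun.

Lemma tprodE v w : tprod (tens v w) = f v * g w.
Proof. exact: tlift_tens. Qed.

End Convolution.

(* (f * g)(c) = sum of f(c_1) g(c_2), in Sweedler notation *)
Definition dual_mul (f g : dual) : dual := tprod f g \o comul C.
Definition dual1 : dual := counit C.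

Fact dual_mulA : associative dual_mul.
Proof.
move=> f g h; apply: dual_ext => c /=.
have -> : tprod f (dual_mul g h) =1 tprod f (tprod g h) \o tmap (idlin C) (comul C).
  by apply: tens_ext => a b /=; rewrite tmapE !tprodE.
have -> : tprod (dual_mul f g) h =1 tprod (tprod f g) h \o tmap (comul C) (idlin C).
  by apply: tens_ext => a b /=; rewrite tmapE !tprodE.
rewrite /= -comulA.
have H : tprod f (tprod g h) \o tassoc C C C =1 tprod (tprod f g) h.
  by apply: tens_ext3 => u v w /=; rewrite tassocE !tprodE mulrA.
exact: H.
Qed.

Fact dual_mul1l : left_id dual1 dual_mul.
Proof.
move=> f; apply: dual_ext => c /=; rewrite -[in RHS](counitl c).
have H : tprod dual1 f =1 f \o (tunitl C \o tmap (counit C) (idlin C)).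
  apply: tens_ext => a b /=; rewrite tprodE tmapE /tunitl /= tlift_tens.
  by rewrite /tunitl_fun linearZ.
exact: H.
Qed.

Fact dual_mul1r : right_id dual1 dual_mul.
Proof.
move=> f; apply: dual_ext => c /=; rewrite -[in RHS](counitr c).
have H : tprod f dual1 =1 f \o (tunitr C \o tmap (idlin C) (counit C)).
  apply: tens_ext => a b /=; rewrite tprodE tmapE /tunitr /= tlift_tens.
  by rewrite /tunitr_fun linearZ /= mulrC.
exact: H.
Qed.

Fact dual_mulDl : left_distributive dual_mul +%R.
Proof.
move=> f g h; apply: dual_ext => c /=.
have H : tprod (f + g) h =1 tprod f h \+ tprod g h.
  by apply: tens_ext => a b /=; rewrite !tprodE /= mulrDl.
exact: H.
Qed.

Fact dual_mulDr : right_distributive dual_mul +%R.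
Proof.
move=> f g h; apply: dual_ext => c /=.
have H : tprod f (g + h) =1 tprod f g \+ tprod f h.
  by apply: tens_ext => a b /=; rewrite !tprodE /= mulrDr.
exact: H.
Qed.

HB.instance Definition _ := GRing.Zmodule_isPzRing.Build dual
  dual_mulA dual_mul1l dual_mul1r dual_mulDl dual_mulDr.

Definition dual_in (a : k) : dual := a \*: counit C.

Fact dual_in_zmod : zmod_morphism dual_in.
Proof. by move=> a b; apply: dual_ext => c /=; rewrite scalerBl. Qed.

Fact dual_mul_inl a f c : dual_mul (dual_in a) f c = a * f c.
Proof.
have H : tprod (dual_in a) f =1 a \*: tprod dual1 f.
  by apply: tens_ext => u v /=; rewrite !tprodE /= scalerAl.
by rewrite /dual_mul /= H /= -[f in RHS]dual_mul1l.
Qed.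

Fact dual_mul_inr a f c : dual_mul f (dual_in a) c = a * f c.
Proof.
have H : tprod f (dual_in a) =1 a \*: tprod f dual1.
  by apply: tens_ext => u v /=; rewrite !tprodE /= scalerAr.
by rewrite /dual_mul /= H /= -[f in RHS]dual_mul1r.
Qed.

Fact dual_in_monoid : monoid_morphism dual_in.
Proof.
split=> [|a b]; apply: dual_ext => c; first by rewrite /= scale1r.
by rewrite [RHS]dual_mul_inl /= -scalerA.
Qed.

HB.instance Definition _ := GRing.isZmodMorphism.Build k dual dual_in dual_in_zmod.
HB.instance Definition _ := GRing.isMonoidMorphism.Build k dual dual_in dual_in_monoid.

Fact dual_inC a (f : dual) : dual_in a * f = f * dual_in a.
Proof.
by apply: dual_ext => c; rewrite [LHS]dual_mul_inl [RHS]dual_mul_inr.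
Qed.

Definition dual_algebra : algebra k := Algebra dual_inC.

End DualAlgebra.

(* The Hom spaces are not packaged as lmodType: the Hom spaces of a
   derived category of modules live in a larger universe than the modules
   themselves, and all lmodTypes live in the same universe. *)
Record klincat (k : fieldType) := KLinCat {
  ob :> Type;
  hom : ob -> ob -> Type;
  idm : forall X, hom X X;
  compm : forall X Y Z, hom Y Z -> hom X Y -> hom X Z;
  zerom : forall X Y, hom X Y;
  addm : forall X Y, hom X Y -> hom X Y -> hom X Y;
  scalem : forall X Y, k -> hom X Y -> hom X Y;
  compmA : forall X Y Z T (h : hom Z T) (g : hom Y Z) (f : hom X Y),
    compm h (compm g f) = compm (compm h g) f;
  compm_idl : forall X Y (f : hom X Y), compm (idm Y) f = f;
  compm_idr : forall X Y (f : hom X Y), compm f (idm X) = f;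
  addmA : forall X Y, associative (@addm X Y);
  addmC : forall X Y, commutative (@addm X Y);
  addm0 : forall X Y, left_id (zerom X Y) (@addm X Y);
  addmN : forall X Y (f : hom X Y), addm (scalem (-1) f) f = zerom X Y;
  scalemA : forall X Y a b (f : hom X Y), scalem a (scalem b f) = scalem (a * b) f;
  scalem1 : forall X Y (f : hom X Y), scalem 1 f = f;
  scalemDr : forall X Y a (f g : hom X Y),
    scalem a (addm f g) = addm (scalem a f) (scalem a g);
  scalemDl : forall X Y a b (f : hom X Y),
    scalem (a + b) f = addm (scalem a f) (scalem b f);
  compm_addl : forall X Y Z (g h : hom Y Z) (f : hom X Y),
    compm (addm g h) f = addm (compm g f) (compm h f);
  compm_addr : forall X Y Z (h : hom Y Z) (f g : hom X Y),
    compm h (addm f g) = addm (compm h f) (compm h g);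
  compm_scalel : forall X Y Z a (g : hom Y Z) (f : hom X Y),
    compm (scalem a g) f = scalem a (compm g f);
  compm_scaler : forall X Y Z a (g : hom Y Z) (f : hom X Y),
    compm g (scalem a f) = scalem a (compm g f) }.

Arguments idm {k _} X.
Arguments zerom {k _} X Y.

Record klinfun (k : fieldType) (T U : klincat k) := KLinFun {
  fob :> T -> U;
  fmor : forall X Y, hom X Y -> hom (fob X) (fob Y);
  fmor_id : forall X, fmor (idm X) = idm (fob X);
  fmor_comp : forall X Y Z (g : hom Y Z) (f : hom X Y),
    fmor (compm g f) = compm (fmor g) (fmor f);
  fmor_add : forall X Y (f g : hom X Y), fmor (addm f g) = addm (fmor f) (fmor g);
  fmor_scale : forall X Y a (f : hom X Y), fmor (scalem a f) = scalem a (fmor f) }.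

Lemma fmor0 (k : fieldType) (T U : klincat k) (F : klinfun T U) X Y :
  fmor F (zerom X Y) = zerom (F X) (F Y).
Proof. by rewrite -(addmN (zerom X Y)) fmor_add fmor_scale addmN. Qed.

Definition klinfun_comp (k : fieldType) (T U V : klincat k)
  (G : klinfun U V) (F : klinfun T U) : klinfun T V.
Proof.
by exists (fun X => G (F X)) (fun X Y f => fmor G (fmor F f)) => *;
  rewrite ?fmor_id ?fmor_comp ?fmor_add ?fmor_scale.
Defined.

Definition inverse_of (k : fieldType) (T : klincat k) (X Y : T)
    (f : hom X Y) (g : hom Y X) : Prop :=
  compm g f = idm X /\ compm f g = idm Y.

Definition is_iso (k : fieldType) (T : klincat k) (X Y : T) (f : hom X Y) : Prop :=
  exists g, inverse_of f g.

(* The library's quotients need a choiceType, hence a small universe. *)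
Section Quot.
Variables (T : Type) (R : T -> T -> Prop).
Hypotheses (R_refl : forall x, R x x) (R_sym : forall x y, R x y -> R y x).
Hypothesis R_trans : forall x y z, R x y -> R y z -> R x z.

Definition quot := {P : T -> Prop | exists x, P = R x}.
Definition qclass (x : T) : quot := exist _ (R x) (ex_intro _ x erefl).
Definition crepr (q : quot) : T := projT1 (cid (proj2_sig q)).

Lemma creprK q : qclass (crepr q) = q.
Proof.
rewrite /crepr; case: cid => x; case: q => P Px /= E.
exact: eq_exist (esym E).
Qed.

Lemma class_eq x y : R x y -> qclass x = qclass y.
Proof.
move=> xy; apply: eq_exist; apply: funext => z; apply: propext.
by split; [apply: R_trans (R_sym xy)|apply: R_trans xy].
Qed.

Lemma crepr_class x : R (crepr (qclass x)) x.
Proof.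
have /(congr1 (@proj1_sig _ _)) /= E := creprK (qclass x).
by rewrite E.
Qed.

End Quot.

(* The localization of T at a class W of morphisms, by generators and
   relations: a morphism is a formal k-linear combination of composites of
   morphisms of T and formal inverses of elements of W, modulo the axioms of
   k-linear categories and the relations making T -> T[W^-1] a k-linear functor
   and the formal inverses inverses.  See loc_lift and loc_lift_uniq for its
   universal property. *)
Section Localization.
Variables (k : fieldType) (T : klincat k) (W : forall X Y : T, hom X Y -> Prop).

Inductive word : T -> T -> Type :=
| Wmor X Y : hom X Y -> word X Y
| Winv X Y (s : hom X Y) : W s -> word Y X
| Wcomp X Y Z : word Y Z -> word X Y -> word X Z
| Wadd X Y : word X Y -> word X Y -> word X Y
| Wscale X Y : k -> word X Y -> word X Y.

Let Wid X := Wmor (idm X).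
Let Wzero X Y := Wmor (zerom X Y).

Inductive weq : forall X Y, word X Y -> word X Y -> Prop :=
| weq_refl X Y (u : word X Y) : weq u u
| weq_sym X Y (u v : word X Y) : weq u v -> weq v u
| weq_trans X Y (u v w : word X Y) : weq u v -> weq v w -> weq u w
| weq_comp X Y Z (u u' : word Y Z) (v v' : word X Y) :
    weq u u' -> weq v v' -> weq (Wcomp u v) (Wcomp u' v')
| weq_add X Y (u u' v v' : word X Y) :
    weq u u' -> weq v v' -> weq (Wadd u v) (Wadd u' v')
| weq_scale X Y a (u u' : word X Y) : weq u u' -> weq (Wscale a u) (Wscale a u')
| weq_compA X Y Z V (w : word Z V) (v : word Y Z) (u : word X Y) :
    weq (Wcomp w (Wcomp v u)) (Wcomp (Wcomp w v) u)
| weq_idl X Y (u : word X Y) : weq (Wcomp (Wid Y) u) u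
| weq_idr X Y (u : word X Y) : weq (Wcomp u (Wid X)) u
| weq_addA X Y (u v w : word X Y) : weq (Wadd u (Wadd v w)) (Wadd (Wadd u v) w)
| weq_addC X Y (u v : word X Y) : weq (Wadd u v) (Wadd v u)
| weq_add0 X Y (u : word X Y) : weq (Wadd (Wzero X Y) u) u
| weq_addN X Y (u : word X Y) : weq (Wadd (Wscale (-1) u) u) (Wzero X Y)
| weq_scaleA X Y a b (u : word X Y) :
    weq (Wscale a (Wscale b u)) (Wscale (a * b) u)
| weq_scale1 X Y (u : word X Y) : weq (Wscale 1 u) u
| weq_scaleDr X Y a (u v : word X Y) :
    weq (Wscale a (Wadd u v)) (Wadd (Wscale a u) (Wscale a v))
| weq_scaleDl X Y a b (u : word X Y) :
    weq (Wscale (a + b) u) (Wadd (Wscale a u) (Wscale b u))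
| weq_comp_addl X Y Z (v w : word Y Z) (u : word X Y) :
    weq (Wcomp (Wadd v w) u) (Wadd (Wcomp v u) (Wcomp w u))
| weq_comp_addr X Y Z (w : word Y Z) (u v : word X Y) :
    weq (Wcomp w (Wadd u v)) (Wadd (Wcomp w u) (Wcomp w v))
| weq_comp_scalel X Y Z a (v : word Y Z) (u : word X Y) :
    weq (Wcomp (Wscale a v) u) (Wscale a (Wcomp v u))
| weq_comp_scaler X Y Z a (v : word Y Z) (u : word X Y) :
    weq (Wcomp v (Wscale a u)) (Wscale a (Wcomp v u))
| weq_mor_comp X Y Z (g : hom Y Z) (f : hom X Y) :
    weq (Wmor (compm g f)) (Wcomp (Wmor g) (Wmor f))
| weq_mor_add X Y (f g : hom X Y) : weq (Wmor (addm f g)) (Wadd (Wmor f) (Wmor g))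
| weq_mor_scale X Y a (f : hom X Y) : weq (Wmor (scalem a f)) (Wscale a (Wmor f))
| weq_invl X Y (s : hom X Y) (Ws : W s) : weq (Wcomp (Winv Ws) (Wmor s)) (Wid X)
| weq_invr X Y (s : hom X Y) (Ws : W s) : weq (Wcomp (Wmor s) (Winv Ws)) (Wid Y).

Definition lhom X Y := quot (@weq X Y).
Definition lclass X Y : word X Y -> lhom X Y := @qclass _ (@weq X Y).

Lemma lclassE X Y (u v : word X Y) : weq u v -> lclass u = lclass v.
Proof. exact: (class_eq (@weq_sym X Y) (@weq_trans X Y)). Qed.

Lemma lclassP X Y (f : lhom X Y) : exists u, f = lclass u.
Proof. by exists (crepr f); rewrite [RHS]creprK. Qed.

Lemma lrepr X Y (u : word X Y) : weq (crepr (lclass u)) u.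
Proof. exact: crepr_class (@weq_refl X Y) _. Qed.

Definition lcomp X Y Z (g : lhom Y Z) (f : lhom X Y) : lhom X Z :=
  lclass (Wcomp (crepr g) (crepr f)).
Definition ladd X Y (f g : lhom X Y) : lhom X Y :=
  lclass (Wadd (crepr f) (crepr g)).
Definition lscale X Y a (f : lhom X Y) : lhom X Y := lclass (Wscale a (crepr f)).

Lemma lcompE X Y Z (v : word Y Z) (u : word X Y) :
  lcomp (lclass v) (lclass u) = lclass (Wcomp v u).
Proof. by apply: lclassE; apply: weq_comp; apply: lrepr. Qed.

Lemma laddE X Y (u v : word X Y) : ladd (lclass u) (lclass v) = lclass (Wadd u v).
Proof. by apply: lclassE; apply: weq_add; apply: lrepr. Qed.

Lemma lscaleE X Y a (u : word X Y) : lscale a (lclass u) = lclass (Wscale a u).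
Proof. by apply: lclassE; apply: weq_scale; apply: lrepr. Qed.

Definition localization : klincat k.
Proof.
exists T lhom (fun X => lclass (Wid X)) lcomp (fun X Y => lclass (Wzero X Y))
  ladd lscale; repeat intro;
  repeat match goal with f : lhom _ _ |- _ =>
    let u := fresh "u" in case: (lclassP f) => u ->; clear f end;
  rewrite ?(lcompE, laddE, lscaleE); apply: lclassE; by constructor.
Defined.

Definition loc_functor : klinfun T localization.
Proof.
exists (fun X : T => X : localization) (fun (X Y : T) (f : hom X Y) => lclass (Wmor f))
  => *; rewrite /= ?(lcompE, laddE, lscaleE) //; apply: lclassE; by constructor.
Defined.

Lemma loc_functor_iso X Y (s : hom X Y) : W s -> is_iso (fmor loc_functor s).
Proof.
move=> Ws; exists (lclass (Winv Ws)).
by split; rewrite /= lcompE; apply: lclassE; constructor.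
Qed.

Section Lift.
Variables (U : klincat k) (F : klinfun T U).
Hypothesis FW : forall X Y (s : hom X Y), W s -> is_iso (fmor F s).

Fixpoint weval X Y (u : word X Y) : hom (F X) (F Y) :=
  match u with
  | Wmor _ _ f => fmor F f
  | Winv _ _ _ Ws => projT1 (cid (FW Ws))
  | Wcomp _ _ _ v u => compm (weval v) (weval u)
  | Wadd _ _ u v => addm (weval u) (weval v)
  | Wscale _ _ a u => scalem a (weval u)
  end.

Lemma weval_eq X Y (u v : word X Y) : weq u v -> weval u = weval v.
Proof.
elim=> {X Y u v} /=; intros;
  rewrite ?(fmor_id, fmor0, fmor_comp, fmor_add, fmor_scale);
  rewrite ?(compmA, compm_idl, compm_idr, addmA, addm0, addmN, scalemA, scalem1);
  rewrite ?(scalemDr, scalemDl, compm_addl, compm_addr, compm_scalel, compm_scaler);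
  try congruence; try exact: addmC; by case: cid => t [].
Qed.

Definition loc_lift : klinfun localization U.
Proof.
exists (fun X : localization => F X)
  (fun (X Y : localization) (f : hom X Y) => weval (crepr f)); intros;
  try (rewrite -fmor_id; exact: (weval_eq (lrepr _)));
  exact: (weval_eq (lrepr _)).
Defined.

Lemma loc_liftE X Y (f : hom X Y) : fmor loc_lift (fmor loc_functor f) = fmor F f.
Proof. exact: (weval_eq (lrepr _)). Qed.

Lemma loc_lift_uniq (g : forall X Y : T, @hom k localization X Y -> hom (F X) (F Y)) :
  (forall X, g X X (@idm k localization X) = idm (F X)) ->
  (forall X Y Z v u, g X Z (compm v u) = compm (g Y Z v) (g X Y u)) ->
  (forall X Y u v, g X Y (addm u v) = addm (g X Y u) (g X Y v)) ->
  (forall X Y a u, g X Y (scalem a u) = scalem a (g X Y u)) ->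
  (forall X Y (f : hom X Y), g X Y (fmor loc_functor f) = fmor F f) ->
  forall X Y u, g X Y u = fmor loc_lift u.
Proof.
move=> g1 gM gD gZ gF X Y u; case: (lclassP u) => {}u ->.
rewrite [RHS](weval_eq (lrepr _)).
elim: u => {X Y} [X Y f|X Y s Ws|X Y Z v IHv u IHu|X Y u IHu v IHv|X Y a u IHu] /=.
- exact: gF.
- case: cid => t [ts st] /=; rewrite -[LHS]compm_idr -st compmA -gF -gM /= lcompE.
  rewrite (lclassE (weq_invl Ws)).
  by have := g1 X; rewrite /= => ->; rewrite compm_idl.
- by rewrite -lcompE gM IHv IHu.
- by rewrite -laddE gD IHu IHv.
- by rewrite -lscaleE gZ IHu.
Qed.

End Lift.
End Localization.

(* The part of a k-linear triangulated category on which the Calabi-Yau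
   condition depends: the k-linear category and the functors X |-> X[n].  The
   distinguished triangles play no role in that condition. *)
Record shiftcat (k : fieldType) := ShiftCat {
  scat :> klincat k;
  shift : int -> klinfun scat scat }.

Section CalabiYau.
Variables (k : fieldType) (T : shiftcat k).

Definition hom_finite : Prop :=
  forall X Y : T, exists (r : nat) (e : 'I_r -> hom X Y), forall f : hom X Y,
    exists c : 'I_r -> k, f = \big[@addm k T X Y/zerom X Y]_(i < r) scalem (c i) (e i).

Definition linear_form (X Y : T) (l : hom X Y -> k) : Prop :=
  forall a f g, l (addm (scalem a f) g) = a * l f + l g.

(* phi X Y f is the linear form on Hom(Y, X[n]) corresponding to f. *)
Definition natural_duality (n : int)
    (phi : forall X Y : T, hom X Y -> hom Y (shift T n X) -> k) : Prop :=
  [/\ forall X Y f, linear_form (phi X Y f),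
      forall X Y a f g u, phi X Y (addm (scalem a f) g) u = a * phi X Y f u + phi X Y g u,
      forall X Y (l : hom Y (shift T n X) -> k), linear_form l -> exists! f, phi X Y f = l
    & forall (X X' Y Y' : T) (x : hom X' X) (f : hom X Y) (y : hom Y Y')
             (u : hom Y' (shift T n X')),
        phi X' Y' (compm y (compm f x)) u =
        phi X Y f (compm (fmor (shift T n) x) (compm u y)) ].

Definition calabi_yau (n : int) : Prop :=
  hom_finite /\ exists phi, natural_duality (n := n) phi.

End CalabiYau.

(* Objects are vector spaces with additional structure, morphisms are certain
   linear maps.  Cohomology is computed on the underlying vector spaces: for
   modules and for comodules, the forgetful functor is exact and reflects
   exactness. *)
Record concrete_cat (k : fieldType) := ConcreteCat {
  cobj :> Type;
  und : cobj -> lmodType k;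
  chom : forall X Y, {linear und X -> und Y} -> Prop;
  chom_id : forall X, chom (idlin (und X));
  chom_comp : forall X Y Z (g : {linear und Y -> und Z}) (f : {linear und X -> und Y}),
    chom g -> chom f -> chom (g \o f);
  chom0 : forall X Y, chom (\0 : {linear und X -> und Y});
  chom_add : forall X Y (f g : {linear und X -> und Y}),
    chom f -> chom g -> chom (f \+ g);
  chom_scale : forall X Y a (f : {linear und X -> und Y}),
    chom f -> chom (a \*: f) }.

Section ConcreteInstances.
Variable k : fieldType.

Section Comod.
Variable C : coalgebra k.

Fact tmap_id (V W : lmodType k) : tmap (idlin V) (idlin W) =1 id.
Proof.
by move=> t; rewrite [t in RHS]tensE [t in LHS]tensE linear_sum; apply: eq_bigr
  => p _; rewrite /= tmapE.
Qed.

Fact tmap_comp (V W W' W'' : lmodType k) (g : {linear W' -> W''}) (f : {linear W -> W'}) :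
  tmap (idlin V) (g \o f) =1 tmap (idlin V) g \o tmap (idlin V) f.
Proof. by apply: tens_ext => v w /=; rewrite !tmapE. Qed.

Fact tmap0 (V W W' : lmodType k) : tmap (idlin V) (\0 : {linear W -> W'}) =1 \0.
Proof. by apply: tens_ext => v w /=; rewrite tmapE linear0r. Qed.

Fact tmap_add (V W W' : lmodType k) (f g : {linear W -> W'}) :
  tmap (idlin V) (f \+ g) =1 tmap (idlin V) f \+ tmap (idlin V) g.
Proof. by apply: tens_ext => v w /=; rewrite !tmapE /= linearDr. Qed.

Fact tmap_scale (V W W' : lmodType k) a (f : {linear W -> W'}) :
  tmap (idlin V) (a \*: f) =1 a \*: tmap (idlin V) f.
Proof. by apply: tens_ext => v w /=; rewrite !tmapE /= linearZr_LR. Qed.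

Definition comod_cat : concrete_cat k.
Proof.
exists (lcomodule C) (@lcomod_car k C) (@lcomod_hom k C).
- by move=> M m; rewrite tmap_id.
- by move=> M N P g f gC fC m; rewrite tmap_comp /= gC fC.
- by move=> M N m; rewrite tmap0 /= linear0.
- by move=> M N f g fC gC m; rewrite tmap_add /= linearD fC gC.
- by move=> M N a f fC m; rewrite tmap_scale /= linearZ fC.
Defined.

End Comod.

Variable A : algebra k.

Definition resk (M : lmodType A) : Type := M.

Section Restriction.
Variable M : lmodType A.
HB.instance Definition _ := GRing.Zmodule.on (resk M).

Definition resk_scale (a : k) (m : resk M) : resk M := alg_in A a *: (m : M).

Fact resk_scaleA a b m : resk_scale a (resk_scale b m) = resk_scale (a * b) m.
Proof. by rewrite /resk_scale scalerA rmorphM. Qed.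
Fact resk_scale1 : left_id 1 resk_scale.
Proof. by move=> m; rewrite /resk_scale rmorph1 scale1r. Qed.
Fact resk_scaleDr : right_distributive resk_scale +%R.
Proof. by move=> a m n; rewrite /resk_scale scalerDr. Qed.
Fact resk_scaleDl m : {morph resk_scale^~ m : a b / a + b}.
Proof. by move=> a b; rewrite /resk_scale rmorphD scalerDl. Qed.

HB.instance Definition _ := GRing.Zmodule_isLmodule.Build k (resk M)
  resk_scaleA resk_scale1 resk_scaleDr resk_scaleDl.
End Restriction.

Definition module_hom (M N : lmodType A) (f : {linear resk M -> resk N}) : Prop :=
  forall (a : A) (m : M), f (a *: m) = a *: (f m : N).

Definition module_cat : concrete_cat k.
Proof.
exists (lmodType A) (fun M => resk M : lmodType k) module_hom.
- by [].
- by move=> M N P g f gA fA a m /=; rewrite fA gA.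
- by move=> M N a m /=; rewrite scaler0.
- by move=> M N f g fA gA a m /=; rewrite fA gA scalerDr.
- move=> M N a f fA b m /=; rewrite fA.
  change (alg_in A a *: (b *: (f m : N)) = b *: (alg_in A a *: (f m : N))).
  by rewrite !scalerA alg_inC.
Defined.

End ConcreteInstances.

Section Complexes.
Variables (k : fieldType) (A : concrete_cat k).

(* The differential is indexed by its source and its target, and vanishes
   unless the degrees are consecutive. *)
Record complex := Complex {
  cx :> int -> A;
  dif : forall i j, {linear und (cx i) -> und (cx j)};
  dif_hom : forall i j, chom (dif i j);
  dif_shape : forall i j x, j != i + 1 -> dif i j x = 0;
  dif_dif : forall i j l x, dif j l (dif i j x) = 0 }.

(* As dif vanishes in the other degrees, these are the kernel of
   X^i -> X^(i+1) and the image of X^(i-1) -> X^i. *)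
Definition cocycle (X : complex) i (x : und (X i)) : Prop :=
  forall j, dif X i j x = 0.
Definition coboundary (X : complex) i (x : und (X i)) : Prop :=
  exists j y, x = dif X j i y.

Definition bounded (X : complex) : Prop :=
  exists N : int, forall i, N < `|i| -> forall x : und (X i), x = 0.

Definition fd_cohomology (X : complex) : Prop :=
  forall i, exists (r : nat) (z : 'I_r -> und (X i)),
    (forall s, cocycle (z s)) /\
    forall x, cocycle x -> exists c : 'I_r -> k, coboundary (x - \sum_s c s *: z s).

Record bfd_complex := BfdComplex {
  bfd_cx :> complex;
  bfd_bounded : bounded bfd_cx;
  bfd_fd : fd_cohomology bfd_cx }.

Record chain_map (X Y : complex) := ChainMap {
  cm :> forall i, {linear und (X i) -> und (Y i)};
  cm_hom : forall i, chom (cm i);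
  cm_dif : forall i j x, cm j (dif X i j x) = dif Y i j (cm i x) }.

Definition quasi_iso (X Y : complex) (f : chain_map X Y) : Prop :=
  forall i,
    (forall x, cocycle x -> coboundary (f i x) -> coboundary x) /\
    (forall y, cocycle y -> exists2 x, cocycle x & coboundary (y - f i x)).

Lemma chain_map_ext (X Y : complex) (f g : chain_map X Y) :
  (forall i, f i =1 g i) -> f = g.
Proof.
case: f g => [f fH fD] [g gH gD] /= fg.
have E : f = g by apply: functional_extensionality_dep => i; apply: linear_ext; exact: fg.
case: _ / E in gH gD *.
by rewrite (Prop_irrelevance fH gH) (Prop_irrelevance fD gD).
Qed.

Definition chain_id X : chain_map X X.
Proof. by exists (fun i => idlin (und (X i))) => // i; apply: chom_id. Defined.

Definition chain_comp X Y Z (g : chain_map Y Z) (f : chain_map X Y) : chain_map X Z.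
Proof.
exists (fun i => g i \o f i : {linear _ -> _}).
- by move=> i; apply: chom_comp; apply: cm_hom.
- by move=> i j x /=; rewrite !cm_dif.
Defined.

Definition chain0 X Y : chain_map X Y.
Proof.
exists (fun i => \0 : {linear _ -> _}).
- by move=> i; apply: chom0.
- by move=> i j x /=; rewrite linear0.
Defined.

Definition chain_add X Y (f g : chain_map X Y) : chain_map X Y.
Proof.
exists (fun i => f i \+ g i : {linear _ -> _}).
- by move=> i; apply: chom_add; apply: cm_hom.
- by move=> i j x /=; rewrite !cm_dif linearD.
Defined.

Definition chain_scale X Y (a : k) (f : chain_map X Y) : chain_map X Y.
Proof.
exists (fun i => a \*: f i : {linear _ -> _}).
- by move=> i; apply: chom_scale; apply: cm_hom.
- by move=> i j x /=; rewrite !cm_dif linearZ.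
Defined.

Definition chain_cat : klincat k.
Proof.
exists bfd_complex chain_map chain_id chain_comp chain0 chain_add chain_scale;
  repeat intro; apply: chain_map_ext => i m /=.
- by [].
- by [].
- by [].
- by rewrite addrA.
- by rewrite addrC.
- by rewrite add0r.
- by rewrite scaleN1r addNr.
- by rewrite scalerA.
- by rewrite scale1r.
- by rewrite scalerDr.
- by rewrite scalerDl.
- by [].
- by rewrite linearD.
- by [].
- by rewrite linearZ.
Defined.

Section Shift.
Variable n : int.

Definition shift_sign : k := (-1) ^ n.

Lemma shift_sign_neq0 : shift_sign != 0.
Proof. by rewrite expfz_neq0 // oppr_eq0 oner_eq0. Qed.

(* X[n]^i = X^(i+n), with differential (-1)^n d *)
Definition shift_complex (X : complex) : complex.
Proof.
exists (fun i => X (i + n)) (fun i j => shift_sign \*: dif X (i + n) (j + n) : {linear _ -> _}).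
- by move=> i j; apply/chom_scale/dif_hom.
- move=> i j x ij /=.
  by rewrite dif_shape ?scaler0 // addrAC (inj_eq (addIr n)).
- by move=> i j l x /=; rewrite linearZ /= dif_dif !scaler0.
Defined.

Lemma shift_cocycle (X : complex) i (x : und (X (i + n))) :
  @cocycle (shift_complex X) i x <-> @cocycle X (i + n) x.
Proof.
split=> cx j; last by rewrite /= cx scaler0.
have /eqP := cx (j - n); rewrite /= scaler_eq0 (negPf shift_sign_neq0) /= => /eqP.
by rewrite subrK.
Qed.

Lemma shift_coboundary (X : complex) i (x : und (X (i + n))) :
  @coboundary (shift_complex X) i x <-> @coboundary X (i + n) x.
Proof.
split=> [[j [y ->]]|[j]].
  by exists (j + n), (shift_sign *: y); rewrite linearZ.
rewrite -(subrK n j) => -[y ->]; exists (j - n), (shift_sign^-1 *: y).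
by rewrite /= linearZ scalerA divff ?shift_sign_neq0 // scale1r.
Qed.

Definition shift_bfd (X : bfd_complex) : bfd_complex.
Proof.
exists (shift_complex X).
- have [N NX] := bfd_bounded X; exists (N + `|n|) => i Ni x.
  apply: NX; rewrite -(ltrD2r `|n|); apply: lt_le_trans Ni _.
  by rewrite -{1}(addrK n i) (le_trans (ler_normB _ _)).
- move=> i; have [r [z [zX zP]]] := bfd_fd X (i + n); exists r, z; split.
    by move=> s; apply/shift_cocycle.
  by move=> x /shift_cocycle /zP [c xc]; exists c; apply/shift_coboundary.
Defined.

Definition shift_map (X Y : complex) (f : chain_map X Y) :
  chain_map (shift_complex X) (shift_complex Y).
Proof.
exists (fun i => f (i + n) : {linear und (shift_complex X i) -> und (shift_complex Y i)}).
- by move=> i; exact: (cm_hom f (i + n)).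
- by move=> i j x /=; rewrite linearZ /= cm_dif.
Defined.

Lemma shift_quasi_iso (X Y : complex) (f : chain_map X Y) :
  quasi_iso f -> quasi_iso (shift_map f).
Proof.
move=> qf i; have [fI fS] := qf (i + n); split.
  by move=> x /shift_cocycle cx /shift_coboundary /fI - /(_ cx) /shift_coboundary.
move=> y /shift_cocycle /fS [x cx xy].
by exists x; [apply/shift_cocycle|apply/shift_coboundary].
Qed.

Definition chain_shift : klinfun chain_cat chain_cat.
Proof.
by exists (fun X : chain_cat => shift_bfd X : chain_cat)
  (fun (X Y : chain_cat) (f : hom X Y) => shift_map f); intros;
  apply: chain_map_ext => i x.
Defined.

End Shift.

Definition quasi_isos (X Y : chain_cat) (f : hom X Y) : Prop := quasi_iso f.

Definition derived_klincat : klincat k := localization quasi_isos.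

Lemma derived_shift_iso n X Y (s : @hom k chain_cat X Y) : quasi_isos s ->
  is_iso (fmor (klinfun_comp (loc_functor quasi_isos) (chain_shift n)) s).
Proof.
by move=> qs; apply: loc_functor_iso; apply: shift_quasi_iso.
Qed.

Definition derived_shift n : klinfun derived_klincat derived_klincat :=
  loc_lift (@derived_shift_iso n).

Definition derived_bfd : shiftcat k := ShiftCat derived_shift.

End Complexes.

Definition coalgebra_CY (k : fieldType) (C : coalgebra k) (n : int) : Prop :=
  calabi_yau (derived_bfd (comod_cat C)) n.

Definition algebra_CY (k : fieldType) (A : algebra k) (n : int) : Prop :=
  calabi_yau (derived_bfd (module_cat A)) n.

(* Main.v *)
(* The proof compares the two derived categories by X |-> X^* = Hom_k(X, k),
   which sends left C-comodules to left C^*-modules contravariantly and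
   exactly.  Finitely generated submodules of M^* are annihilators of
   subcomodules of M, so the descending chain condition on C makes C^* left
   noetherian, and a finitely generated C^*-module P is X^* for a comodule X,
   namely its finite dual (the representative forms on P).  A bounded complex N
   of modules with finite dimensional cohomology contains a quasi-isomorphic
   subcomplex P of finitely generated modules, and N |-> (finite dual of P)
   inverts X |-> X^* up to isomorphism in the derived categories.  No homotopies
   are needed for functoriality: any two such subcomplexes lie in a third one.
   Since (X[n])^*[n] = X^*, the duality exchanges the Calabi-Yau conditions. *)

From HB Require Import structures.
From mathcomp Require Import all_boot all_order all_algebra.
From mathcomp Require Import boolp classical_sets.
Require Import Defs.

Set Implicit Arguments.
Unset Strict Implicit.
Unset Printing Implicit Defensive.

Import Order.TTheory GRing.Theory Num.Theory.
Local Open Scope ring_scope.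

(** * Linear forms and tensors *)

(** The derived categories are localizations given by generators and relations. So each functor
    between them comes from the universal property, and each natural transformation is checked on
    chain maps only: naturality at a formal inverse follows by cancelling an isomorphism. The terms
    of a complex may be infinite dimensional even when its cohomology is finite dimensional, so full
    biduality is replaced by the finite dual, which recovers every finitely generated module. A left
    comodule is treated as a right module over [C^*], by contracting its coaction with forms;
    transposing this right action gives a left module, which is why left corresponds to left.
    Contravariance also exchanges the two arguments of the Calabi-Yau pairing. With [F X = X^*], the
    space [Hom(X, Y)] becomes [Hom(F Y, F X)] and [Hom(Y, X[n])] becomes [Hom(F X, (F Y)[n])], which
    is the pairing for [(F Y, F X)]. *)

Section LinearExtension.
Variables (k : fieldType) (V : lmodType k).

(** Once it contains [(0, 0)], such a [G] is the graph of a linear form on a subspace,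
    single-valuedness being a matter of the value at [0]. Graphs can be ordered by inclusion for
    Zorn's lemma. *)
Definition partial_form (G : V * k -> Prop) : Prop :=
  (forall a p q, G p -> G q -> G (a *: p.1 + q.1, a * p.2 + q.2)) /\
  (forall b, G (0, b) -> b = 0).

Lemma partial_form_maximal (L : V * k -> Prop) : L (0, 0) -> partial_form L ->
  exists G, [/\ partial_form G, forall p, L p -> G p &
    forall H, partial_form H -> (forall p, G p -> H p) -> forall p, H p -> G p].
Proof.
(* Adjoining [L] settles the empty chain and makes the maximal graph contain [L]. *)
move=> L0 Lf; pose P (A : set (V * k)) := partial_form (fun p => A p \/ L p).
have [F FP Ftot|A [PA maxA]] := @Zorn_bigcup _ P.
  have common p q : (\bigcup_(X in F) X)%classic p \/ L p ->
      (\bigcup_(X in F) X)%classic q \/ L q ->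
      exists Y : set (V * k), [/\ P Y, (forall r, Y r -> (\bigcup_(X in F) X)%classic r),
        Y p \/ L p & Y q \/ L q].
    move=> [[X FX Xp]|Lp] [[Y FY Yq]|Lq].
    - have [XY|YX] := Ftot _ _ FX FY.
        exists Y; split; [exact: FP|by move=> r Yr; exists Y|left; exact: XY|by left].
      exists X; split; [exact: FP|by move=> r Xr; exists X|by left|left; exact: YX].
    - exists X; split; [exact: FP|by move=> r Xr; exists X|by left|by right].
    - exists Y; split; [exact: FP|by move=> r Yr; exists Y|by right|by left].
    - exists set0; split; [|by []|by right|by right].
      rewrite /P; suff -> : (fun p => set0 p \/ L p) = L by [].
      by apply: funext => r; apply: propext; split=> [[]|]; last right.
  split=> [a p q Gp Gq|b Gb].
    have [Y [[PY _] YF Yp Yq]] := common _ _ Gp Gq.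
    by case: (PY a _ _ Yp Yq) => [/YF|]; [left|right].
  by have [Y [[_ PY] _ Yb _]] := common _ _ Gb Gb; exact: PY.
exists (fun p => A p \/ L p); split => // [p|H Hf GH p Hp]; first by right.
left; apply: contrapT => nAp; apply: (maxA H).
  split=> [|HA]; first by move=> q Aq; apply: GH; left.
  exact: nAp (HA _ Hp).
rewrite /P; suff -> : (fun p => H p \/ L p) = H by [].
by apply: funext => q; apply: propext; split=> [[|Lq]|] //; [apply: GH; right|left].
Qed.

Lemma linear_extension (L : V * k -> Prop) : L (0, 0) -> partial_form L ->
  exists f : {linear V -> k^o}, forall v b, L (v, b) -> f v = b.
Proof.
move=> L0 Lf; have [G [[GD Gf] LG Gmax]] := partial_form_maximal L0 Lf.
have G0 : G (0, 0) by exact: LG.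
have Gtot v : exists b, G (v, b).
  apply: contrapT => nGv.
  (* If [v] is outside the domain of [G], sending [v] to [0] extends [G] to the sum of that domain
     and the line of [v], against maximality. *)
  pose H (p : V * k) := exists a w, G (w, p.2) /\ p.1 = w + a *: v.
  have HH : partial_form H.
    split=> [c [_ b] [_ b'] [a [w /= [Gw ->]]] [a' [w' /= [Gw' ->]]]|b /= [a [w /= [Gw]]]].
      exists (c * a + a'), (c *: w + w'); split; first exact: (GD c _ _ Gw Gw').
      by rewrite scalerDr scalerDl scalerA addrACA.
    have [->|a0 /eqP] := eqVneq a 0.
      by rewrite scale0r addr0 => w0; apply: Gf; rewrite [in G _]w0.
    rewrite eq_sym addr_eq0 => /eqP wv; case: nGv; exists (- a^-1 * b + 0).
    have := GD (- a^-1) _ _ Gw G0; rewrite /= wv scalerN scaleNr opprK addr0.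
    by rewrite scalerA mulVf // scale1r.
  have GH p : G p -> H p.
    by case: p => w b Gw; exists 0, w; rewrite scale0r addr0.
  case: nGv; exists 0; apply: (Gmax H HH GH).
  by exists 1, 0; rewrite scale1r add0r.
have Guniq v b b' : G (v, b) -> G (v, b') -> b = b'.
  move=> Gb Gb'; have := GD (-1) _ _ Gb Gb'; rewrite /= scaleN1r addNr.
  by move=> /Gf /eqP; rewrite mulN1r addrC subr_eq0 => /eqP.
pose f v : k^o := projT1 (cid (Gtot v)).
have fP v : G (v, f v) by rewrite /f; case: cid.
have flin : linear f.
  by move=> a u v; apply: Guniq (fP _) _; apply: (GD a (u, f u) (v, f v)).
pose fM := GRing.isLinear.Build k V k^o *:%R f flin.
exists (HB.pack f fM : {linear V -> k^o}) => v b /LG; exact: Guniq (fP v).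
Qed.

Lemma separating_form (P : V -> Prop) (v : V) : subspace P -> ~ P v ->
  exists2 f : {linear V -> k^o}, (forall u, P u -> f u = 0) & f v = 1.
Proof.
move=> [P0 PD] nPv.
(* On [P + k v], the coefficient of [v]. *)
pose L (p : V * k) := exists2 u, P u & p.1 = u + p.2 *: v.
have Lf : partial_form L.
  split=> [a [_ b] [_ b'] [/= u Pu ->] [/= u' Pu' ->]|b [/= u Pu]].
    exists (a *: u + u'); first exact: PD.
    by rewrite /= scalerDr scalerDl scalerA addrACA.
  move=> /eqP; have [->|b0] // := eqVneq b 0.
  rewrite eq_sym addrC addr_eq0 => /eqP bv; case: nPv.
  have -> : v = (- b^-1) *: u + 0.
    by rewrite addr0 scaleNr -scalerN -bv scalerA mulVf // scale1r.
  exact: PD.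
have [|f fP] := linear_extension _ Lf; first by exists 0; rewrite //= scale0r addr0.
exists f => [u Pu|]; apply: fP; last by exists 0; rewrite //= scale1r add0r.
by exists u; rewrite //= scale0r addr0.
Qed.

Lemma form_eq1 (v : V) : v != 0 -> exists f : {linear V -> k^o}, f v = 1.
Proof.
move=> v0; have [| |f _ fv] := @separating_form (eq^~ 0) v; last by exists f.
  by split=> [|a u w -> ->] //; rewrite scaler0 addr0.
exact/eqP.
Qed.

End LinearExtension.

(** On [P] the form [phi] factors through [g], which prescribes [psi] on the image of [P]; the rest
    is extension to [W]. *)
Lemma form_factor (k : fieldType) (V W : lmodType k) (P : V -> Prop)
    (g : {linear V -> W}) (phi : {linear V -> k^o}) :
  subspace P -> (forall v, P v -> g v = 0 -> phi v = 0) ->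
  exists psi : {linear W -> k^o}, forall v, P v -> psi (g v) = phi v.
Proof.
move=> [P0 PD] gphi.
pose L (p : W * k) := exists2 v, P v & p = (g v, phi v).
have L0 : L (0, 0) by exists 0; rewrite ?linear0.
have [|psi psiP] := linear_extension L0; last first.
  by exists psi => v Pv; apply: psiP; exists v.
split=> [a _ _ [u Pu ->] [v Pv ->]|b [v Pv [/esym gv ->]]]; last exact: gphi.
by exists (a *: u + v); [exact: PD|rewrite !linearP].
Qed.

Section Forms.
Variables (k : fieldType) (V : lmodType k).

Definition forms := {linear V -> k^o}.

Lemma forms_ext (f g : forms) : f =1 g -> f = g.
Proof. exact: linear_ext. Qed.

HB.instance Definition _ := gen_eqMixin forms.
HB.instance Definition _ := gen_choiceMixin forms.

Fact forms_addA : associative (fun f g : forms => f \+ g : forms).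
Proof. by move=> f g h; apply: forms_ext => c /=; rewrite addrA. Qed.
Fact forms_addC : commutative (fun f g : forms => f \+ g : forms).
Proof. by move=> f g; apply: forms_ext => c /=; rewrite addrC. Qed.
Fact forms_add0 : left_id (\0 : forms) (fun f g : forms => f \+ g : forms).
Proof. by move=> f; apply: forms_ext => c /=; rewrite add0r. Qed.
Fact forms_addN :
  left_inverse (\0 : forms) (fun f : forms => \- f : forms) (fun f g : forms => f \+ g : forms).
Proof. by move=> f; apply: forms_ext => c /=; rewrite addNr. Qed.

HB.instance Definition _ :=
  GRing.isZmodule.Build forms forms_addA forms_addC forms_add0 forms_addN.

Definition forms_scale (a : k) (f : forms) : forms := a \*: f.

Fact forms_scaleA a b f : forms_scale a (forms_scale b f) = forms_scale (a * b) f.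
Proof. by apply: forms_ext => c /=; rewrite scalerA. Qed.
Fact forms_scale1 : left_id 1 forms_scale.
Proof. by move=> f; apply: forms_ext => c /=; rewrite scale1r. Qed.
Fact forms_scaleDr : right_distributive forms_scale +%R.
Proof. by move=> a f g; apply: forms_ext => c /=; rewrite scalerDr. Qed.
Fact forms_scaleDl f : {morph forms_scale^~ f : a b / a + b}.
Proof. by move=> a b; apply: forms_ext => c /=; rewrite scalerDl. Qed.

HB.instance Definition _ := GRing.Zmodule_isLmodule.Build k forms
  forms_scaleA forms_scale1 forms_scaleDr forms_scaleDl.

Lemma forms_sumE (I : Type) (s : seq I) (F : I -> forms) v :
  (\sum_(i <- s) F i : forms) v = \sum_(i <- s) F i v.
Proof. by elim/big_rec2: _ => // i _ f _ <-. Qed.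

End Forms.

Section Contraction.
Variable k : fieldType.

Fact ctr_key : unit. Proof. by []. Qed.
(** Contraction of the first factor with [f]. Locked, so that simplification stops here and does not
    reach the quotient construction of the tensor product. *)
Definition ctr (V W : lmodType k) (f : {linear V -> k^o}) : {linear tensor V W -> W} :=
  locked_with ctr_key (tunitl W \o tmap f (idlin W) : {linear _ -> _}).

Lemma ctr_unlock (V W : lmodType k) (f : {linear V -> k^o}) (t : tensor V W) :
  ctr W f t = tunitl W (tmap f (idlin W) t).
Proof. by rewrite /ctr locked_withE. Qed.

Lemma ctrE (V W : lmodType k) (f : {linear V -> k^o}) v (w : W) :
  ctr W f (tens v w) = f v *: w.
Proof. by rewrite ctr_unlock tmapE /tunitl /= tlift_tens. Qed.

Lemma ctr_eq (V W : lmodType k) (f g : {linear V -> k^o}) (t : tensor V W) :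
  f =1 g -> ctr W f t = ctr W g t.
Proof. by move=> /linear_ext ->. Qed.

Lemma ctr_tmap (V V' W W' : lmodType k) (h : {linear V -> V'}) (g : {linear W -> W'})
    (f : {linear V' -> k^o}) t :
  ctr W' f (tmap h g t) = g (ctr W (f \o h) t).
Proof.
suff H : ctr W' f \o tmap h g =1 g \o ctr W (f \o h) by exact: (H t).
by apply: tens_ext => v w; rewrite /= tmapE !ctrE linearZ.
Qed.

Lemma ctr_tmapr (V W W' : lmodType k) (g : {linear W -> W'}) (f : {linear V -> k^o}) t :
  ctr W' f (tmap (idlin V) g t) = g (ctr W f t).
Proof. by rewrite ctr_tmap; congr (g _); exact: ctr_eq. Qed.

(** A biorthogonal presentation, built one term at a time as in Gram-Schmidt: the forms [f i] are
    produced along with the vectors [a i], without choosing a basis of [V]. *)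
Lemma tens_dual_basis (V W : lmodType k) (t : tensor V W) :
  exists r (a : 'I_r -> V) (b : 'I_r -> W) (f : 'I_r -> forms V),
    (forall i j, f i (a j) = (i == j)%:R) /\ t = \sum_i tens (a i) (b i).
Proof.
rewrite (tensE t); elim: (repr t) => [|[x y] s [r [a [b [f [fa IH]]]]]].
  exists 0, (fun=> 0), (fun=> 0), (fun=> 0).
  by split=> [[]|] //; rewrite !(big_nil, big_ord0).
(* [x'] is the part of [x] killed by all [f j]; the rest lies in the span of the [a j], and its
   contribution is absorbed into the [b j]. *)
rewrite big_cons {}IH /=; pose x' := x - \sum_j f j x *: a j.
have fx' i : f i x' = 0.
  rewrite linearB linear_sum /= (bigD1 i) //= big1 => [|j ji].
    by rewrite linearZ /= fa eqxx [_ *: _]mulr1 addr0 subrr.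
  by rewrite linearZ /= fa eq_sym (negPf ji) scaler0.
have {1}-> : x = x' + \sum_j f j x *: a j by rewrite subrK.
pose b' j := f j x *: y + b j.
have -> : tens (x' + \sum_j f j x *: a j) y + \sum_i tens (a i) (b i) =
    tens x' y + \sum_i tens (a i) (b' i).
  rewrite linearDl -addrA linear_sumlz -big_split; congr (_ + _).
  by apply: eq_bigr => j _; rewrite linearDr linearZl_LR linearZr_LR.
have [->|/form_eq1 [g gx']] := eqVneq x' 0.
  by exists r, a, b', f; rewrite linear0l add0r.
(* The correction makes the new form vanish on the old [a j]; it keeps the value [1] at [x'], which
   the [f j] kill. *)
pose g' : forms V := (g : forms V) - \sum_j (g (a j) : k) *: (f j : forms V).
have g'E v : g' v = g v - \sum_j g (a j) *: f j v.
  by rewrite /g' /= forms_sumE.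
pose cons (T : Type) (x : T) (h : 'I_r -> T) i := if unlift ord0 i is Some j then h j else x.
exists r.+1, (cons _ x' a), (cons _ y b'), (cons _ g' f); split.
  move=> i j; rewrite /cons; case: unliftP => [i'|] ->; case: unliftP => [j'|] ->.
  - by rewrite fa (inj_eq lift_inj).
  - by rewrite fx'.
  - rewrite g'E (bigD1 j') //= big1 ?addr0 => [|l lj].
      by rewrite fa eqxx [_ *: _]mulr1 subrr.
    by rewrite fa (negPf lj) scaler0.
  - by rewrite g'E big1 ?subr0 // => l _; rewrite fx' scaler0.
rewrite big_ord_recl /cons unlift_none; congr (_ + _).
by apply: eq_bigr => j _; rewrite liftK.
Qed.

Lemma ctr_basis (V W : lmodType k) (t : tensor V W) :
  exists r (a : 'I_r -> V) (f : 'I_r -> forms V),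
    t = \sum_i tens (a i) (ctr W (f i) t).
Proof.
have [r [a [b [f [fa tE]]]]] := tens_dual_basis t.
exists r, a, f; rewrite {1}tE; apply: eq_bigr => i _; congr (tens _ _).
rewrite tE linear_sum (bigD1 i) //= big1 ?addr0 => [|j ji]; rewrite ctrE fa.
  by rewrite eqxx scale1r.
by rewrite eq_sym (negPf ji) scale0r.
Qed.

(** This turns identities between coactions into identities between actions of [C^*]. *)
Lemma ctr_inj (V W : lmodType k) (t u : tensor V W) :
  (forall f, ctr W f t = ctr W f u) -> t = u.
Proof.
move=> tu; apply/eqP; rewrite -subr_eq0; apply/eqP.
have [r [a [f ->]]] := ctr_basis (t - u).
by apply: big1 => i _; rewrite linearB /= tu subrr linear0r.
Qed.

End Contraction.

(** * Comodules as rational modules over the dual algebra *)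

Section Action.
Variables (k : fieldType) (C : coalgebra k).

Fact lact_key : unit. Proof. by []. Qed.
(** In Sweedler notation, [m] goes to the sum of [f(m_(-1)) m_(0)]. This is a right action, whence
    the order of the factors in [lactM]. *)
Definition lact (M : lcomodule C) (f : dual C) : {linear M -> M} :=
  locked_with lact_key (ctr M f \o lcoact M : {linear _ -> _}).

Lemma lactE M f m : lact M f m = ctr M f (lcoact M m).
Proof. by rewrite /lact locked_withE. Qed.

Lemma ctr_prod (M : lmodType k) (f g : dual C) (t : tensor C M) :
  ctr M g (ctr _ f (tassoc _ _ _ (tmap (comul C) (idlin M) t))) = ctr M (f * g) t.
Proof.
suff H : ctr M g \o (ctr _ f \o tassoc _ _ _) =1 ctr M (tprod f g).
  by have /= -> := H (tmap (comul C) (idlin M) t); rewrite ctr_tmap.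
by apply: tens_ext3 => u v w; rewrite /= tassocE !ctrE linearZ /= ctrE tprodE scalerA.
Qed.

Lemma lactM M f g m : lact M g (lact M f m) = lact M (f * g) m.
Proof.
rewrite !lactE -ctr_prod lcoactA.
by rewrite ctr_tmapr.
Qed.

Lemma lact1 M m : lact M 1 m = m.
Proof. by rewrite lactE ctr_unlock; exact: lcoact1. Qed.

Lemma lactD M f g m : lact M (f + g) m = lact M f m + lact M g m.
Proof.
rewrite !lactE; suff H : ctr M (f + g) =1 ctr M f \+ ctr M g by exact: H.
by apply: tens_ext => v w; rewrite /= !ctrE scalerDl.
Qed.

Lemma lact_rational M m : exists r (a : 'I_r -> C) (f : 'I_r -> dual C),
  lcoact M m = \sum_i tens (a i) (lact M (f i) m).
Proof.
have [r [a [f E]]] := ctr_basis (lcoact M m); exists r, a, f; rewrite {1}E.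
by apply: eq_bigr => i _; rewrite lactE.
Qed.

Lemma lcomod_homP (M N : lcomodule C) (f : {linear M -> N}) :
  lcomod_hom f <-> forall g m, f (lact M g m) = lact N g (f m).
Proof.
split=> [fC g m|fC m]; first by rewrite !lactE fC ctr_tmapr.
by apply: ctr_inj => g; rewrite -lactE -fC ctr_tmapr lactE.
Qed.

Section Rational.
Variables (Q : lmodType k) (act : dual C -> {linear Q -> Q}).
Hypothesis actM : forall f g q, act g (act f q) = act (f * g) q.
Hypothesis act1 : forall q, act 1 q = q.
Hypothesis act_rational : forall q, exists t : tensor C Q, forall f, ctr Q f t = act f q.

Definition rat_coact_fun (q : Q) : tensor C Q := projT1 (cid (act_rational q)).

Lemma rat_coact_funE f q : ctr Q f (rat_coact_fun q) = act f q.
Proof. by rewrite /rat_coact_fun; case: cid => t /= ->. Qed.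

Fact rat_coact_linear : linear rat_coact_fun.
Proof.
by move=> a p q; apply: ctr_inj => f; rewrite linearP /= !rat_coact_funE linearP.
Qed.

HB.instance Definition _ :=
  GRing.isLinear.Build k Q (tensor C Q) *:%R rat_coact_fun rat_coact_linear.

Definition rat_coact : {linear Q -> tensor C Q} := rat_coact_fun.

(** A right [C^*]-action is a coaction as soon as its value at each element is given by a tensor. By
    [ctr_inj] that tensor is unique, hence linear in [q] and coassociative. *)
Definition rat_comodule : lcomodule C.
Proof.
exists Q rat_coact => m.
  apply: ctr_inj => f; apply: ctr_inj => g; rewrite ctr_prod ctr_tmapr.
  by rewrite /= !rat_coact_funE actM.
by have := rat_coact_funE (1 : dual C) m; rewrite ctr_unlock act1.
Defined.

Lemma rat_lactE f q : lact rat_comodule f q = act f q.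
Proof. by rewrite lactE; exact: rat_coact_funE. Qed.

End Rational.
End Action.

(** * Finitely generated modules over the dual algebra *)

Section Submodule.
Variables (R : pzRingType) (V : lmodType R).

Definition submodule (S : V -> Prop) : Prop :=
  S 0 /\ forall a u v, S u -> S v -> S (a *: u + v).

Lemma submodZ S a u : submodule S -> S u -> S (a *: u).
Proof. by move=> [S0 SP] Su; rewrite -[_ *: _]addr0; apply: SP. Qed.
Lemma submodD S u v : submodule S -> S u -> S v -> S (u + v).
Proof. by move=> [S0 SP] Su Sv; rewrite -[u]scale1r; apply: SP. Qed.
Lemma submodB S u v : submodule S -> S u -> S v -> S (u - v).
Proof. by move=> [S0 SP] Su Sv; rewrite addrC -scaleN1r; apply: SP. Qed.

(** Peeling off one generator at a time matches the inductions on the number of generators. *)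
Fixpoint span (l : seq V) (x : V) : Prop :=
  if l is v :: l' then exists a, span l' (x - a *: v) else x = 0.

Lemma span_submod l : submodule (span l).
Proof.
elim: l => [|v l [IH0 IH]]; first by split=> //= a u w -> ->; rewrite scaler0 addr0.
split=> [|a u w [b ub] [c wc]]; first by exists 0; rewrite scale0r subr0.
exists (a * b + c).
by rewrite scalerDl -scalerA opprD addrACA -scalerBr; apply: IH.
Qed.

Lemma span_cons v l x : span l x -> span (v :: l) x.
Proof. by move=> lx; exists 0; rewrite scale0r subr0. Qed.

Lemma span_mem l x : x \in l -> span l x.
Proof.
elim: l => //= v l IH; rewrite inE => /predU1P[->|/IH]; last exact: span_cons.
by exists 1; rewrite scale1r subrr; case: (span_submod l).
Qed.

Lemma span_sub l S : submodule S -> (forall x, x \in l -> S x) ->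
  forall x, span l x -> S x.
Proof.
move=> HS; elim: l => [|v l IH] lS x /=; first by move=> ->; case: HS.
move=> [a /IH xa]; rewrite -(subrK (a *: v) x); apply: submodD => //.
  by apply: xa => y yl; apply: lS; rewrite inE yl orbT.
by apply: submodZ => //; apply: lS; rewrite mem_head.
Qed.

Definition fin_gen (S : V -> Prop) : Prop := exists l, forall x, S x <-> span l x.

Definition sublmod S of submodule S : Type := {x : V | S x}.

Section SubLmod.
Variables (S : V -> Prop) (HS : submodule S).

HB.instance Definition _ := gen_eqMixin (sublmod HS).
HB.instance Definition _ := gen_choiceMixin (sublmod HS).

Lemma sublmod_ext (x y : sublmod HS) : sval x = sval y -> x = y.
Proof. by case: x y => [x Sx] [y Sy] /= xy; exact: eq_exist. Qed.

Definition sub_zero : sublmod HS := exist _ 0 HS.1.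
Definition sub_add (x y : sublmod HS) : sublmod HS :=
  exist _ _ (submodD HS (proj2_sig x) (proj2_sig y)).
Definition sub_scale a (x : sublmod HS) : sublmod HS :=
  exist _ _ (submodZ a HS (proj2_sig x)).

Fact sub_addA : associative sub_add.
Proof. by move=> x y z; apply: sublmod_ext; rewrite /= addrA. Qed.
Fact sub_addC : commutative sub_add.
Proof. by move=> x y; apply: sublmod_ext; rewrite /= addrC. Qed.
Fact sub_add0 : left_id sub_zero sub_add.
Proof. by move=> x; apply: sublmod_ext; rewrite /= add0r. Qed.
Fact sub_addN : left_inverse sub_zero (sub_scale (-1)) sub_add.
Proof. by move=> x; apply: sublmod_ext; rewrite /= scaleN1r addNr. Qed.
HB.instance Definition _ :=
  GRing.isZmodule.Build (sublmod HS) sub_addA sub_addC sub_add0 sub_addN.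

Fact sub_scaleA a b x : sub_scale a (sub_scale b x) = sub_scale (a * b) x.
Proof. by apply: sublmod_ext; rewrite /= scalerA. Qed.
Fact sub_scale1 : left_id 1 sub_scale.
Proof. by move=> x; apply: sublmod_ext; rewrite /= scale1r. Qed.
Fact sub_scaleDr : right_distributive sub_scale +%R.
Proof. by move=> a x y; apply: sublmod_ext; rewrite /= scalerDr. Qed.
Fact sub_scaleDl x : {morph sub_scale^~ x : a b / a + b}.
Proof. by move=> a b; apply: sublmod_ext; rewrite /= scalerDl. Qed.
HB.instance Definition _ := GRing.Zmodule_isLmodule.Build R (sublmod HS)
  sub_scaleA sub_scale1 sub_scaleDr sub_scaleDl.

Definition sub_val (x : sublmod HS) : V := sval x.
Fact sub_val_linear : linear sub_val.
Proof. by []. Qed.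
HB.instance Definition _ :=
  GRing.isLinear.Build R (sublmod HS) V *:%R sub_val sub_val_linear.

Lemma sub_val_inj : injective sub_val.
Proof. exact: sublmod_ext. Qed.

Lemma sub_valP x : S (sub_val x).
Proof. exact: proj2_sig. Qed.

End SubLmod.

End Submodule.

Lemma sublmod_span_fin_gen (R : pzRingType) (V : lmodType R) (l : seq V) :
  exists l' : seq (sublmod (span_submod l)), forall x, span l' x.
Proof.
have lift S (HS : submodule S) : forall m : seq V, (forall x, x \in m -> S x) ->
    exists m' : seq (sublmod HS), map (@sub_val R V S HS) m' = m.
  elim=> [|v m IH] mS; first by exists [::].
  have [|m' <-] := IH; first by move=> x xm; apply: mS; rewrite inE xm orbT.
  by exists (exist _ v (mS v (mem_head _ _)) :: m').
have [l' l'l] := lift _ (span_submod l) l (@span_mem _ _ l).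
have span_val S (HS : submodule S) (m : seq (sublmod HS)) x :
    span (map (@sub_val R V S HS) m) (sub_val x) -> span m x.
  elim: m x => /= [|v m IH] x; first by move=> x0; apply: sub_val_inj; rewrite x0.
  move=> [a xa]; exists a; apply: IH; rewrite linearB; exact: xa.
by exists l' => x; apply: span_val; rewrite l'l; exact: sub_valP.
Qed.

Section Noetherian.
Variables (R : pzRingType).
Hypothesis ideal_fin_gen : forall S : R^o -> Prop, submodule S -> fin_gen S.

(** The usual induction over a noetherian ring: split off the ideal of coefficients of the first
    generator. *)
Lemma sub_span_fin_gen (V : lmodType R) (l : seq V) (S : V -> Prop) :
  submodule S -> (forall x, S x -> span l x) -> fin_gen S.
Proof.
elim: l S => [|v l IH] S HS Sl.
  by exists [::] => x; split=> [/Sl|->] //; case: HS.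
(* The coefficients of [v] in elements of [S]. *)
pose J (a : R^o) := exists2 s, S s & span l (s - (a : R) *: v).
have [|la laP] := @ideal_fin_gen J.
  split=> [|a u w [s Ss su] [t St tw]].
    by exists 0; [case: HS|rewrite scale0r subr0; case: (span_submod l)].
  exists (a *: s + t); first by case: HS => _; apply.
  rewrite scalerDl -scalerA opprD addrACA -scalerBr.
  by case: (span_submod l) => _; apply.
(* Generators of [J] are lifted to [S]; then each element of [J] has a lift in the span of these
   lifts. *)
have [ls [lsS lsP]] : exists ls, (forall s, s \in ls -> S s) /\
    forall a : R^o, span la a -> exists2 s, span ls s & span l (s - (a : R) *: v).
  have : forall a, a \in la -> J a by move=> a /span_mem /laP.
  elim: la {laP} => [|a la IHa] laJ.
    exists [::]; split => // a ->; exists 0 => //; rewrite scale0r subr0.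
    by case: (span_submod l).
  have [|ls [lsS lsP]] := IHa; first by move=> b bl; apply: laJ; rewrite inE bl orbT.
  have [s Ss sa] := laJ _ (mem_head _ _).
  exists (s :: ls); split=> [t|b /= [c /lsP [t lst tb]]].
    by rewrite inE => /predU1P[->|/lsS].
  exists (c *: s + t); first by exists c; rewrite addrC addKr.
  have -> : c *: s + t - (b : R) *: v =
      c *: (s - (a : R) *: v) + (t - ((b - c *: a : R^o) : R) *: v).
    have E : ((c *: a : R^o) : R) *: v = c *: ((a : R) *: v) by rewrite scalerA.
    rewrite scalerBr [(_ - _ : R) *: v]scalerBl E opprB.
    by rewrite [t + _]addrCA !addrA subrK.
  by case: (span_submod l) => _; apply.
(* What remains after subtracting such a lift lies both in [S] and in the span of [l]. *)
have [||l' l'P] := IH (fun x => S x /\ span l x); last 1 first.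
- exists (ls ++ l') => x; split; last first.
    apply: span_sub => // y; rewrite mem_cat => /orP[/lsS //|/span_mem /l'P []] //.
  move=> Sx; have [a xa] := Sl _ Sx.
  have [s ss sa] := lsP a ((laP a).1 (ex_intro2 _ _ x Sx xa)).
  rewrite -(subrK s x); apply: submodD; first exact: span_submod.
    have /l'P : S (x - s) /\ span l (x - s).
      split; first by apply: submodB => //; exact: span_sub ss.
      have -> : x - s = (x - a *: v) - (s - a *: v) by rewrite opprB addrA subrK.
      by apply: submodB => //; exact: span_submod.
    apply: span_sub => [|y yl]; first exact: span_submod.
    by apply: span_mem; rewrite mem_cat yl orbT.
  apply: span_sub ss => [|y yl]; first exact: span_submod.
  by apply: span_mem; rewrite mem_cat yl.
- split=> [|a u w [Su lu] [Sw lw]].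
    by split; [case: HS|case: (span_submod l)].
  by split; [case: HS => _; apply|case: (span_submod l) => _; apply].
- by move=> x [].
Qed.

End Noetherian.

(** * The dual of a comodule and its closed submodules *)

Section DualModule.
Variables (k : fieldType) (C : coalgebra k) (M : lcomodule C).

Definition cdual := forms M.
HB.instance Definition _ := GRing.Zmodule.on cdual.

Definition cdual_scale (f : dual_algebra C) (phi : cdual) : cdual := phi \o lact M f.

Fact cdual_scaleA f g phi : cdual_scale f (cdual_scale g phi) = cdual_scale (f * g) phi.
Proof. by apply: forms_ext => m /=; rewrite lactM. Qed.
Fact cdual_scale1 : left_id 1 cdual_scale.
Proof. by move=> phi; apply: forms_ext => m /=; rewrite lact1. Qed.
Fact cdual_scaleDr : right_distributive cdual_scale +%R.
Proof. by move=> f phi psi; apply: forms_ext. Qed.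
Fact cdual_scaleDl phi : {morph cdual_scale^~ phi : f g / f + g}.
Proof. by move=> f g; apply: forms_ext => m /=; rewrite lactD linearD. Qed.

HB.instance Definition _ := GRing.Zmodule_isLmodule.Build (dual_algebra C) cdual
  cdual_scaleA cdual_scale1 cdual_scaleDr cdual_scaleDl.

Lemma cdual_scaleE (f : dual_algebra C) (phi : cdual) m : (f *: phi) m = phi (lact M f m).
Proof. by []. Qed.

Lemma cdual_sumE (I : Type) (r : seq I) (a : I -> dual_algebra C) (F : I -> cdual) m :
  (\sum_(i <- r) a i *: F i : cdual) m = \sum_(i <- r) F i (lact M (a i) m).
Proof. by rewrite forms_sumE. Qed.

(** Consequently the [k]-structure that [resk] puts on the dual of [M] is the pointwise one. *)
Lemma lact_in a m : lact M (alg_in (dual_algebra C) a) m = a *: m.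
Proof.
rewrite lactE -[in RHS](lact1 m) lactE.
suff H : ctr M (a \*: counit C) =1 a \*: ctr M (counit C) by exact: H.
by apply: tens_ext => v w; rewrite /= !ctrE scalerA.
Qed.

Definition annihilator (S : cdual -> Prop) (m : M) : Prop := forall phi, S phi -> phi m = 0.

Lemma annihilator_subspace S : subspace (annihilator S).
Proof.
split=> [phi _|a u v Su Sv phi Sphi]; first exact: linear0.
by rewrite linearP Su // Sv // scaler0 addr0.
Qed.

Lemma annihilator_lact S f m : submodule S -> annihilator S m -> annihilator S (lact M f m).
Proof. by move=> HS Sm phi Sphi; rewrite -cdual_scaleE; apply: Sm; exact: submodZ. Qed.

Lemma annihilator_lsubcomodule S : submodule S -> lsubcomodule (annihilator S).
Proof.
move=> HS; split=> [|m Sm]; first exact: annihilator_subspace.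
have [r [a [f ->]]] := lact_rational m.
exists [seq (a i, lact M (f i) m) | i <- enum 'I_r].
  by move=> _ /mapP[i _ ->]; split => //; exact: annihilator_lact.
by rewrite big_map big_enum.
Qed.

(** The coefficient map, sending [m] to the sum of [m_(-1) phi(m_(0))]. The multiples [h *: phi] are
    exactly the forms that factor through it, with [h] as the second factor. *)
Definition rcoef (phi : {linear M -> k^o}) : {linear M -> C} :=
  tunitr C \o (tmap (idlin C) phi \o lcoact M).

Lemma rcoefE (h : dual C) (phi : {linear M -> k^o}) m : h (rcoef phi m) = phi (lact M h m).
Proof.
suff H : h \o (tunitr C \o tmap (idlin C) phi) =1 phi \o ctr M h.
  by rewrite lactE; exact: H.
apply: tens_ext => c v; rewrite /= ctrE tmapE /= tlift_tens /tunitr_fun.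
by rewrite !linearZ; exact: mulrC.
Qed.

(* Finitely generated submodules of M^* are closed: by induction on the
   generators, a form vanishing on the annihilator of l and r differs from a
   multiple h r of r by a form vanishing on the annihilator of l. *)
Lemma closed_span (l : seq cdual) (f : cdual) :
  (forall m, annihilator (span l) m -> f m = 0) -> span l f.
Proof.
elim: l f => [|r l IH] f fl.
  by apply: forms_ext => m; apply: fl => phi ->.
have [m Pm gm|h hP] := @form_factor _ _ _ (annihilator (span l)) (rcoef r) f
  (annihilator_subspace _).
  apply: fl => phi [a /Pm].
  move=> /eqP; rewrite subr_eq0 => /eqP ->.
  by rewrite cdual_scaleE -rcoefE gm linear0.
exists (h : dual_algebra C); apply: IH => m Pm.
have -> : (f - (h : dual_algebra C) *: r) m = f m - r (lact M h m) by [].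
by rewrite -rcoefE hP // subrr.
Qed.

End DualModule.

Section Artinian.
Variables (k : fieldType) (C : coalgebra k).

(** This identifies the dual of the regular comodule with [C^*] as a left module over itself. *)
Lemma lact_lregular (f : dual C) (c : C) (phi : dual C) :
  phi (lact (lregular C) f c) = (f * phi) c.
Proof.
rewrite lactE; suff H : phi \o ctr C f =1 tprod f phi by exact: H.
by apply: tens_ext => a b; rewrite /= ctrE tprodE linearZ.
Qed.

Lemma span_lregular (l : seq (dual C)) (f : dual C) :
  @span (dual_algebra C) (cdual (lregular C)) l f ->
  @span (dual_algebra C) (dual_algebra C)^o l f.
Proof.
elim: l f => //= r l IH f [a fa]; exists a; apply: IH.
suff -> : (f : dual_algebra C) - a * r =
  ((f : cdual (lregular C)) - a *: (r : cdual (lregular C))) by [].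
apply: dual_ext => c.
have -> : ((f : cdual (lregular C)) - a *: (r : cdual (lregular C))) c =
  f c - r (lact (lregular C) a c) by [].
by rewrite lact_lregular.
Qed.

(** Annihilators in [C] turn a strictly increasing chain of finitely generated ideals into a
    descending chain of subcomodules, and [closed_span] shows that no strict step is lost. *)
Lemma artinian_ideal_fin_gen (S : (dual_algebra C)^o -> Prop) :
  lartinian (lregular C) -> submodule S -> fin_gen S.
Proof.
move=> Cart HS; apply: contrapT => nS.
pose below (l : seq (dual_algebra C)^o) := forall x, span l x -> S x.
have next (L : {l | below l}) : exists f, S f /\ ~ span (sval L) f.
  apply: contrapT => nL; apply: nS; exists (sval L) => x; split; last exact: (proj2_sig L).
  by move=> Sx; apply: contrapT => nx; apply: nL; exists x.
pose new L := projT1 (cid (next L)).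
have [Snew nnew] : (forall L, S (new L)) /\ (forall L, ~ span (sval L) (new L)).
  by split=> L; rewrite /new; case: cid => f [].
have step (L : {l | below l}) : below (new L :: sval L).
  move=> x [a xa]; rewrite -(subrK (a *: new L) x); apply: submodD => //.
    exact: (proj2_sig L).
  by apply: submodZ (Snew L).
have below0 : below [::] by move=> x ->; case: HS.
pose chain n := iter n (fun L => exist below _ (step L)) (exist below _ below0).
pose sp n : cdual (lregular C) -> Prop :=
  @span (dual_algebra C) (cdual (lregular C)) (sval (chain n)).
have [||i0 i0P] := Cart (fun n => annihilator (sp n)).
- by move=> n; apply: annihilator_lsubcomodule; exact: span_submod.
- by move=> n x nx phi nphi; apply: nx; exact: span_cons.
(* At the stable index the new generator vanishes on the annihilator of the old span, hence already
   lies in that span. *)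
apply: (nnew (chain i0)); apply: span_lregular; apply: closed_span => m /i0P.
move=> /(_ i0.+1 (leqnSn _)); apply; exists 1; rewrite scale1r subrr.
by case: (span_submod (V := cdual (lregular C)) (sval (chain i0))).
Qed.
End Artinian.

(** * The finite dual *)

Section Pullback.
Variables (k : fieldType) (V W : lmodType k) (u : {linear V -> W}).

Definition pull_fun (phi : forms W) : forms V := phi \o u.
Fact pull_linear : linear pull_fun.
Proof. by move=> a f g; exact: forms_ext. Qed.
HB.instance Definition _ :=
  GRing.isLinear.Build k (forms W) (forms V) *:%R pull_fun pull_linear.
Definition pull : {linear forms W -> forms V} := pull_fun.

Lemma pullE phi v : pull phi v = phi (u v).
Proof. by []. Qed.

End Pullback.

Section FiniteDual.
Variables (k : fieldType) (C : coalgebra k).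
Local Notation A := (dual_algebra C).

Section Object.
Variable P : lmodType A.

Definition asc_fun (f : A) (p : resk P) : resk P := f *: (p : P).
Fact asc_linear f : linear (asc_fun f).
Proof.
move=> a p q; rewrite /asc_fun scalerDr; congr (_ + _).
have E : f *: (alg_in A a *: (p : P)) = alg_in A a *: (f *: (p : P)).
  by rewrite !scalerA alg_inC.
exact: E.
Qed.
HB.instance Definition _ f :=
  GRing.isLinear.Build k (resk P) (resk P) *:%R (asc_fun f) (asc_linear f).
Definition asc (f : A) : {linear resk P -> resk P} := asc_fun f.

(* The forms theta on P such that theta (f p) is a finite sum of terms
   f(c_j) theta_j(p); they make up the finite dual of P. *)
Definition representative (theta : forms (resk P)) : Prop :=
  exists t : tensor C (forms (resk P)), forall f : dual C, ctr _ f t = pull (asc f) theta.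

Fact representative_submod : @submodule k _ representative.
Proof.
split=> [|a p q [t tp] [s sq]].
  by exists 0 => f; rewrite !linear0.
by exists (a *: t + s) => f; rewrite !linearP tp sq.
Qed.

Lemma pull_ascM (f g : A) theta : pull (asc g) (pull (asc f) theta) = pull (asc (f * g)) theta.
Proof.
by apply: forms_ext => p; rewrite !pullE; congr (theta _); exact: (@scalerA A P).
Qed.

(** Since [(f * g) c = g (lact (lregular C) f c)], it suffices to move the first factors of the
    representing tensor by [f]. *)
Lemma representative_asc f theta :
  representative theta -> representative (pull (asc f) theta).
Proof.
move=> [t tP]; exists (tmap (lact (lregular C) f) (idlin _) t) => g.
rewrite ctr_tmap /= pull_ascM -tP; apply: ctr_eq => c.
exact: lact_lregular.
Qed.

Definition rdual : lmodType k := sublmod representative_submod.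

Definition ract_fun (f : A) (x : rdual) : rdual :=
  exist _ _ (representative_asc f (sub_valP x)).
Fact ract_linear f : linear (ract_fun f).
Proof. by move=> a x y; apply: sub_val_inj; apply: forms_ext. Qed.
HB.instance Definition _ f :=
  GRing.isLinear.Build k rdual rdual *:%R (ract_fun f) (ract_linear f).
Definition ract (f : dual C) : {linear rdual -> rdual} := ract_fun f.

Fact ractM f g x : ract g (ract f x) = ract (f * g) x.
Proof. by apply: sub_val_inj; exact: pull_ascM. Qed.

Fact ract1 x : ract 1 x = x.
Proof.
apply: sub_val_inj; apply: forms_ext => p; congr (sub_val x _); exact: (@scale1r A P).
Qed.

(** The second factors of the tensor have to be representative themselves. By [ctr_basis] they can
    be taken to be contractions of a representing tensor, that is, translates of [x]. *)
Fact ract_rational (x : rdual) : exists t : tensor C rdual, forall f, ctr _ f t = ract f x.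
Proof.
case: x => theta Hx; have [t tP] := Hx; have [r [a [f tE]]] := ctr_basis t.
exists (\sum_i tens (a i) (ract (f i) (exist _ theta Hx : rdual))) => g.
apply: sub_val_inj; rewrite -[RHS]tP tE !linear_sum; apply: eq_bigr => i _.
by rewrite !ctrE linearZ tP.
Qed.

Definition rdual_comod : lcomodule C := rat_comodule ractM ract1 ract_rational.

Lemma rdual_lactE f (x : rdual) p :
  sub_val (lact rdual_comod f x : rdual) p = sub_val x (f *: (p : P)).
Proof. by rewrite rat_lactE. Qed.

Lemma rdual_ext (x y : rdual) : sub_val x =1 sub_val y -> x = y.
Proof. by move=> xy; apply: sub_val_inj; exact: forms_ext. Qed.

End Object.

Section Unit.
Variable P : lmodType A.

Definition ev_fun (p : P) (x : rdual_comod P) : k^o := sub_val (x : rdual P) p.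
Fact ev_fun_linear p : linear (ev_fun p).
Proof. by []. Qed.
HB.instance Definition _ p :=
  GRing.isLinear.Build k (rdual_comod P) k^o *:%R (ev_fun p) (ev_fun_linear p).
Definition ev (p : resk P) : resk (cdual (rdual_comod P)) :=
  (ev_fun p : {linear rdual_comod P -> k^o}).

Lemma evZ (f : A) (p : P) : ev (f *: p) = f *: (ev p : cdual (rdual_comod P)).
Proof. by apply: forms_ext => x; rewrite cdual_scaleE /= /ev_fun rdual_lactE. Qed.

Fact ev_linear : linear ev.
Proof.
move=> a p q; transitivity (ev (a *: p) + ev q).
  by apply: forms_ext => x /=; rewrite /ev_fun linearD.
by congr (_ + _); exact: evZ.
Qed.
HB.instance Definition _ :=
  GRing.isLinear.Build k (resk P) (resk (cdual (rdual_comod P))) *:%R ev ev_linear.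

Lemma ev_hom : module_hom (ev : {linear _ -> _}).
Proof. exact: evZ. Qed.

End Unit.
End FiniteDual.

Lemma span_sumP (R : pzRingType) (V : lmodType R) (l : seq V) x :
  span l x -> exists a : nat -> R, x = \sum_(i < size l) a i *: l`_i.
Proof.
elim: l x => [|v l IH] x /=; first by move=> ->; exists (fun=> 0); rewrite big_ord0.
move=> [b /IH [a xa]]; exists (fun i => if i is j.+1 then a j else b).
by rewrite big_ord_recl /= -xa addrC subrK.
Qed.

(** * Reflexivity of finitely generated modules *)

Section Reflexive.
Variables (k : fieldType) (C : coalgebra k).
Local Notation A := (dual_algebra C).

Section Copower.
Variable n : nat.
(** The comodule [C^n]. Its dual is free of rank [n], so every module with [n] generators is a
    quotient of the dual of a comodule. *)
Definition copow := {ffun 'I_n -> C}.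

Definition inj_fun (i : 'I_n) (c : C) : copow := [ffun j => if i == j then c else 0].
Fact inj_linear i : linear (inj_fun i).
Proof.
move=> a c d; apply/ffunP => j; rewrite !ffunE.
by case: ifP; rewrite ?scaler0 ?addr0.
Qed.
HB.instance Definition _ i :=
  GRing.isLinear.Build k C copow *:%R (inj_fun i) (inj_linear i).
Definition inj i : {linear C -> copow} := inj_fun i.

Definition proj_fun (i : 'I_n) (c : copow) : C := c i.
Fact proj_linear i : linear (proj_fun i).
Proof. by move=> a c d; rewrite /proj_fun !ffunE. Qed.
HB.instance Definition _ i :=
  GRing.isLinear.Build k copow C *:%R (proj_fun i) (proj_linear i).
Definition proj i : {linear copow -> C} := proj_fun i.

Lemma copow_sum (c : copow) : c = \sum_i inj i (c i).
Proof.
apply/ffunP => j; rewrite sum_ffunE (bigD1 j) //= big1 ?addr0 => [|i ij].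
  by rewrite ffunE eqxx.
by rewrite ffunE (negPf ij).
Qed.

Definition copow_act_fun (f : dual C) (c : copow) : copow :=
  [ffun i => lact (lregular C) f (c i)].
Fact copow_act_linear f : linear (copow_act_fun f).
Proof. by move=> a c d; apply/ffunP => i; rewrite !ffunE linearP. Qed.
HB.instance Definition _ f :=
  GRing.isLinear.Build k copow copow *:%R (copow_act_fun f) (copow_act_linear f).
Definition copow_act f : {linear copow -> copow} := copow_act_fun f.

Fact copow_actM f g c : copow_act g (copow_act f c) = copow_act (f * g) c.
Proof. by apply/ffunP => i; rewrite !ffunE lactM. Qed.
Fact copow_act1 c : copow_act 1 c = c.
Proof. by apply/ffunP => i; rewrite !ffunE lact1. Qed.
Fact copow_act_rational c : exists t : tensor C copow, forall f, ctr _ f t = copow_act f c.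
Proof.
exists (\sum_i tmap (idlin C) (inj i) (comul C (c i))) => f.
rewrite linear_sum [RHS]copow_sum; apply: eq_bigr => i _.
by rewrite ctr_tmapr /= ffunE lactE.
Qed.

Definition copower : lcomodule C := rat_comodule copow_actM copow_act1 copow_act_rational.

Lemma copower_lactE f (c : copow) : lact copower f c = copow_act f c.
Proof. exact: rat_lactE. Qed.

Definition comp_inj (phi : cdual copower) (i : 'I_n) : dual C :=
  (phi : {linear copow -> k^o}) \o inj i.

Lemma comp_injZ (f : A) (phi : cdual copower) i :
  comp_inj (f *: phi) i = f * comp_inj phi i.
Proof.
apply: dual_ext => c; rewrite -[RHS]lact_lregular.
rewrite /comp_inj [LHS]cdual_scaleE /=; congr (phi _).
rewrite copower_lactE; apply/ffunP => j; rewrite !ffunE.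
by case: ifP => // _; rewrite linear0.
Qed.

Lemma comp_inj_sum (phi : cdual copower) (c : copow) :
  phi c = \sum_i comp_inj phi i (c i).
Proof. by rewrite {1}[c]copow_sum linear_sum. Qed.

Definition coord_form (i : 'I_n) : cdual copower :=
  (counit C \o proj i : {linear copow -> k^o}).

Lemma copower_fin_gen (phi : cdual copower) : span (codom coord_form) phi.
Proof.
have -> : phi = \sum_i (comp_inj phi i : A) *: coord_form i.
  apply: forms_ext => c; rewrite cdual_sumE comp_inj_sum; apply: eq_bigr => i _.
  rewrite copower_lactE /= /proj_fun ffunE.
  by rewrite [RHS](lact_lregular _ _ (1 : dual C)) mulr1.
elim/big_ind: _ => [|u v|i _].
- by case: (span_submod (V := cdual copower) (codom coord_form)).
- by apply: submodD; exact: span_submod.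
- by apply: submodZ; [exact: span_submod|apply: span_mem; exact: codom_f].
Qed.

End Copower.

Hypothesis Cart : lartinian (lregular C).

Definition reflexive_module (P : lmodType A) : Prop :=
  (forall p : resk P, ev p = 0 -> p = 0) /\ forall phi, exists p : resk P, ev p = phi.

Section FinGen.
Variables (P : lmodType A) (l : seq P).
Hypothesis Pl : forall p, span l p.

Let n := size l.
Let M := copower n.
Let F (phi : cdual M) : P := \sum_(i < n) (comp_inj phi i : A) *: l`_i.

Let FZ (f : A) phi : F (f *: phi) = f *: F phi.
Proof.
by rewrite /F scaler_sumr; apply: eq_bigr => i _; rewrite comp_injZ scalerA.
Qed.

Let FD phi psi : F (phi + psi) = F phi + F psi.
Proof.
rewrite /F -big_split; apply: eq_bigr => i _ /=; rewrite -scalerDl; congr (_ *: _).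
exact: dual_ext.
Qed.

Let F_surj p : exists phi, F phi = p.
Proof.
have [a ->] := span_sumP (Pl p).
pose phi : cdual M := \sum_(i < n) (a i : A) *: coord_form i.
exists phi; apply: eq_bigr => j _; congr (_ *: _); apply: dual_ext => c.
rewrite /comp_inj /= cdual_sumE (bigD1 j) //= big1 ?addr0 => [|i ij];
  rewrite copower_lactE /= /proj_fun !ffunE.
  by rewrite eqxx [LHS](lact_lregular _ _ (1 : dual C)) mulr1.
by rewrite eq_sym (negPf ij) !linear0.
Qed.

Let ker_submod : submodule (fun phi => F phi = 0).
Proof.
split=> [|a u v Fu Fv]; last by rewrite FD FZ Fu Fv scaler0 addr0.
by have := FZ 0 0; rewrite !scale0r.
Qed.

(** The kernel [K] of [F] is finitely generated, hence closed: [g] lies in [K] once it vanishes on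
    the annihilator of [K] in [C^n]. Each point of that annihilator induces a representative form on
    [P], and [ev p = 0] makes [g] vanish there. *)
Let ev_inj (p : resk P) : ev p = 0 -> p = 0.
Proof.
have [m mP] : fin_gen (fun phi => F phi = 0).
  apply: (sub_span_fin_gen _ (l := codom (@coord_form n))) => // [|phi _].
    by move=> S; exact: artinian_ideal_fin_gen.
  exact: copower_fin_gen.
have [g <-] := F_surj p => evg; apply/mP/closed_span => c cK.
(* Any set-theoretic section will do: evaluation at a point annihilating [K] does not depend on the
   chosen preimages, so [q |-> s q d] is linear. *)
pose s (q : P) : cdual M := projT1 (cid (F_surj q)).
have sP q : F (s q) = q by rewrite /s; case: cid.
have annE phi psi d : annihilator (span m) d -> F phi = F psi -> phi d = psi d.
  move=> dK E; apply/eqP; rewrite -subr_eq0; apply/eqP/(dK (phi - psi))/mP.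
  by rewrite FD E -FD subrr; case: ker_submod.
have th_lin d : annihilator (span m) d -> linear (fun q : resk P => s q d : k^o).
  move=> dK a q r; transitivity (((alg_in A a : A) *: s q + s r : cdual M) d).
    by apply: annE => //; rewrite FD FZ !sP.
  have -> : ((alg_in A a : A) *: s q + s r : cdual M) d = s q (lact M (alg_in A a) d) + s r d.
    by [].
  by rewrite lact_in linearZ.
pose th d (dK : annihilator (span m) d) : forms (resk P) :=
  HB.pack (fun q : resk P => s q d : k^o)
    (GRing.isLinear.Build k (resk P) k^o *:%R _ (th_lin d dK)).
have th_rep d (dK : annihilator (span m) d) : representative (th d dK).
  (* The coaction of [d] supplies the representing tensor; its components [lact M (f i) d] stay in
     the annihilator. *)
  have [r [a [f dE]]] := lact_rational d.
  have fK i := annihilator_lact (f i) (span_submod (V := cdual M) m) dK.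
  exists (\sum_i tens (a i) (th _ (fK i))) => h; apply: forms_ext => q.
  rewrite linear_sum forms_sumE pullE /=.
  transitivity (s q (lact M h d)).
    rewrite lactE dE !linear_sum; apply: eq_bigr => i _.
    by rewrite !ctrE linearZ.
  have -> : s q (lact M h d) = ((h : A) *: s q) d by [].
  by apply: annE => //; rewrite FZ !sP.
have := congr1 (fun h : cdual (rdual_comod P) => h (exist _ _ (th_rep c cK))) evg.
rewrite /= /ev_fun /= => <-; by apply: annE => //; rewrite sP.
Qed.

(** Representative forms on [P] are given by points of [C^n], so [lam] becomes a form on a subspace
    of [C^n]; an extension [g] of it to [C^n] yields the preimage [F g]. *)
Let ev_surj (lam : resk (cdual (rdual_comod P))) : exists p : resk P, ev p = lam.
Proof.
have rep_eval (theta : forms (resk P)) (q : P) : representative theta ->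
    exists c : C, forall f : A, theta (f *: q) = f c.
  move=> [t tP]; have [r [a [f tE]]] := ctr_basis t.
  exists (\sum_i (ctr _ (f i) t : forms (resk P)) q *: a i) => g.
  transitivity (pull (asc P g) theta q) => //.
  rewrite -tP {1}tE !linear_sum forms_sumE; apply: eq_bigr => i _.
  by rewrite ctrE linearZ; exact: mulrC.
have rep_point (x : rdual P) : exists c : copow n, forall phi : cdual M,
    phi c = sub_val x (F phi).
  pose y i := projT1 (cid (rep_eval _ (l`_i) (sub_valP x))).
  have yP i (f : A) : sub_val x (f *: l`_i) = f (y i) by rewrite /y; case: cid.
  exists [ffun i : 'I_n => y i] => phi; rewrite comp_inj_sum /F.
  rewrite (linear_sum (sub_val x : {linear resk P -> k^o})).
  by apply: eq_bigr => i _; rewrite ffunE yP.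
pose L (p : M * k) := exists2 x : rdual P, p.2 = lam x &
  forall phi : cdual M, phi p.1 = sub_val x (F phi).
have L0 : L (0, 0) by exists 0 => [|phi]; rewrite ?linear0.
have [|g gP] := linear_extension L0.
  split=> [a [c _] [d _] [x /= -> xP] [y /= -> yP]|b [x /= -> xP]].
    by exists (a *: x + y) => [|phi]; rewrite linearP // xP yP.
  (* A form given by the point [0] vanishes on the image of [F], which is all of [P]. *)
  suff -> : x = 0 by rewrite linear0.
  apply: rdual_ext => q; have [phi <-] := F_surj q.
  by rewrite -xP linear0.
exists (F g); apply: forms_ext => x; have [c cP] := rep_point x.
by rewrite /= /ev_fun -cP; apply: gP; exists x.
Qed.

Lemma fin_gen_reflexive : reflexive_module P.
Proof. by split. Qed.

End FinGen.
End Reflexive.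

(** * Duality for complexes *)

Section Degree.
Variables (k : fieldType) (A : concrete_cat k).

(** Degrees such as [i] and [- - i] are equal but not convertible, so the terms in these degrees are
    compared by transport. *)
Definition dcast (X : int -> A) i j (e : i = j) : {linear und (X i) -> und (X j)} :=
  match e in _ = l return {linear und (X i) -> und (X l)} with
  | erefl => idlin (und (X i))
  end.

Lemma dcast_hom X i j (e : i = j) : chom (@dcast X i j e).
Proof. by case: _ / e; exact: chom_id. Qed.

Lemma dcast_id X i (e : i = i) x : @dcast X i i e x = x.
Proof. by rewrite (eq_irrelevance e erefl). Qed.

Lemma dcast_comp X i j l (e : i = j) (e' : j = l) x :
  dcast X e' (dcast X e x) = dcast X (etrans e e') x.
Proof. by case: _ / e'; case: _ / e. Qed.

Lemma dcastK X i j (e : i = j) (e' : j = i) : cancel (@dcast X i j e) (@dcast X j i e').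
Proof. by move=> x; rewrite dcast_comp dcast_id. Qed.

Lemma dif_dcast (X : complex A) i j l (e : i = j) x :
  dif X j l (dcast X e x) = dif X i l x.
Proof. by case: _ / e. Qed.

Lemma dcast_dif (X : complex A) i j l (e : j = l) x :
  dcast X e (dif X i j x) = dif X i l x.
Proof. by case: _ / e. Qed.

Lemma cm_dcast (X Y : complex A) (f : chain_map X Y) i j (e : i = j) x :
  f j (dcast X e x) = dcast Y e (f i x).
Proof. by case: _ / e. Qed.

Variable X : complex A.

Lemma cocycleP i (x : und (X i)) : cocycle x <-> dif X i (i + 1) x = 0.
Proof.
split=> [|dx j]; first exact.
by have [->|/dif_shape ->] := eqVneq j (i + 1).
Qed.

Lemma coboundaryP i (x : und (X i)) : coboundary x <-> exists y, x = dif X (i - 1) i y.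
Proof.
split=> [[j [y ->]]|[y ->]]; last by exists (i - 1), y.
have [ij|ij] := eqVneq i (j + 1); last by exists 0; rewrite linear0 dif_shape.
have e : j = i - 1 by rewrite ij addrK.
by exists (dcast X e y); rewrite dif_dcast.
Qed.

Lemma cocycle_subspace i : subspace (@cocycle k A X i).
Proof.
split=> [j|a u v cu cv j]; first by rewrite linear0.
by rewrite linearP /= cu cv scaler0 addr0.
Qed.

Lemma coboundary_subspace i : subspace (@coboundary k A X i).
Proof.
split=> [|a u v /coboundaryP[y ->] /coboundaryP[z ->]]; apply/coboundaryP.
  by exists 0; rewrite linear0.
by exists (a *: y + z); rewrite linearP.
Qed.

End Degree.

Section DualComplex.
Variables (k : fieldType) (C : coalgebra k).
Local Notation A := (dual_algebra C).

Section Cpull.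
Variables (M N : lcomodule C) (u : {linear M -> N}).
Definition cpull_fun (phi : resk (cdual N)) : resk (cdual M) :=
  ((phi : {linear N -> k^o}) \o u : cdual M).

Lemma resk_cdualE (a : k) (phi : resk (cdual N)) x :
  ((a *: phi : resk (cdual N)) : cdual N) x = a * (phi : cdual N) x.
Proof.
transitivity ((phi : cdual N) (lact N (alg_in A a) x)) => //.
by rewrite lact_in linearZ.
Qed.
End Cpull.

Fact cpull_linear (M N : lcomodule C) (u : {linear M -> N}) : linear (cpull_fun u).
Proof.
move=> a phi psi; apply: forms_ext => m.
transitivity (a * (phi : cdual N) (u m) + (psi : cdual N) (u m)).
  by rewrite -resk_cdualE.
transitivity (((a *: cpull_fun u phi : resk (cdual M)) : cdual M) m +
  (psi : cdual N) (u m)) => //.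
by rewrite resk_cdualE.
Qed.
HB.instance Definition _ (M N : lcomodule C) (u : {linear M -> N}) :=
  GRing.isLinear.Build k (resk (cdual N)) (resk (cdual M)) *:%R
    (cpull_fun u) (cpull_linear u).
Definition cpull (M N : lcomodule C) (u : {linear M -> N}) :
  {linear resk (cdual N) -> resk (cdual M)} := cpull_fun u.

Lemma cpull_hom (M N : lcomodule C) (u : {linear M -> N}) :
  lcomod_hom u -> module_hom (cpull u).
Proof.
move=> /lcomod_homP uC f phi; apply: forms_ext => m; rewrite cdual_scaleE.
by rewrite /= uC.
Qed.

(** The transposed differentials carry no sign, so a comparison with shifts meets only the signs of
    the shifts; see [twist]. *)
Definition dual_complex (X : complex (comod_cat C)) : complex (module_cat A).
Proof.
exists (fun i => cdual (X (- i)) : module_cat A) (fun i j => cpull (dif X (- j) (- i))).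
- by move=> i j; apply: cpull_hom; exact: (dif_hom X (- j) (- i)).
- move=> i j phi ij; apply: forms_ext => x.
  have E : dif X (- j) (- i) x = 0.
    rewrite dif_shape //; apply: contra ij => /eqP e.
    by rewrite -[i]opprK e opprD opprK subrK.
  by rewrite /= E linear0.
- by move=> i j l phi; apply: forms_ext => x; rewrite /= dif_dif linear0.
Defined.

Definition dual_map (X Y : complex (comod_cat C)) (f : chain_map X Y) :
  chain_map (dual_complex Y) (dual_complex X).
Proof.
exists (fun i => cpull (f (- i))).
- by move=> i; apply: cpull_hom; exact: (cm_hom f (- i)).
- by move=> i j phi; apply: forms_ext => x; rewrite /= cm_dif.
Defined.

Variable X : complex (comod_cat C).
Implicit Types (i : int).

Lemma dual_cocycle i (phi : cdual (X (- i))) :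
  @cocycle _ _ (dual_complex X) i phi <-> forall x, @coboundary _ _ X (- i) x -> phi x = 0.
Proof.
split=> [cphi x [j]|phi0 j]; last first.
  by apply: forms_ext => x; apply: phi0; exists (- j), x.
rewrite -(opprK j) => -[y ->].
exact: (congr1 (fun psi : cdual (X (- (- j))) => psi y) (cphi (- j))).
Qed.

(** Exactness of the dual: a form that vanishes on the kernel of the differential descends to its
    image and extends from there. *)
Lemma dual_coboundary i (phi : cdual (X (- i))) :
  @coboundary _ _ (dual_complex X) i phi <-> forall x, @cocycle _ _ X (- i) x -> phi x = 0.
Proof.
split=> [[j [psi ->]] x cx|phi0]; first by rewrite /= cx linear0.
have [||psi psiP] := @form_factor k (X (- i)) (X (- i + 1)) (fun=> True)
   (dif X (- i) (- i + 1)) phi.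
- by [].
- by move=> x _ dx; apply: phi0; apply/(@cocycleP _ _ X).
have e : - i + 1 = - (i - 1) by rewrite opprB addrC.
exists (i - 1).
exists ((psi : {linear _ -> k^o}) \o @dcast _ (comod_cat C) X _ _ (esym e) :
  cdual (X (- (i - 1)))).
by apply: forms_ext => x; rewrite /= dcast_dif psiP.
Qed.

End DualComplex.

Lemma field_ideal_fin_gen (k : fieldType) (S : k^o -> Prop) : submodule S -> fin_gen S.
Proof.
move=> HS; have [[a Sa a0]|nS] := pselect (exists2 a : k, S a & a != 0).
  exists [:: a : k^o] => x; split=> [_|[b /eqP]].
    by exists (x / a); apply/eqP; rewrite subr_eq0 [_ *: _]divfK.
  by rewrite subr_eq0 => /eqP ->; exact: submodZ.
exists [::] => x; split=> [Sx|->]; last by case: HS.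
by apply: contrapT => /eqP x0; apply: nS; exists x.
Qed.

(** * Finite dimensional cohomology and quasi-isomorphisms *)

Section Cohomology.
Variables (k : fieldType) (A : concrete_cat k).

(** The forms embed the cocycles, modulo their common kernel there, in [k^r]. Lifts of generators of
    the image span the cocycles up to that common kernel, which consists of coboundaries. *)
Lemma fd_of_forms (X : complex A) i r (e : 'I_r -> forms (und (X i))) :
  (forall x, @cocycle _ _ X i x -> (forall s, e s x = 0) -> @coboundary _ _ X i x) ->
  exists (r : nat) (z : 'I_r -> und (X i)), (forall s, @cocycle _ _ X i (z s)) /\
    forall x, @cocycle _ _ X i x ->
      exists c : 'I_r -> k, @coboundary _ _ X i (x - \sum_s c s *: z s).
Proof.
move=> e0; pose E (x : und (X i)) : 'rV[k]_r := \row_s (e s x : k).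
have EP a x y : E (a *: x + y) = a *: E x + E y.
  by apply/rowP => s; rewrite !mxE linearP.
have Esum n (c : 'I_n -> k) (z : 'I_n -> und (X i)) :
    E (\sum_s c s *: z s) = \sum_s c s *: E (z s).
  by elim/big_rec2: _ => [|s v w _ <-]; [apply/rowP => s; rewrite !mxE linear0|exact: EP].
have [l lP] : fin_gen (fun v => exists2 x, @cocycle _ _ X i x & v = E x).
  apply: (sub_span_fin_gen _ (l := codom (@delta_mx k 1 r 0))) => [|| v _].
  - exact: field_ideal_fin_gen.
  - have [C0 CP] := @cocycle_subspace _ _ X i; split=> [|a _ _ [x cx ->] [y cy ->]].
      by exists 0 => //; apply/rowP => s; rewrite !mxE linear0.
    by exists (a *: x + y); [exact: CP|rewrite EP].
  - rewrite [v]row_sum_delta; elim/big_ind: _ => [|u w|j _].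
    + by case: (span_submod (codom (@delta_mx k 1 r 0))).
    + by apply: submodD; exact: span_submod.
    + by apply: submodZ; [exact: span_submod|apply: span_mem; exact: codom_f].
have zex (s : 'I_(size l)) : exists x, @cocycle _ _ X i x /\ l`_s = E x.
  have /lP [x cx Ex] : span l l`_s by apply: span_mem; exact: mem_nth.
  by exists x.
pose z s := projT1 (cid (zex s)).
have zP s : @cocycle _ _ X i (z s) /\ l`_s = E (z s) by rewrite /z; case: cid.
exists (size l), z; split=> [s|x cx]; first by case: (zP s).
have /lP /span_sumP [c Ec] : exists2 y, @cocycle _ _ X i y & E x = E y by exists x.
exists (fun s => c s).
have [C0 CP] := @cocycle_subspace _ _ X i.
apply: e0 => [|s].
  rewrite addrC -scaleN1r; apply: (CP) => //.
  elim/big_ind: _ => // [u v Cu Cv|s _]; first by rewrite -[u]scale1r; apply: (CP).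
  by rewrite -[_ *: _]addr0; apply: (CP) => //; case: (zP s).
have /rowP /(_ s) : E x = E (\sum_(s' < size l) c s' *: z s').
  by rewrite Ec Esum; apply: eq_bigr => s' _; case: (zP s') => _ ->.
by rewrite !mxE => xs; rewrite linearB /= xs subrr.
Qed.

Lemma bijective_quasi_iso (X Y : complex A) (f : chain_map X Y) :
  (forall i, injective (f i)) -> (forall i y, exists x, f i x = y) -> quasi_iso f.
Proof.
move=> fI fS i; split=> [x cx /coboundaryP[y fx]|y cy].
  have [z zy] := fS _ y; apply/coboundaryP; exists z.
  by apply: fI; rewrite fx cm_dif zy.
have [x xy] := fS _ y; exists x; last first.
  by rewrite xy subrr; case: (@coboundary_subspace _ _ Y i).
by move=> j; apply: fI; rewrite cm_dif xy cy linear0.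
Qed.

Lemma quasi_iso_comp (X Y Z : complex A) (g : chain_map Y Z) (f : chain_map X Y) :
  quasi_iso f -> quasi_iso g -> quasi_iso (chain_comp g f).
Proof.
move=> qf qg i; have [fI fS] := qf i; have [gI gS] := qg i.
split=> [x cx gfx|z cz].
  by apply: fI => //; apply: gI => // j; rewrite -cm_dif cx linear0.
have [y cy [j [w zy]]] := gS z cz; have [x cx /coboundaryP[v yx]] := fS y cy.
exists x => //=; have [B0 BP] := @coboundary_subspace _ _ Z i.
have -> : z - g i (f i x) = 1 *: g i (y - f i x) + (z - g i y).
  by rewrite scale1r linearB [RHS]addrC addrA subrK.
apply: BP; last by rewrite zy; exists j, w.
by rewrite yx cm_dif; exists (i - 1), (g (i - 1) v).
Qed.

Lemma quasi_iso_cancel_l (X Y Z : complex A) (g : chain_map Y Z) (f : chain_map X Y) :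
  quasi_iso g -> quasi_iso (chain_comp g f) -> quasi_iso f.
Proof.
move=> qg qgf i; have [gI gS] := qg i; have [gfI gfS] := qgf i.
have fc x : cocycle x -> cocycle (f i x) by move=> cx j; rewrite -cm_dif cx linear0.
split=> [x cx /coboundaryP[v fx]|y cy].
  by apply: gfI => //=; rewrite fx cm_dif; exists (i - 1), (g (i - 1) v).
have cgy : cocycle (g i y) by move=> j; rewrite -cm_dif cy linear0.
have [x cx gxy] := gfS _ cgy; exists x => //.
have [Z0 ZP] := @cocycle_subspace _ _ Y i.
apply: gI; last by rewrite linearB.
by rewrite addrC -scaleN1r; apply: ZP => //; exact: fc.
Qed.

Lemma quasi_iso_cancel_r (X Y Z : complex A) (g : chain_map Y Z) (f : chain_map X Y) :
  quasi_iso f -> quasi_iso (chain_comp g f) -> quasi_iso g.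
Proof.
move=> qf qgf i; have [fI fS] := qf i; have [gfI gfS] := qgf i.
split=> [y cy gy|z cz].
  have [x cx yx] := fS y cy; have [B0 BP] := @coboundary_subspace _ _ Y i.
  rewrite -(subrK (f i x) y) -[y - _]scale1r; apply: BP => //.
  have /coboundaryP[v xE] : coboundary x.
    apply: gfI => //=; have [B0' BP'] := @coboundary_subspace _ _ Z i.
    have -> : g i (f i x) = (-1) *: g i (y - f i x) + g i y.
      by rewrite scaleN1r linearB opprB subrK.
    apply: BP' => //; have /coboundaryP[w ->] := yx.
    by rewrite cm_dif; exists (i - 1), (g (i - 1) w).
  by rewrite xE cm_dif; exists (i - 1), (f (i - 1) v).
have [x cx zx] := gfS z cz; exists (f i x) => // j.
by rewrite -cm_dif cx linear0.
Qed.

End Cohomology.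

Section DualExact.
Variables (k : fieldType) (C : coalgebra k).
Local Notation A := (dual_algebra C).
Local Notation cocy X := (@cocycle _ (comod_cat C) X).
Local Notation cobd X := (@coboundary _ (comod_cat C) X).

Lemma resk_cdual_sumE (M : lcomodule C) (I : Type) (r : seq I) (c : I -> k)
    (F : I -> resk (cdual M)) x :
  ((\sum_(i <- r) c i *: F i : resk (cdual M)) : cdual M) x =
  \sum_(i <- r) c i * (F i : cdual M) x.
Proof.
elim: r => [|i r IH]; first by rewrite !big_nil.
by rewrite !big_cons -IH -resk_cdualE.
Qed.

(** The dual complex in degree [i] involves [X] in degree [- i]; quantifying over [- i] avoids a
    transport. *)
Lemma all_degrees (T : int -> Prop) : (forall i, T (- i)) -> forall i, T i.
Proof. by move=> H i; rewrite -(opprK i). Qed.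

Lemma dual_map_quasi_iso (X Y : complex (comod_cat C)) (f : chain_map X Y) :
  quasi_iso f -> quasi_iso (dual_map f).
Proof.
move=> qf i; have [fI fS] := qf (- i); split=> [phi /dual_cocycle cphi|phi /dual_cocycle cphi].
  move=> /dual_coboundary fphi; apply/dual_coboundary => y /fS [x cx yx].
  rewrite -(subrK (f (- i) x) y) linearD /= [X in X + _](cphi _ yx) add0r.
  exact: fphi.
(* The lift of [phi] is prescribed on images of cocycles plus coboundaries. It is well defined
   because [f] is injective on cohomology and [phi] kills coboundaries. *)
pose L (p : Y (- i) * k) := exists x w, [/\ cocy X x,
  p.1 = f (- i) x + dif Y (- i - 1) (- i) w & p.2 = (phi : cdual (X (- i))) x].
have [Z0 ZP] := @cocycle_subspace _ (comod_cat C) X (- i).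
have [||psi psiP] := @linear_extension k (Y (- i)) L.
- by exists 0, 0; rewrite !linear0 addr0.
- split=> [a [_ _] [_ _] [x [w [/= cx -> ->]]] [x' [w' [/= cx' -> ->]]]|].
    exists (a *: x + x'), (a *: w + w'); split; rewrite ?linearP //=; first exact: ZP.
    by rewrite scalerDr addrACA.
  move=> b [x [w [/= cx E ->]]]; apply: cphi; apply: fI => //.
  apply/coboundaryP; exists (- w).
  by rewrite linearN; apply/eqP; rewrite -addr_eq0 -E.
exists (psi : cdual (Y (- i))).
  apply/dual_cocycle => y /coboundaryP[w ->]; apply: psiP.
  by exists 0, w; rewrite !linear0 add0r.
apply/dual_coboundary => x cx.
transitivity ((phi : cdual (X (- i))) x - psi (f (- i) x)) => //.
apply/eqP; rewrite subr_eq0; apply/eqP/esym/psiP.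
by exists x, 0; rewrite linear0 addr0.
Qed.

(** If the conclusion fails, some form vanishes on the coboundaries, or on the classes in the image
    of [f], and takes the value [1] at the offending cocycle. It is a cocycle of the dual complex,
    where the hypothesis forces that value to be [0]. *)
Lemma quasi_iso_of_dual_map (X Y : complex (comod_cat C)) (f : chain_map X Y) :
  quasi_iso (dual_map f) -> quasi_iso f.
Proof.
move=> qf; apply: all_degrees => i; have [fI fS] := qf i; split=> [x cx fx|y cy].
  apply: contrapT => nx.
  have [phi phiB phix] := separating_form (@coboundary_subspace _ (comod_cat C) X (- i)) nx.
  have [|psi /dual_cocycle cpsi /dual_coboundary psiE] := fS (phi : cdual (X (- i))).
    exact/dual_cocycle.
  have : phi x - (psi : cdual (Y (- i))) (f (- i) x) = 0 by exact: (psiE x cx).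
  by rewrite phix cpsi // subr0 => /eqP; rewrite oner_eq0.
pose P (z : Y (- i)) := exists2 x, cocy X x & cobd Y (z - f (- i) x).
suff [x cx yx] : P y by exists x.
apply: contrapT => ny.
have [Z0 ZP] := @cocycle_subspace _ (comod_cat C) X (- i).
have [B0 BP] := @coboundary_subspace _ (comod_cat C) Y (- i).
have [|phi phiP phiy] := separating_form _ ny.
  split=> [|a u v [x cx ux] [x' cx' vx']]; first by exists 0 => //; rewrite linear0 subr0.
  exists (a *: x + x'); first exact: ZP.
  by rewrite linearP opprD addrACA -scalerBr; exact: BP.
suff /dual_coboundary /(_ y cy) : @coboundary _ (module_cat A) (dual_complex Y) i
   (phi : cdual (Y (- i))).
  by rewrite phiy => /eqP; rewrite oner_eq0.
apply: fI.
  apply/dual_cocycle => z Bz; apply: phiP.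
  by exists 0 => //; rewrite linear0 subr0.
apply/dual_coboundary => x cx; apply: phiP.
by exists x; rewrite // subrr.
Qed.

Lemma dual_fd (X : complex (comod_cat C)) :
  fd_cohomology X -> fd_cohomology (dual_complex X).
Proof.
move=> Xfd i; have [r [z [cz zP]]] := Xfd (- i).
have e_lin s : linear (fun phi : resk (cdual (X (- i))) => (phi : cdual (X (- i))) (z s)).
  move=> a phi psi; transitivity (a * (phi : cdual (X (- i))) (z s) + (psi : cdual _) (z s)).
    by rewrite -resk_cdualE.
  by [].
pose e s : forms (resk (cdual (X (- i)))) :=
  HB.pack (fun phi : resk (cdual (X (- i))) => (phi : cdual (X (- i))) (z s))
    (GRing.isLinear.Build k _ k^o *:%R _ (e_lin s)).
apply: (@fd_of_forms _ _ (dual_complex X) i r e) => phi /dual_cocycle cphi ephi.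
apply/dual_coboundary => x /zP [c xc].
pose psi : {linear X (- i) -> k^o} := phi.
change (psi x = 0); rewrite -(subrK (\sum_s c s *: z s) x) linearD.
have -> : psi (x - \sum_s c s *: z s) = 0 by exact: cphi.
rewrite linear_sum add0r; apply: big1 => s _.
by rewrite linearZ /= [psi _](ephi s) scaler0.
Qed.

(** The representatives [z s] in the dual are themselves forms on [X] and detect coboundaries: a
    form separating a cocycle from the coboundaries is a combination of them up to a form vanishing
    on cocycles. *)
Lemma fd_of_dual (X : complex (comod_cat C)) :
  fd_cohomology (dual_complex X) -> fd_cohomology X.
Proof.
move=> Xfd; apply: all_degrees => i; have [r [z [cz zP]]] := Xfd i.
apply: (@fd_of_forms _ _ X (- i) r (fun s => z s : cdual (X (- i)))) => x cx zx.
apply: contrapT => nx.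
have [phi phiB phix] := separating_form (@coboundary_subspace _ (comod_cat C) X (- i)) nx.
have [|c /dual_coboundary /(_ x cx)] := zP (phi : cdual (X (- i))).
  exact/dual_cocycle.
pose S : resk (cdual (X (- i))) := \sum_s c s *: z s.
move=> E; have : (phi x - (S : cdual (X (- i))) x) = 0 by exact: E.
rewrite phix resk_cdual_sumE big1 ?subr0 => [/eqP|s _]; first by rewrite oner_eq0.
by rewrite [X in _ * X]zx mulr0.
Qed.

Lemma dual_bounded (X : complex (comod_cat C)) : bounded X -> bounded (dual_complex X).
Proof.
move=> [N NX]; exists N => i Ni phi; apply: forms_ext => x.
have -> : x = 0 by apply: NX; rewrite normrN.
by rewrite linear0.
Qed.

End DualExact.

Lemma quasi_iso_fd (k : fieldType) (A : concrete_cat k) (X Y : complex A)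
    (f : chain_map X Y) :
  quasi_iso f -> fd_cohomology X -> fd_cohomology Y.
Proof.
move=> qf Xfd i; have [r [z [cz zP]]] := Xfd i; have [fI fS] := qf i.
exists r, (fun s => f i (z s)); split=> [s j|y cy]; first by rewrite -cm_dif cz linear0.
have [x cx yx] := fS y cy; have [c /coboundaryP[w xc]] := zP x cx; exists c.
have [B0 BP] := @coboundary_subspace _ _ Y i.
have -> : y - \sum_s c s *: f i (z s) =
    1 *: f i (x - \sum_s c s *: z s) + (y - f i x).
  rewrite scale1r linearB [f i (\sum_s _)]linear_sum [RHS]addrC addrA subrK; congr (_ - _).
  by apply: eq_bigr => s _; rewrite linearZ.
by apply: BP => //; rewrite xc cm_dif; exists (i - 1), (f (i - 1) w).
Qed.

(** * The adjunction between duals and finite duals *)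

Section FiniteDualMaps.
Variables (k : fieldType) (C : coalgebra k).
Local Notation A := (dual_algebra C).

Lemma representative_pull (P Q : lmodType A) (u : {linear resk P -> resk Q}) theta :
  module_hom u -> representative theta -> representative (pull u theta).
Proof.
move=> hu [t tP]; exists (tmap (idlin C) (pull u) t) => f.
rewrite ctr_tmapr tP; apply: forms_ext => p; rewrite !pullE; congr (theta _).
exact/esym/(hu f p).
Qed.

Section Rpull.
Variables (P Q : lmodType A) (u : {linear resk P -> resk Q}) (hu : module_hom u).

Definition rpull_fun (x : rdual_comod Q) : rdual_comod P :=
  exist _ _ (representative_pull hu (sub_valP (x : rdual Q))).
Fact rpull_linear : linear rpull_fun.
Proof. by move=> a x y; apply: rdual_ext. Qed.
HB.instance Definition _ :=
  GRing.isLinear.Build k (rdual_comod Q) (rdual_comod P) *:%R rpull_fun rpull_linear.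
Definition rpull : {linear rdual_comod Q -> rdual_comod P} := rpull_fun.

Lemma rpull_hom : lcomod_hom rpull.
Proof.
apply/lcomod_homP => f x; apply: rdual_ext => p; rewrite rdual_lactE.
transitivity (sub_val (lact (rdual_comod Q) f x : rdual Q) (u p)) => //.
by rewrite rdual_lactE -hu.
Qed.
End Rpull.

Section Adjunct.
Variables (P : lmodType A) (X : lcomodule C) (u : {linear resk P -> resk (cdual X)}).
Hypothesis hu : module_hom u.

Definition adj_form_fun (x : X) (p : resk P) : k^o := (u p : cdual X) x.
Fact adj_form_linear x : linear (adj_form_fun x).
Proof.
move=> a p q; rewrite /adj_form_fun linearP.
transitivity (((a *: u p : resk (cdual X)) : cdual X) x + (u q : cdual X) x) => //.
by rewrite resk_cdualE.
Qed.
HB.instance Definition _ x :=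
  GRing.isLinear.Build k (resk P) k^o *:%R (adj_form_fun x) (adj_form_linear x).
Definition adj_form (x : X) : forms (resk P) := adj_form_fun x.

Fact adj_form_lin : linear adj_form.
Proof.
by move=> a x y; apply: forms_ext => p; rewrite /= /adj_form_fun linearP.
Qed.
HB.instance Definition _ :=
  GRing.isLinear.Build k X (forms (resk P)) *:%R adj_form adj_form_lin.

Fact adj_form_lact f x : pull (asc P f) (adj_form x) = adj_form (lact X f x).
Proof.
apply: forms_ext => p; rewrite pullE /= /adj_form_fun.
by rewrite -cdual_scaleE -hu.
Qed.

(** Pushing the coaction of [x] forward gives the representing tensor. Hence [u], read as a pairing
    of [P] with [X], has an adjunct from [X] to the finite dual of [P]. *)
Fact adj_form_representative x : representative (adj_form x).
Proof.
exists (tmap (idlin C) adj_form (lcoact X x)) => f.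
by rewrite ctr_tmapr -lactE adj_form_lact.
Qed.

Definition adj_fun (x : X) : rdual_comod P := exist _ _ (adj_form_representative x).
Fact adj_linear : linear adj_fun.
Proof.
move=> a x y; apply: rdual_ext => p.
transitivity (adj_form (a *: x + y) p) => //.
by rewrite linearP.
Qed.
HB.instance Definition _ :=
  GRing.isLinear.Build k X (rdual_comod P) *:%R adj_fun adj_linear.
Definition adj : {linear X -> rdual_comod P} := adj_fun.

Lemma adjE x p : sub_val (adj x : rdual P) p = (u p : cdual X) x.
Proof. by []. Qed.

Lemma adj_hom : lcomod_hom adj.
Proof.
apply/lcomod_homP => f x; apply: rdual_ext => p.
by rewrite rdual_lactE !adjE -cdual_scaleE -hu.
Qed.
End Adjunct.

Local Notation comod_complex := (complex (comod_cat C)).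
Local Notation mod_complex := (complex (module_cat A)).

Definition rdual_complex (N : mod_complex) : comod_complex.
Proof.
exists (fun i => rdual_comod (N (- i)) : comod_cat C)
  (fun i j => rpull (dif_hom N (- j) (- i))).
- by move=> i j; exact: rpull_hom.
- move=> i j x ij; apply: rdual_ext => p.
  have E : dif N (- j) (- i) p = 0.
    rewrite dif_shape //; apply: contra ij => /eqP e.
    by rewrite -[i]opprK e opprD opprK subrK.
  transitivity (sub_val (x : rdual (N (- i))) (dif N (- j) (- i) p)) => //.
  by rewrite E linear0.
- move=> i j l x; apply: rdual_ext => p.
  transitivity (sub_val (x : rdual (N (- i))) (dif N (- j) (- i) (dif N (- l) (- j) p))) => //.
  by rewrite dif_dif linear0.
Defined.

Definition rdual_map (P Q : mod_complex) (f : chain_map P Q) :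
  chain_map (rdual_complex Q) (rdual_complex P).
Proof.
exists (fun i => rpull (cm_hom f (- i))).
- by move=> i; exact: rpull_hom.
- move=> i j x; apply: rdual_ext => p.
  transitivity (sub_val (x : rdual (Q (- i))) (dif Q (- j) (- i) (f (- j) p))) => //.
  by rewrite -cm_dif.
Defined.

Lemma opprK_sym (i : int) : i = - - i.
Proof. by rewrite opprK. Qed.

Definition ev_map (P : mod_complex) : chain_map P (dual_complex (rdual_complex P)).
Proof.
exists (fun i => (@ev _ _ (P (- - i)) : {linear _ -> _}) \o dcast P (opprK_sym i)
  : {linear _ -> _}).
- move=> i; apply: (@chom_comp _ (module_cat A) _ _ _ (@ev _ _ (P (- - i)))).
    exact: ev_hom.
  exact: dcast_hom.
- move=> i j x; apply: forms_ext => y /=; rewrite /ev_fun.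
  transitivity (sub_val (y : rdual (P (- - j)))
    (dif P (- - i) (- - j) (dcast P (opprK_sym i) x))) => //.
  by rewrite dif_dcast dcast_dif.
Defined.

Definition adj_map (P : mod_complex) (X : comod_complex)
  (u : chain_map P (dual_complex X)) : chain_map X (rdual_complex P).
Proof.
exists (fun i => adj (cm_hom u (- i)) \o dcast X (opprK_sym i) : {linear _ -> _}).
- move=> i; apply: (@chom_comp _ (comod_cat C) _ _ _ (adj (cm_hom u (- i)))).
    exact: adj_hom.
  exact: dcast_hom.
- move=> i j x; apply: rdual_ext => p.
  transitivity ((u (- i) (dif P (- j) (- i) p) : cdual _) (dcast X (opprK_sym i) x)) => //.
  rewrite cm_dif.
  transitivity ((u (- j) p : cdual _) (dif X (- - i) (- - j) (dcast X (opprK_sym i) x))) => //.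
  by rewrite dif_dcast /= dcast_dif.
Defined.

(** A triangle identity; through it, [adj_map u] inherits being a quasi-isomorphism from [u]. *)
Lemma adj_mapK (P : mod_complex) (X : comod_complex) (u : chain_map P (dual_complex X)) :
  chain_comp (dual_map (adj_map u)) (ev_map P) = u.
Proof.
apply: chain_map_ext => i p; apply: forms_ext => x.
transitivity ((u (- - i) (dcast P (opprK_sym i) p) : cdual _)
  (dcast X (opprK_sym (- i)) x)) => //.
have gen j (e : i = j) (e' : - i = - j) :
    (u j (dcast P e p) : cdual (X (- j))) (dcast X e' x) = (u i p : cdual (X (- i))) x.
  by case: _ / e in e' *; rewrite !dcast_id.
exact: gen.
Qed.

Lemma adj_map_rdual (P Q : mod_complex) (X : comod_complex) (f : chain_map P Q)
    (u : chain_map Q (dual_complex X)) :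
  chain_comp (rdual_map f) (adj_map u) = adj_map (chain_comp u f).
Proof. by apply: chain_map_ext => i x; apply: rdual_ext. Qed.

Lemma adj_map_dual (P : mod_complex) (X Y : comod_complex) (g : chain_map X Y)
    (u : chain_map P (dual_complex Y)) :
  adj_map (chain_comp (dual_map g) u) = chain_comp (adj_map u) g.
Proof.
apply: chain_map_ext => i x; apply: rdual_ext => p.
transitivity ((u (- i) p : cdual _) (g (- - i) (dcast X (opprK_sym i) x))) => //.
by rewrite cm_dcast.
Qed.

Lemma ev_map_nat (P Q : mod_complex) (f : chain_map P Q) :
  chain_comp (ev_map Q) f = chain_comp (dual_map (rdual_map f)) (ev_map P).
Proof.
apply: chain_map_ext => i p; apply: forms_ext => x.
transitivity (sub_val (x : rdual (Q (- - i))) (dcast Q (opprK_sym i) (f i p))) => //.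
by rewrite -cm_dcast.
Qed.

Definition reflexive_complex (P : mod_complex) : Prop :=
  forall i, reflexive_module (P i : lmodType A).

Lemma ev_map_quasi_iso (P : mod_complex) : reflexive_complex P -> quasi_iso (ev_map P).
Proof.
move=> rP; apply: bijective_quasi_iso => [i p q|i phi].
  move=> /= E; apply: (can_inj (dcastK (X := P) (opprK_sym i) (esym (opprK_sym i)))).
  have [evI _] := rP (- - i); apply/eqP; rewrite -subr_eq0; apply/eqP/evI.
  rewrite linearB; apply/eqP; rewrite subr_eq0; apply/eqP; exact: E.
have [_ /(_ phi) [p pphi]] := rP (- - i).
by exists (dcast P (esym (opprK_sym i)) p); rewrite /= dcastK.
Qed.

Lemma rdual_bounded (P : mod_complex) : bounded P -> bounded (rdual_complex P).
Proof.
move=> [N NP]; exists N => i Ni x; apply: rdual_ext => p.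
have -> : p = 0 by apply: NP; rewrite normrN.
by rewrite !linear0.
Qed.

Lemma rdual_fd (P : mod_complex) :
  reflexive_complex P -> fd_cohomology P -> fd_cohomology (rdual_complex P).
Proof.
by move=> rP fP; apply: fd_of_dual; apply: quasi_iso_fd fP; exact: ev_map_quasi_iso.
Qed.

(** Exactness of the finite dual is not approached directly: the dual reflects quasi-isomorphisms,
    and [ev_map] identifies the dual of [rdual_map f] with [f]. *)
Lemma rdual_map_quasi_iso (P Q : mod_complex) (f : chain_map P Q) :
  reflexive_complex P -> reflexive_complex Q -> quasi_iso f -> quasi_iso (rdual_map f).
Proof.
move=> rP rQ qf; apply: quasi_iso_of_dual_map.
apply: (quasi_iso_cancel_r (ev_map_quasi_iso rP)); rewrite -ev_map_nat.
by apply: quasi_iso_comp => //; exact: ev_map_quasi_iso.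
Qed.

Lemma adj_map_quasi_iso (P : mod_complex) (X : comod_complex)
    (u : chain_map P (dual_complex X)) :
  reflexive_complex P -> quasi_iso u -> quasi_iso (adj_map u).
Proof.
move=> rP qu; apply: quasi_iso_of_dual_map.
by apply: (quasi_iso_cancel_r (ev_map_quasi_iso rP)); rewrite adj_mapK.
Qed.

End FiniteDualMaps.

Lemma quasi_iso_fd_source (k : fieldType) (A : concrete_cat k) (X Y : complex A)
    (f : chain_map X Y) :
  quasi_iso f -> fd_cohomology Y -> fd_cohomology X.
Proof.
move=> qf Yfd i; have [r [z [cz zP]]] := Yfd i; have [fI fS] := qf i.
have lift s : exists x, cocycle x /\ coboundary (z s - f i x).
  by have [x cx zx] := fS _ (cz s); exists x.
pose w s := projT1 (cid (lift s)).
have wP s : cocycle (w s) /\ coboundary (z s - f i (w s)) by rewrite /w; case: cid.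
exists r, w; split=> [s|x cx]; first by case: (wP s).
have /zP [c xc] : cocycle (f i x) by move=> j; rewrite -cm_dif cx linear0.
exists c; have [Z0 ZP] := @cocycle_subspace _ _ X i.
have [B0 BP] := @coboundary_subspace _ _ Y i.
have Bsum : coboundary (\sum_s c s *: (z s - f i (w s))).
  elim/big_rec: _ => // s y _ By; apply: (BP) => //; by case: (wP s).
apply: fI.
  rewrite addrC -scaleN1r; apply: (ZP) => //.
  elim/big_rec: _ => // s y _ Zy; apply: (ZP) => //; by case: (wP s).
have -> : f i (x - \sum_s c s *: w s) =
    1 *: (f i x - \sum_s c s *: z s) + \sum_s c s *: (z s - f i (w s)).
  rewrite scale1r linearB [f i (\sum_s _)]linear_sum.
  under [X in _ = _ + X]eq_bigr => s _ do rewrite scalerBr.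
  rewrite sumrB addrA subrK; congr (_ - _).
  by apply: eq_bigr => s _; rewrite linearZ.
exact: BP.
Qed.

(** * Finitely generated subcomplexes *)

Section ModuleSpan.
Variables (k : fieldType) (A : algebra k).
Variables (V W : lmodType A) (u : {linear resk V -> resk W}) (hu : module_hom u).

Lemma module_homB (v : V) a (w : V) : u (v - a *: w) = (u v : W) - a *: (u w : W).
Proof. by rewrite -(hu a w); exact: (linearB u). Qed.

Lemma span_image (l : seq V) v : span l v -> span (map u l : seq W) (u v).
Proof.
elim: l v => [|w l IH] v /=; first by move=> ->; exact: (linear0 u).
by move=> [a /IH va]; exists a; rewrite -module_homB.
Qed.

Lemma span_lift (l : seq W) : (forall w, w \in l -> exists v, u v = w) ->
  exists2 m : seq V, (forall v, v \in m -> (u v : W) \in l) &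
    forall w, span l w -> exists2 v, span m v & u v = w.
Proof.
elim: l => [|w l IH] lP.
  by exists [::] => // _ ->; exists 0 => //; exact: (linear0 u).
have [|m mP ml] := IH; first by move=> x xl; apply: lP; rewrite inE xl orbT.
have [v vw] := lP _ (mem_head _ _); exists (v :: m).
  move=> x; rewrite inE => /predU1P[->|/mP xl]; first by rewrite vw mem_head.
  by rewrite inE xl orbT.
move=> y /= [a /ml [x mx xy]]; exists (x + a *: v).
  by exists a; rewrite addrK.
have -> : u (x + a *: v) = (u x : W) + (u (a *: v) : W) by exact: (linearD u).
by rewrite hu vw xy subrK.
Qed.

Lemma preim_submod (S : W -> Prop) : submodule S -> submodule (fun v : V => S (u v)).
Proof.
move=> [S0 SP]; split=> [|a v w Sv Sw].
  by have -> : u (0 : V) = (0 : W) by exact: (linear0 u).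
have -> : u (a *: v + w) = (u (a *: v) : W) + (u w : W) by exact: (linearD u).
by rewrite hu; apply: SP.
Qed.

Lemma image_submod (S : V -> Prop) :
  submodule S -> submodule (fun w : W => exists2 v, S v & u v = w).
Proof.
move=> [S0 SP]; split=> [|a _ _ [v Sv <-] [w Sw <-]]; 
  first by exists 0 => //; exact: (linear0 u).
exists (a *: v + w); first exact: SP.
have -> : u (a *: v + w) = (u (a *: v) : W) + (u w : W) by exact: (linearD u).
by rewrite hu.
Qed.

End ModuleSpan.

Definition fg_module (R : pzRingType) (V : lmodType R) : Prop :=
  exists l : seq V, forall v, span l v.

Definition fg_complex (k : fieldType) (A : algebra k) (P : complex (module_cat A)) : Prop :=
  forall i, fg_module (P i : lmodType A).

Section Subcomplex.
Variables (k : fieldType) (A : algebra k) (N : complex (module_cat A)).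
Variable l : forall i, seq (N i : lmodType A).
Hypothesis l_dif : forall i j (x : N i : lmodType A), span (l i) x -> span (l j) (dif N i j x).

Let sub i : lmodType A := sublmod (span_submod (l i)).

Definition sub_incl_fun i (x : resk (sub i)) : resk (N i : lmodType A) := sub_val (x : sub i).
Fact sub_incl_linear i : linear (@sub_incl_fun i).
Proof. by []. Qed.
HB.instance Definition _ i := GRing.isLinear.Build k (resk (sub i))
  (resk (N i : lmodType A)) *:%R (@sub_incl_fun i) (@sub_incl_linear i).
Definition sub_incl i : {linear resk (sub i) -> resk (N i : lmodType A)} := @sub_incl_fun i.

Lemma sub_incl_inj i : injective (@sub_incl i).
Proof.
move=> x y xy; exact: (sub_val_inj (xy : sub_val (x : sub i) = sub_val (y : sub i))).
Qed.

Definition sub_dif_fun i j (x : resk (sub i)) : resk (sub j) :=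
  exist _ (dif N i j (sub_incl i x)) (l_dif j (sub_valP (x : sub i))).
Fact sub_dif_linear i j : linear (@sub_dif_fun i j).
Proof.
by move=> a x y; apply: sub_incl_inj; rewrite linearP /= /sub_incl_fun /= linearP.
Qed.
HB.instance Definition _ i j := GRing.isLinear.Build k (resk (sub i))
  (resk (sub j)) *:%R (@sub_dif_fun i j) (@sub_dif_linear i j).
Definition sub_dif i j : {linear resk (sub i) -> resk (sub j)} := @sub_dif_fun i j.

Definition subcomplex : complex (module_cat A).
Proof.
exists (fun i => sub i : module_cat A) sub_dif.
- by move=> i j a x; apply: sub_incl_inj; exact: (dif_hom N i j a (sub_val (x : sub i))).
- move=> i j x ij; apply: sub_incl_inj.
  exact: (@dif_shape _ _ N i j (sub_val (x : sub i)) ij).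
- by move=> i j m x; apply: sub_incl_inj; exact: (@dif_dif _ _ N i j m (sub_val (x : sub i))).
Defined.

Definition subcomplex_incl : chain_map subcomplex N.
Proof. by exists sub_incl. Defined.

Lemma subcomplex_fg : fg_complex subcomplex.
Proof. by move=> i; exact: sublmod_span_fin_gen. Qed.

Lemma subcomplex_factor (P : complex (module_cat A)) (g : chain_map P N) :
  (forall i p, span (l i) (g i p)) ->
  exists a : chain_map P subcomplex, chain_comp subcomplex_incl a = g.
Proof.
move=> gl.
pose a i (p : und (P i)) : resk (sub i) := exist _ (g i p) (gl i p).
have a_lin i : linear (a i) by move=> b p q; apply: sub_incl_inj; exact: linearP.
pose al i : {linear und (P i) -> resk (sub i)} :=
  HB.pack (a i) (GRing.isLinear.Build k _ _ *:%R _ (a_lin i)).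
have al_hom i : chom (al i : {linear und (P i) -> und (subcomplex i)}).
  by move=> b p; apply: sub_incl_inj; exact: (cm_hom g i b p).
have al_dif i j x : al j (dif P i j x) = dif subcomplex i j (al i x).
  apply: sub_incl_inj; change (g j (dif P i j x) = dif N i j (g i x)); exact: cm_dif.
by exists (ChainMap al_hom al_dif); apply: chain_map_ext.
Qed.

End Subcomplex.

Section FgSubcomplex.
Variables (k : fieldType) (A : algebra k).
Hypothesis ideal_fin_gen : forall S : A^o -> Prop, submodule S -> fin_gen S.
Variables (N P Q : complex (module_cat A)) (f : chain_map P N) (g : chain_map Q N).
Hypotheses (fdN : fd_cohomology N) (bN : bounded N).
Hypotheses (fgP : fg_complex P) (fgQ : fg_complex Q).

(** The second clause makes the inclusion injective on cohomology in degree [i + 1], the third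
    surjective in degree [i]. Only [l i] and [l (i + 1)] occur, so [l] can be built by descending
    induction. *)
Let good (l : forall i, seq (N i : lmodType A)) i : Prop :=
  [/\ forall x, span (l i) x -> span (l (i + 1)) (dif N i (i + 1) x),
      forall x, span (l (i + 1)) (dif N i (i + 1) x) ->
        exists2 x', span (l i) x' & dif N i (i + 1) x' = dif N i (i + 1) x,
      forall x, @cocycle _ _ N i x -> exists z, [/\ span (l i) z, @cocycle _ _ N i z &
        @coboundary _ _ N i (x - z)],
      forall p, span (l i) (f i p) & forall q, span (l i) (g i q)].

Let good_zero l i : (forall x : und (N i), x = 0) -> good l i.
Proof.
move=> N0; have s0 (x : und (N i)) : span (l i) x.
  by rewrite (N0 x); case: (span_submod (l i)).
split => // [x _|x _|x cx].
- by rewrite (N0 x) linear0; case: (span_submod (l (i + 1))).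
- by exists x.
- by exists x; split => //; rewrite subrr; case: (@coboundary_subspace _ _ N i).
Qed.

Let good_step l i : good l (i + 1) ->
  exists m : seq (N i : lmodType A), good (dfwith l m) i.
Proof.
move=> [_ _ _ Lf Lg]; pose S (y : N (i + 1) : lmodType A) := span (l (i + 1)) y.
have HS : @submodule _ (N (i + 1) : lmodType A) S by exact: span_submod.
pose d := dif N i (i + 1); have hd : module_hom d by exact: (dif_hom N i (i + 1)).
(* [ly] generates the coboundaries of [N] inside the span already chosen in degree [i + 1]; here the
   noetherian property enters. *)
have [||ly lyP] := sub_span_fin_gen ideal_fin_gen (l := l (i + 1))
  (S := fun y => S y /\ exists2 x, True & d x = y).
- have [S0 SP] := HS.
  have [I0 IP] := image_submod hd (S := fun=> True) (conj I (fun _ _ _ _ _ => I)).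
  by split=> // a u v [Su Iu] [Sv Iv]; split; [exact: SP|exact: IP].
- by move=> y [].
have [|lx lxl lxP] := span_lift hd (l := ly).
  by move=> y /span_mem /lyP [_ [x _ <-]]; exists x.
have [r [z [cz zP]]] := fdN i; have [lp lpP] := fgP i; have [lq lqP] := fgQ i.
(* Preimages of [ly], representatives of the cohomology, and images of generators of [P] and [Q]:
   one block for each of the last four clauses. *)
pose m : seq (N i : lmodType A) := lx ++ codom z ++ map (f i) lp ++ map (g i) lq.
have sub_m (l' : seq (N i : lmodType A)) : {subset l' <= m} ->
    forall x, span l' x -> span m x.
  by move=> l'm; apply: span_sub => [|x /l'm]; [exact: span_submod|exact: span_mem].
exists m; have E : dfwith l m i = m by exact: dfwith_in.
have E' : dfwith l m (i + 1) = l (i + 1).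
  by apply: dfwith_out; rewrite -[X in X == _]addr0 (inj_eq (addrI i)).
split; rewrite ?E ?E'.
- apply: span_sub; first exact: (preim_submod hd HS).
  move=> x; rewrite !mem_cat => /or4P[/lxl /span_mem /lyP []//|/codomP[s ->]| |].
  + by rewrite cz; case: HS.
  + by move=> /mapP[p _ ->]; rewrite -cm_dif.
  + by move=> /mapP[q _ ->]; rewrite -cm_dif.
- move=> x Sx; have /lyP /lxP [x' lx' dx'] : S (d x) /\ exists2 x', True & d x' = d x.
    by split=> //; exists x.
  by exists x' => //; apply: sub_m lx' => y; rewrite mem_cat => ->.
- move=> x /zP [c xc]; exists (\sum_s c s *: z s); split => //.
    elim/big_ind: _ => [|u v|s _].
    + by case: (span_submod m).
    + exact: (@submodD A (N i) (span m) u v (span_submod m)).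
    + have zs : span m (z s) by apply: span_mem; rewrite !mem_cat codom_f !orbT.
      exact: (@submodZ A (N i) (span m) (alg_in A (c s)) (z s) (span_submod m) zs).
  have [C0 CP] := @cocycle_subspace _ _ N i.
  by elim/big_rec: _ => // s y _ Cy; apply: (CP).
- move=> p; have /(span_image (cm_hom f i)) : span lp p by exact: lpP.
  by apply: sub_m => y; rewrite !mem_cat => ->; rewrite !orbT.
- move=> q; have /(span_image (cm_hom g i)) : span lq q by exact: lqP.
  by apply: sub_m => y; rewrite !mem_cat => ->; rewrite !orbT.
Qed.

Let good_ex : exists l, forall i, good l i.
Proof.
(* From degree [B + 1] on [N] vanishes, and the induction starts there with empty lists. *)
have [B NB] := bN; pose B' := B + 1.
have down (n : nat) : exists l, forall i, B' - n%:Z <= i -> good l i.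
  elim: n => [|n [l lP]].
    exists (fun=> [::]) => i; rewrite subr0 => Bi; apply: good_zero; apply: NB.
    by apply: lt_le_trans (ler_norm i); rewrite -lezD1.
  have [|m mP] := @good_step l (B' - n.+1%:Z).
    by apply: lP; rewrite -addn1 PoszD opprD addrA subrK.
  exists (dfwith l m) => i; rewrite le_eqVlt => /predU1P[<- //|Bi].
  have [a b c d e] : good l i.
    apply: lP; rewrite -lezD1 in Bi; apply: le_trans Bi.
    by rewrite -addn1 PoszD opprD addrA subrK.
  have Ei j : i <= j -> dfwith l m j = l j.
    by move=> ij; apply: dfwith_out; rewrite lt_eqF // (lt_le_trans Bi).
  by rewrite /good !Ei // lerDl.
(* After [n] steps the degree [B' - n] is at most [- B'], below which [N] vanishes again. *)
pose n := absz (B' + B'); have [l lP] := down n; exists l => i.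
have [/lP //|iB] := lerP (B' - n%:Z) i.
apply: good_zero; apply: NB; rewrite -normrN; apply: lt_le_trans (ler_norm _).
rewrite ltrNr; apply: lt_le_trans iB _; apply: (@le_trans _ _ (- B')).
  by rewrite lerBlDr -lerBlDl opprK abszE ler_norm.
by rewrite lerN2 /B' lerDl.
Qed.

(** In the applications [Q] is already embedded in [N], while [P] may reach [N] through a chain map
    from another complex. *)
Lemma fg_subcomplex : exists (S : complex (module_cat A)) (e : chain_map S N)
    (a : chain_map P S) (b : chain_map Q S),
  [/\ fg_complex S, (forall i, injective (e i)), quasi_iso e,
      chain_comp e a = f & chain_comp e b = g].
Proof.
have [l lP] := good_ex.
have l_dif i j (x : N i : lmodType A) : span (l i) x -> span (l j) (dif N i j x).
  have [->|ij] := eqVneq j (i + 1); first by case: (lP i) => + _ _ _ _; apply.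
  by rewrite dif_shape //; case: (span_submod (l j)).
have [i p|a aE] := @subcomplex_factor _ _ _ _ l_dif _ f; first by case: (lP i).
have [i p|b bE] := @subcomplex_factor _ _ _ _ l_dif _ g; first by case: (lP i).
exists (subcomplex l_dif), (subcomplex_incl l_dif), a, b; split => //.
- exact: subcomplex_fg.
- by move=> i; exact: sub_incl_inj.
move=> i; split=> [x cx /coboundaryP[y xy]|y cy]; last first.
  have [_ _ /(_ y cy) [z [lz cz yz]] _ _] := lP i.
  exists (exist _ z lz : sublmod (span_submod (l i))) => //.
  by move=> j; apply: sub_incl_inj; exact: cz.
(* If [x] is the differential of some [y] in [N], the second clause in degree [i - 1] replaces [y]
   by an element of the subcomplex with the same differential. *)
have [_ liftP _ _ _] := lP (i - 1).
have e : i - 1 + 1 = i by rewrite subrK.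
have [|y' ly' dy'] := liftP y.
  rewrite -(dcast_dif (esym e)) -xy.
  case: _ / (esym e); exact: sub_valP.
apply/coboundaryP; exists (exist _ y' ly' : sublmod (span_submod (l (i - 1)))).
apply: sub_incl_inj; rewrite [LHS]xy.
by rewrite -(dcast_dif e) -dy' dcast_dif.
Qed.

End FgSubcomplex.

(** * Localizations and opposite categories *)

Lemma iso_monic (k : fieldType) (T : klincat k) (X Y Z : T) (f : hom Y Z) (g h : hom X Y) :
  is_iso f -> compm f g = compm f h -> g = h.
Proof.
by move=> [i [fi _]] /(congr1 (fun u => compm i u)); rewrite !compmA fi !compm_idl.
Qed.

Lemma iso_epic (k : fieldType) (T : klincat k) (X Y Z : T) (f : hom X Y) (g h : hom Y Z) :
  is_iso f -> compm g f = compm h f -> g = h.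
Proof.
by move=> [i [_ fi]] /(congr1 (fun u => compm u i)); rewrite -!compmA fi !compm_idr.
Qed.

Lemma iso_cancel (k : fieldType) (T : klincat k) (X Y Z : T) (g : hom Y Z) (f : hom X Y) :
  is_iso f -> is_iso (compm g f) -> is_iso g.
Proof.
move=> [i [if_ fi]] [j [jg gj]]; exists (compm f j); split; last by rewrite compmA.
by apply: (iso_epic (ex_intro _ i (conj if_ fi))); rewrite -!compmA jg compm_idr compm_idl.
Qed.

Lemma fmor_iso (k : fieldType) (T U : klincat k) (F : klinfun T U) (X Y : T) (f : hom X Y) :
  is_iso f -> is_iso (fmor F f).
Proof.
by move=> [g [gf fg]]; exists (fmor F g); split; rewrite -fmor_comp ?gf ?fg fmor_id.
Qed.

Section Opposite.
Variable k : fieldType.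

(** Contravariant functors are encoded as functors to the opposite category, so that [klinfun] and
    [loc_lift] serve for them too. *)
Definition op (T : klincat k) : klincat k.
Proof.
exists (ob T) (fun X Y => @hom k T Y X) (@idm k T) (fun X Y Z g f => @compm k T Z Y X f g)
  (fun X Y => @zerom k T Y X) (fun X Y => @addm k T Y X) (fun X Y => @scalem k T Y X);
  intros; rewrite ?compmA ?compm_idl ?compm_idr ?scalemA ?scalem1 ?scalemDr ?scalemDl
    ?compm_addl ?compm_addr ?compm_scalel ?compm_scaler ?addmN //.
- exact: addmA.
- exact: addmC.
- exact: addm0.
Defined.

Definition op_fun (T U : klincat k) (F : klinfun T U) : klinfun (op T) (op U).
Proof.
by exists (fun X : op T => F X : op U) (fun X Y (f : @hom k (op T) X Y) => fmor F f);
  intros; rewrite /= ?fmor_id ?fmor_comp ?fmor_add ?fmor_scale.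
Defined.

Definition contra_fun (T U : klincat k) (F : T -> U)
    (m : forall X Y : T, hom X Y -> @hom k U (F Y) (F X))
    (m_id : forall X, m X X (idm X) = idm (F X))
    (m_comp : forall X Y Z (g : hom Y Z) (f : hom X Y),
      m X Z (compm g f) = compm (m X Y f) (m Y Z g))
    (m_add : forall X Y (f g : hom X Y), m X Y (addm f g) = addm (m X Y f) (m X Y g))
    (m_scale : forall X Y a (f : hom X Y), m X Y (scalem a f) = scalem a (m X Y f)) :
  klinfun T (op U) := @KLinFun k T (op U) F m m_id m_comp m_add m_scale.

Lemma op_iso (T : klincat k) (X Y : T) (f : hom X Y) :
  is_iso f -> @is_iso k (op T) Y X f.
Proof. by move=> [g [gf fg]]; exists g. Qed.

End Opposite.

Section LocalizationInduction.
Variables (k : fieldType) (T : klincat k) (W : forall X Y : T, hom X Y -> Prop).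

(** Induction on words, restated for classes: a formal inverse enters only as an inverse of the
    image of an element of [W]. *)
Lemma loc_ind (P : forall X Y : T, @hom k (localization W) X Y -> Prop) :
  (forall X Y (f : hom X Y), P X Y (fmor (loc_functor W) f)) ->
  (forall X Y Z v u, P Y Z v -> P X Y u -> P X Z (compm v u)) ->
  (forall X Y u v, P X Y u -> P X Y v -> P X Y (addm u v)) ->
  (forall X Y a u, P X Y u -> P X Y (scalem a u)) ->
  (forall X Y (s : hom X Y) t, W s -> inverse_of (fmor (loc_functor W) s) t -> P Y X t) ->
  forall X Y u, P X Y u.
Proof.
move=> Pmor Pcomp Padd Pscale Pinv X Y u; case: (lclassP u) => {}u ->.
elim: u => {X Y} [X Y f|X Y s Ws|X Y Z v IHv u IHu|X Y u IHu v IHv|X Y a u IHu].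
- exact: Pmor.
- apply: (Pinv _ _ s) => //.
  by split; rewrite /= lcompE; apply: lclassE; constructor.
- by rewrite -lcompE; apply: Pcomp.
- by rewrite -laddE; apply: Padd.
- by rewrite -lscaleE; apply: Pscale.
Qed.

End LocalizationInduction.

Section LocalizationNatural.
Variables (k : fieldType) (T U : klincat k) (W : forall X Y : T, hom X Y -> Prop).
Variables (F G : klinfun (localization W) U).
Variable tau : forall X : T, hom (F X) (G X).
Hypothesis tau_nat : forall (X Y : T) (f : hom X Y),
  compm (fmor G (fmor (loc_functor W) f)) (tau X) =
  compm (tau Y) (fmor F (fmor (loc_functor W) f)).

Lemma loc_natural (X Y : T) (u : @hom k (localization W) X Y) :
  compm (fmor G u) (tau X) = compm (tau Y) (fmor F u).
Proof.
move: X Y u; apply: loc_ind => //.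
- move=> X Y Z v u IHv IHu.
  by rewrite (fmor_comp F) (fmor_comp G) -compmA IHu compmA IHv compmA.
- by move=> X Y u v IHu IHv; rewrite (fmor_add F) (fmor_add G) compm_addl compm_addr IHu IHv.
- by move=> X Y a u IHu; rewrite (fmor_scale F) (fmor_scale G) compm_scalel compm_scaler IHu.
- move=> X Y s t Ws st; have [ts ts'] := st.
  have Gs : is_iso (fmor G (fmor (loc_functor W) s)) by apply: fmor_iso; exists t.
  apply: (iso_monic Gs); rewrite !compmA -(fmor_comp G) ts' fmor_id compm_idl.
  by rewrite tau_nat -compmA -(fmor_comp F) ts' fmor_id compm_idr.
Qed.

End LocalizationNatural.

(** [op (op T)] has the data of [T] with other proofs of the axioms, so the identity has to be a
    functor between them. *)
Definition op_op (k : fieldType) (T : klincat k) : klinfun T (op (op T)).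
Proof. by exists (fun X : T => X : op (op T)) (fun X Y (f : @hom k T X Y) => f). Defined.

Lemma loc_natural_unit (k : fieldType) (T U : klincat k) (W : forall X Y : T, hom X Y -> Prop)
    (F : klinfun (localization W) (op U)) (G : klinfun U (op (localization W)))
    (eta : forall X : localization W, @hom k (localization W) X (G (F X : U))) :
  (forall (X Y : T) (f : hom X Y),
    compm (fmor G (fmor F (fmor (loc_functor W) f) : @hom k U _ _) :
        @hom k (localization W) _ _) (eta X) = compm (eta Y) (fmor (loc_functor W) f)) ->
  forall (X Y : localization W) (w : hom X Y),
    compm (fmor G (fmor F w : @hom k U _ _) : @hom k (localization W) _ _) (eta X) =
    compm (eta Y) w.
Proof.
move=> eta_nat.
exact: (@loc_natural k T (op (op (localization W))) W (op_op (localization W))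
  (klinfun_comp (op_fun G) F) eta eta_nat).
Qed.

Lemma loc_natural_shift (k : fieldType) (T U : klincat k) (W : forall X Y : T, hom X Y -> Prop)
    (F : klinfun (localization W) (op U)) (s : klinfun (localization W) (localization W))
    (t : klinfun U U)
    (theta : forall X : localization W, @hom k U (F X) (t (F (s X)))) :
  (forall (X Y : T) (f : hom X Y),
    compm (theta X) (fmor F (fmor (loc_functor W) f) : @hom k U _ _) =
    compm (fmor t (fmor F (fmor s (fmor (loc_functor W) f)) : @hom k U _ _)) (theta Y)) ->
  forall (X Y : localization W) (w : hom X Y),
    compm (theta X) (fmor F w : @hom k U _ _) =
    compm (fmor t (fmor F (fmor s w) : @hom k U _ _)) (theta Y).
Proof.
move=> theta_nat.
exact: (@loc_natural k T (op U) W (klinfun_comp (op_fun t) (klinfun_comp F s)) F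
  theta theta_nat).
Qed.

Section LiftTwist.
Variables (k : fieldType) (T U : klincat k).
Variables (V : forall X Y : T, hom X Y -> Prop) (W : forall X Y : U, hom X Y -> Prop).
Variables (F : klinfun T (op U)) (s : klinfun T T) (t : klinfun U U).
Hypothesis F_iso : forall X Y (f : hom X Y), V f ->
  is_iso (fmor (klinfun_comp (op_fun (loc_functor W)) F) f).
Hypothesis s_iso : forall X Y (f : hom X Y), V f ->
  is_iso (fmor (klinfun_comp (loc_functor V) s) f).
Hypothesis t_iso : forall X Y (f : hom X Y), W f ->
  is_iso (fmor (klinfun_comp (loc_functor W) t) f).
Variable theta : forall X : T, @hom k U (F X) (t (F (s X))).
Hypothesis theta_nat : forall X Y (f : hom X Y),
  compm (theta X) (fmor F f : @hom k U _ _) =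
  compm (fmor t (fmor F (fmor s f) : @hom k U _ _)) (theta Y).

Definition lift_theta (X : localization V) : @hom k (localization W)
    (loc_lift F_iso X) (loc_lift t_iso (loc_lift F_iso (loc_lift s_iso X))) :=
  fmor (loc_functor W) (theta X).

Lemma lift_theta_nat (X Y : localization V) (w : hom X Y) :
  compm (lift_theta X) (fmor (loc_lift F_iso) w : @hom k (localization W) _ _) =
  compm (fmor (loc_lift t_iso)
    (fmor (loc_lift F_iso) (fmor (loc_lift s_iso) w) : @hom k (localization W) _ _))
    (lift_theta Y).
Proof.
move: X Y w; apply: loc_natural_shift => X Y f.
rewrite (loc_liftE s_iso) (loc_liftE F_iso) (loc_liftE F_iso (fmor s f)).
rewrite (loc_liftE t_iso (fmor F (fmor s f) : @hom k U _ _)) /lift_theta.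
by rewrite -[LHS](fmor_comp (loc_functor W)) theta_nat (fmor_comp (loc_functor W)).
Qed.

End LiftTwist.

Lemma loc_natural_id (k : fieldType) (T : klincat k) (W : forall X Y : T, hom X Y -> Prop)
    (s t : klinfun (localization W) (localization W))
    (alpha : forall X : localization W, @hom k (localization W) (t (s X)) X) :
  (forall (X Y : T) (f : hom X Y),
    compm (fmor (loc_functor W) f) (alpha X) =
    compm (alpha Y) (fmor t (fmor s (fmor (loc_functor W) f)))) ->
  forall (X Y : localization W) (w : hom X Y),
    compm w (alpha X) = compm (alpha Y) (fmor t (fmor s w)).
Proof.
move=> alpha_nat.
pose id_fun : klinfun (localization W) (localization W) :=
  KLinFun (fun X => erefl (idm X)) (fun X Y Z g f => erefl (compm g f))
    (fun X Y f g => erefl (addm f g)) (fun X Y a f => erefl (scalem a f)).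
exact: (@loc_natural k T (localization W) W (klinfun_comp t s) id_fun alpha alpha_nat).
Qed.

Section QuasiInverse.
Variables (k : fieldType) (U : klincat k) (s t : klinfun U U).
Variables (alpha : forall X : U, hom (t (s X)) X) (beta : forall X : U, hom (s (t X)) X).
Hypotheses (alpha_iso : forall X, is_iso (alpha X)) (beta_iso : forall X, is_iso (beta X)).
Hypothesis alpha_nat : forall X Y (w : hom X Y),
  compm w (alpha X) = compm (alpha Y) (fmor t (fmor s w)).
Hypothesis beta_nat : forall X Y (w : hom X Y),
  compm w (beta X) = compm (beta Y) (fmor s (fmor t w)).

Lemma quasi_inverse_inj (X Y : U) (v w : hom X Y) : fmor s v = fmor s w -> v = w.
Proof. by move=> E; apply: (iso_epic (alpha_iso X)); rewrite !alpha_nat E. Qed.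

Lemma quasi_inverse_surj (X Y : U) (v : hom (s X) (s Y)) : exists w, fmor s w = v.
Proof.
have [i [ia ai]] := alpha_iso X.
exists (compm (alpha Y) (compm (fmor t v) i)).
have t_inj (X' Y' : U) (v' w' : hom X' Y') : fmor t v' = fmor t w' -> v' = w'.
  by move=> E; apply: (iso_epic (beta_iso X')); rewrite !beta_nat E.
apply: t_inj; apply: (iso_monic (alpha_iso Y)); rewrite -alpha_nat.
by rewrite -!compmA ia compm_idr.
Qed.

End QuasiInverse.

Section Equivalence.
Variables (k : fieldType) (S T : klincat k) (F : klinfun S (op T)) (G : klinfun T (op S)).
Local Notation Fm w := (fmor F w : @hom k T _ _).
Local Notation Gm v := (fmor G v : @hom k S _ _).
Variables (eta : forall X : S, @hom k S X (G (F X : T))).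
Variables (sigma : forall N : T, @hom k T N (F (G N : S))).
Hypotheses (eta_iso : forall X, is_iso (eta X)) (sigma_iso : forall N, is_iso (sigma N)).
Hypothesis eta_nat : forall X Y (w : hom X Y), compm (Gm (Fm w)) (eta X) = compm (eta Y) w.
Hypothesis sigma_nat : forall N M (v : hom N M),
  compm (Fm (Gm v)) (sigma N) = compm (sigma M) v.

Lemma equiv_inj (X Y : S) (w w' : hom X Y) : fmor F w = fmor F w' -> w = w'.
Proof.
move=> E; apply: (iso_monic (eta_iso Y)); rewrite -!eta_nat.
by congr (compm _ _); congr (fmor G _).
Qed.

Lemma equiv_inj_inv (N M : T) (v v' : hom N M) : fmor G v = fmor G v' -> v = v'.
Proof.
move=> E; apply: (iso_monic (sigma_iso M)); rewrite -!sigma_nat.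
by congr (compm _ _); congr (fmor F _).
Qed.

(** The square of [eta] dictates [w] and gives [G (F w) = G v]; then [G] is cancelled, being
    faithful. *)
Lemma equiv_surj (X Y : S) (v : @hom k T (F Y) (F X)) :
  exists w : @hom k S X Y, fmor F w = v.
Proof.
have [i [ie ei]] := eta_iso Y.
exists (compm i (compm (Gm v) (eta X))); apply: equiv_inj_inv.
apply: (iso_epic (T := S) (eta_iso X)); rewrite [LHS]eta_nat.
by rewrite compmA ei compm_idl.
Qed.

End Equivalence.

(* The naturality square of the counit at f : N -> M, decomposed along
   N <- res N -> R <- res M -> M, in an abstract category. *)
Lemma counit_square (k : fieldType) (T : klincat k) (N M rN rM R DN DM DR : T)
    (f : hom N M) (pN : hom rN N) (pM : hom rM M) (a : hom rN R) (b : hom rM R) (e : hom R M)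
    (sN : hom N DN) (sM : hom M DM) (vN : hom rN DN) (vM : hom rM DM) (vR : hom R DR)
    (da : hom DN DR) (db : hom DM DR) (dphi : hom DN DM) :
  is_iso pN -> is_iso b -> is_iso db ->
  compm e a = compm f pN -> compm e b = pM ->
  compm sN pN = vN -> compm sM pM = vM ->
  compm da vN = compm vR a -> compm db vM = compm vR b ->
  compm db dphi = da ->
  compm dphi sN = compm sM f.
Proof.
move=> ipN ib idb ea eb sNp sMp ha hb hphi.
have H : compm db (compm sM e) = vR.
  by apply: (iso_epic ib); rewrite -!compmA eb sMp.
apply: (iso_monic idb); apply: (iso_epic ipN).
by rewrite compmA hphi -compmA sNp ha -!compmA -ea -[in LHS]H -!compmA.
Qed.

(** * Transport of the Calabi-Yau condition along a duality *)

Section Transport.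
Variables (k : fieldType) (S T : shiftcat k) (n : int).
Variable F : klinfun S (op T).
Local Notation Fm w := (fmor F w : @hom k T _ _).
Hypothesis F_inj : forall (X Y : S) (w w' : hom X Y), Fm w = Fm w' -> w = w'.
Hypothesis F_surj : forall (X Y : S) (v : @hom k T (F Y) (F X)),
  exists w : @hom k S X Y, Fm w = v.
Variable b : forall X Y : S, @hom k S Y (shift S n X) -> @hom k T (F X) (shift T n (F Y)).
Hypothesis b_add : forall X Y u v, @b X Y (addm u v) = addm (b u) (b v).
Hypothesis b_scale : forall X Y a u, @b X Y (scalem a u) = scalem a (b u).
Hypothesis b_inj : forall X Y u v, @b X Y u = b v -> u = v.
Hypothesis b_surj : forall X Y v, exists u, @b X Y u = v.
Hypothesis b_nat : forall X X' Y Y' (x : hom X' X) (y : hom Y Y') (u : hom Y' (shift S n X')),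
  b (compm (fmor (shift S n) x) (compm u y)) =
  compm (fmor (shift T n) (Fm y)) (compm (b u) (Fm x)).

Lemma hom_finite_transport : hom_finite T -> hom_finite S.
Proof.
move=> finT X Y; have [r [e eP]] := finT (F Y) (F X).
pose e' i := projT1 (cid (F_surj (e i))).
have e'P i : fmor F (e' i) = e i by rewrite /e'; case: cid.
exists r, e' => f; have [c fc] := eP (fmor F f); exists c; apply: F_inj.
rewrite fc (big_morph (fun g : hom X Y => Fm g) (id1 := zerom _ _) (op1 := @addm k T _ _)).
- by apply: eq_bigr => i _; rewrite fmor_scale e'P.
- by move=> u v; exact: (fmor_add F).
- exact: (fmor0 F).
Qed.

(** The pair [(X, Y)] of [S] corresponds to [(F Y, F X)] in [T]: [f] and [u] are paired as [F f] and
    [b u]. *)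
Lemma calabi_yau_transport : calabi_yau T n -> calabi_yau S n.
Proof.
move=> [finT [phi [phiL phiD phiU phiN]]]; split; first exact: hom_finite_transport.
exists (fun X Y f u => phi (F Y) (F X) (Fm f) (b u)); split.
- by move=> X Y f a u v; rewrite b_add b_scale; exact: phiL.
- by move=> X Y a f g u; rewrite -phiD; congr (phi _ _ _ _);
    rewrite (fmor_add F) (fmor_scale F).
- move=> X Y l lL; pose c v := projT1 (cid (@b_surj X Y v)).
  have cK v : b (c v) = v by rewrite /c; case: cid.
  have cb u : c (b u) = u by apply: b_inj; rewrite cK.
  have [|g [gl gU]] := phiU (F Y) (F X) (fun v => l (c v)).
    move=> a u v; rewrite -lL; congr (l _); apply: b_inj.
    by rewrite b_add b_scale !cK.
  have [f fg] := F_surj g; exists f; split=> [|f' f'l].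
    by apply: funext => u; rewrite fg gl cb.
  apply: F_inj; rewrite fg; apply: gU; apply: funext => v.
  by rewrite -[v in LHS]cK -f'l.
- move=> X X' Y Y' x f y u; rewrite b_nat -phiN; congr (phi _ _ _ _).
  by rewrite !(fmor_comp F) /= compmA.
Qed.

End Transport.

Section ShiftEquivalence.
Variables (k : fieldType) (S T : shiftcat k) (n : int).
Variables (F : klinfun S (op T)) (G : klinfun T (op S)).
Local Notation Fm w := (fmor F w : @hom k T _ _).
Local Notation Gm v := (fmor G v : @hom k S _ _).
Variables (eta : forall X : S, @hom k S X (G (F X : T))).
Variables (sigma : forall N : T, @hom k T N (F (G N : S))).
Hypotheses (eta_iso : forall X, is_iso (eta X)) (sigma_iso : forall N, is_iso (sigma N)).
Hypothesis eta_nat : forall X Y (w : hom X Y), compm (Gm (Fm w)) (eta X) = compm (eta Y) w.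
Hypothesis sigma_nat : forall N M (v : hom N M),
  compm (Fm (Gm v)) (sigma N) = compm (sigma M) v.
Hypothesis sh_inj : forall N M (v v' : hom N M),
  fmor (shift T n) v = fmor (shift T n) v' -> v = v'.
Hypothesis sh_surj : forall N M (v : hom (shift T n N) (shift T n M)),
  exists v' : hom N M, fmor (shift T n) v' = v.
Variable theta : forall X : S, @hom k T (F X) (shift T n (F (shift S n X : S))).
Hypothesis theta_iso : forall X, is_iso (theta X).
Hypothesis theta_nat : forall X Y (w : hom X Y),
  compm (theta X) (Fm w) = compm (fmor (shift T n) (Fm (fmor (shift S n) w))) (theta Y).

(** [F] and the shift turn [u : Y -> X[n]] into a map [F(X[n])[n] -> (F Y)[n]], and [theta] corrects
    its source to [F X]. *)
Let b X Y (u : @hom k S Y (shift S n X)) : @hom k T (F X) (shift T n (F Y)) :=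
  compm (fmor (shift T n) (Fm u)) (theta X).

Let b_add X Y (u v : hom Y (shift S n X)) : b (addm u v) = addm (b u) (b v).
Proof. by rewrite /b (fmor_add F) /= fmor_add compm_addl. Qed.

Let b_scale X Y a (u : hom Y (shift S n X)) : b (scalem a u) = scalem a (b u).
Proof. by rewrite /b (fmor_scale F) /= fmor_scale compm_scalel. Qed.

Let b_inj X Y (u v : hom Y (shift S n X)) : b u = b v -> u = v.
Proof.
by move=> /(iso_epic (theta_iso X)) /sh_inj /(equiv_inj eta_iso eta_nat).
Qed.

Let b_surj X Y (v : @hom k T (F X) (shift T n (F Y))) : exists u, @b X Y u = v.
Proof.
have [i [it ti]] := theta_iso X; have [v' v'E] := sh_surj (compm v i).
have [u uv] := equiv_surj eta_iso sigma_iso eta_nat sigma_nat v'.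
by exists u; rewrite /b uv v'E -compmA it compm_idr.
Qed.

Let b_nat X X' Y Y' (x : hom X' X) (y : hom Y Y') (u : hom Y' (shift S n X')) :
  b (compm (fmor (shift S n) x) (compm u y)) =
  compm (fmor (shift T n) (Fm y)) (compm (b u) (Fm x)).
Proof.
rewrite /b !(fmor_comp F) /= !fmor_comp -!compmA; congr (compm _ _).
by rewrite theta_nat.
Qed.

Lemma calabi_yau_equivalence : calabi_yau S n <-> calabi_yau T n.
Proof.
split; last first.
  apply: (@calabi_yau_transport k S T n F _ _ (fun X Y u => b u)) => //.
  - exact: (equiv_inj eta_iso eta_nat).
  - exact: (equiv_surj eta_iso sigma_iso eta_nat sigma_nat).
(* For the converse, [G] takes the place of [F]. Its comparison map is obtained by inverting [b]
   after conjugation with [sigma], which spares the construction of a shift isomorphism for [G]. *)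
have cex (A B : T) (u : hom B (shift T n A)) :
    exists c : @hom k S (G A) (shift S n (G B)),
    compm (b c) (sigma B) = compm (fmor (shift T n) (sigma A)) u.
  have [i [is_ si]] := sigma_iso B.
  have [c cE] := b_surj (compm (compm (fmor (shift T n) (sigma A)) u) i).
  by exists c; rewrite cE -compmA is_ compm_idr.
pose c (A B : T) u := projT1 (cid (@cex A B u)).
have cP (A B : T) u : compm (b (@c A B u)) (sigma B) = compm (fmor (shift T n) (sigma A)) u.
  by rewrite /c; case: cid.
have cU (A B : T) u w : compm (b w) (sigma B) = compm (fmor (shift T n) (sigma A)) u ->
    @c A B u = w.
  by rewrite -cP => /(iso_epic (sigma_iso B)) /b_inj ->.
apply: (@calabi_yau_transport k T S n G _ _ (fun X Y u => c X Y u)).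
- exact: (equiv_inj_inv sigma_iso sigma_nat).
- exact: (equiv_surj sigma_iso eta_iso sigma_nat eta_nat).
- by move=> A B u v; apply: cU; rewrite b_add compm_addl !cP compm_addr.
- by move=> A B a u; apply: cU; rewrite b_scale compm_scalel cP compm_scaler.
- move=> A B u v E; apply: (iso_monic (fmor_iso (shift T n) (sigma_iso A))).
  by rewrite -!cP E.
- move=> A B w; have [i [is_ si]] := fmor_iso (shift T n) (sigma_iso A).
  exists (compm i (compm (b w) (sigma B))); apply: cU.
  by rewrite compmA si compm_idl.
move=> X X' Y Y' x y u; apply: cU.
rewrite b_nat -!compmA sigma_nat; have := congr1 (fun w => compm w y) (cP _ _ u).
rewrite /b -!compmA => ->.
by rewrite !compmA -!fmor_comp sigma_nat.
Qed.

End ShiftEquivalence.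

(** * The shift as an autoequivalence of the derived category *)

Section ShiftFunctor.
Variables (k : fieldType) (B : concrete_cat k).
Local Notation T := (chain_cat B).
Local Notation SB := (derived_klincat B).
Local Notation L f := (fmor (loc_functor (@quasi_isos k B)) f : @hom k SB _ _).

Lemma derived_shiftE n (X Y : T) (f : hom X Y) :
  fmor (derived_shift B n) (L f) =
  L (shift_map n f : @hom k T (shift_bfd n X) (shift_bfd n Y)).
Proof. exact: (loc_liftE (@derived_shift_iso k B n) f). Qed.

Section Unshift.
Variables (m n : int).
Hypothesis mn : m + n = 0.

Lemma shift_sign_mul : shift_sign k m * shift_sign k n = 1.
Proof. by rewrite /shift_sign -expfzDr ?mn // oppr_eq0 oner_eq0. Qed.

Lemma unshift_deg (i : int) : i + m + n = i.
Proof. by rewrite -addrA mn addr0. Qed.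

(** The signs [(-1)^m] and [(-1)^n] cancel as [m + n = 0]. Used in both orders, this makes the
    shifts by [n] and [- n] quasi-inverse. *)
Definition unshift (X : complex B) : chain_map (shift_complex m (shift_complex n X)) X.
Proof.
exists (fun i => dcast X (unshift_deg i) :
  {linear und (shift_complex m (shift_complex n X) i) -> und (X i)}).
- by move=> i; exact: (dcast_hom X (unshift_deg i)).
- move=> i j x.
  transitivity (dcast X (unshift_deg j)
    (shift_sign k m *: (shift_sign k n *: dif X (i + m + n) (j + m + n) x))) => //.
  by rewrite scalerA shift_sign_mul scale1r dif_dcast dcast_dif.
Defined.

Lemma unshift_quasi_iso X : quasi_iso (unshift X).
Proof.
apply: bijective_quasi_iso => [i|i y].
  exact: (can_inj (dcastK (X := X) (unshift_deg i) (esym (unshift_deg i)))).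
exists (dcast X (esym (unshift_deg i)) y).
exact: (dcastK (X := X) (esym (unshift_deg i)) (unshift_deg i)).
Qed.

Definition unshift_mor (X : T) : @hom k T (shift_bfd m (shift_bfd n X)) X := unshift X.

Definition unshift_derived (X : SB) :
  @hom k SB (derived_shift B m (derived_shift B n X)) X := L (unshift_mor X).

Lemma unshift_derived_iso X : is_iso (unshift_derived X).
Proof.
apply: (loc_functor_iso (W := @quasi_isos k B)); exact: unshift_quasi_iso.
Qed.

Lemma unshift_nat (X Y : T) (f : @hom k T X Y) :
  compm (L f) (unshift_derived X) =
  compm (unshift_derived Y) (fmor (derived_shift B m) (fmor (derived_shift B n) (L f))).
Proof.
rewrite derived_shiftE (derived_shiftE m).
have E : compm f (unshift_mor X) = compm (unshift_mor Y) (shift_map m (shift_map n f) :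
    @hom k T (shift_bfd m (shift_bfd n X)) (shift_bfd m (shift_bfd n Y))).
  by apply: chain_map_ext => i x; rewrite /= cm_dcast.
transitivity (L (compm f (unshift_mor X))); first by rewrite fmor_comp.
by rewrite E fmor_comp.
Qed.

Lemma unshift_derived_nat (X Y : SB) (w : hom X Y) :
  compm w (unshift_derived X) =
  compm (unshift_derived Y) (fmor (derived_shift B m) (fmor (derived_shift B n) w)).
Proof. by move: X Y w; exact: (loc_natural_id unshift_nat). Qed.

End Unshift.

Variable n : int.

Lemma derived_shift_inj (X Y : SB) (v w : hom X Y) :
  fmor (derived_shift B n) v = fmor (derived_shift B n) w -> v = w.
Proof.
exact: (quasi_inverse_inj (unshift_derived_iso (addNr n)) (unshift_derived_nat (addNr n))).
Qed.

Lemma derived_shift_surj (X Y : SB) (v : hom (derived_shift B n X) (derived_shift B n Y)) :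
  exists w : hom X Y, fmor (derived_shift B n) w = v.
Proof.
exact: (quasi_inverse_surj (unshift_derived_iso (addNr n)) (unshift_derived_iso (addrN n))
  (unshift_derived_nat (addNr n)) (unshift_derived_nat (addrN n))).
Qed.

End ShiftFunctor.

(** * The derived duality *)

Section DerivedDuality.
Variables (k : fieldType) (C : coalgebra k).
Hypothesis Cart : lartinian (lregular C).
Local Notation A := (dual_algebra C).
Local Notation TC := (chain_cat (comod_cat C)).
Local Notation TA := (chain_cat (module_cat A)).
Local Notation SC := (derived_klincat (comod_cat C)).
Local Notation SA := (derived_klincat (module_cat A)).
Local Notation LC f := (fmor (loc_functor (@quasi_isos k (comod_cat C))) f : @hom k SC _ _).
Local Notation LA f := (fmor (loc_functor (@quasi_isos k (module_cat A))) f : @hom k SA _ _).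

Definition dual_bfd (X : TC) : TA :=
  BfdComplex (dual_bounded (bfd_bounded X)) (dual_fd (bfd_fd X)).

Definition dual_functor : klinfun TC (op TA).
Proof.
exists (fun X => dual_bfd X : op TA) (fun X Y (f : @hom k TC X Y) => dual_map f);
  intros; apply: chain_map_ext => i phi; apply: forms_ext => x //.
- exact: (linearD (phi : {linear _ -> k^o})).
- transitivity (a * (cpull (f (- i)) phi : cdual _) x).
    exact: (linearZ_LR (phi : {linear _ -> k^o})).
  by rewrite -resk_cdualE.
Defined.

Definition dual_derived_fun : klinfun TC (op SA) :=
  klinfun_comp (op_fun (loc_functor (@quasi_isos k (module_cat A)))) dual_functor.

Lemma dual_derived_iso (X Y : TC) (s : hom X Y) :
  quasi_isos s -> is_iso (fmor dual_derived_fun s).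
Proof.
move=> qs; apply: op_iso; apply: (loc_functor_iso (W := @quasi_isos k (module_cat A))).
exact: dual_map_quasi_iso.
Qed.

Definition dual_derived : klinfun SC (op SA) := loc_lift dual_derived_iso.

Lemma dual_derivedE (X Y : TC) (f : hom X Y) :
  fmor dual_derived (LC f) = LA (dual_map f : @hom k TA (dual_bfd Y) (dual_bfd X)).
Proof. exact: (loc_liftE dual_derived_iso f). Qed.

Lemma fg_complex_reflexive (P : complex (module_cat A)) : fg_complex P -> reflexive_complex P.
Proof. by move=> fP i; have [l lP] := fP i; exact: fin_gen_reflexive lP. Qed.

Lemma fg_subobject (N : TA) (P Q : complex (module_cat A))
    (f : chain_map P N) (g : chain_map Q N) :
  fg_complex P -> fg_complex Q ->
  exists (R : TA) (e : @hom k TA R N) (a : chain_map P R) (b : chain_map Q R),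
  [/\ fg_complex R, (forall i, injective (e i)), quasi_isos e,
      chain_comp e a = f & chain_comp e b = g].
Proof.
move=> fP fQ; have [|R [e [a [b [fgR eI qe ea eb]]]]] :=
  fg_subcomplex _ f g (bfd_fd N) (bfd_bounded N) fP fQ.
  by move=> S; exact: artinian_ideal_fin_gen.
have bR : bounded R.
  have [B NB] := bfd_bounded N; exists B => i Bi x.
  by apply: eI; rewrite linear0; exact: NB.
by exists (BfdComplex bR (quasi_iso_fd_source qe (bfd_fd N))), e, a, b.
Qed.

Lemma fg_span (N P Q : TA) (f : @hom k TA P N) (g : @hom k TA Q N) :
  fg_complex P -> fg_complex Q ->
  exists (R : TA) (e : @hom k TA R N) (a : @hom k TA P R) (b : @hom k TA Q R),
  [/\ fg_complex R, (forall i, injective (e i)), quasi_isos e,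
      compm e a = f & compm e b = g].
Proof. exact: fg_subobject. Qed.

Lemma resolution_ex (N : TA) : exists (P : TA) (e : @hom k TA P N),
  [/\ fg_complex P, (forall i, injective (e i)) & quasi_isos e].
Proof.
(* The zero subcomplex, since here nothing prescribed has to be contained in the resolution. *)
pose Z : complex (module_cat A) := subcomplex (N := N) (l := fun=> [::])
  (fun i j x (x0 : x = 0) => etrans (congr1 _ x0) (linear0 (dif N i j))).
have fgZ : fg_complex Z by exact: subcomplex_fg.
have [R [e [_ [_ [fgR eI qe _ _]]]]] :=
  fg_subobject (chain0 Z N) (chain0 Z N) fgZ fgZ.
by exists R, e.
Qed.

(** * The inverse duality on chosen resolutions *)

Definition res (N : TA) : TA := projT1 (cid (resolution_ex N)).
Definition res_map (N : TA) : @hom k TA (res N) N :=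
  projT1 (cid (projT2 (cid (resolution_ex N)))).

Lemma res_mapP (N : TA) :
  [/\ fg_complex (res N), (forall i, injective (res_map N i)) & quasi_isos (res_map N)].
Proof. by rewrite /res_map /res; case: cid => P e /=; case: cid. Qed.

Lemma res_fg N : fg_complex (res N). Proof. by case: (res_mapP N). Qed.
Lemma res_qi N : quasi_isos (res_map N). Proof. by case: (res_mapP N). Qed.

Definition rdual_bfd (P : TA) (fP : fg_complex P) : TC :=
  BfdComplex (rdual_bounded (bfd_bounded P))
    (rdual_fd (fg_complex_reflexive fP) (bfd_fd P)).

Definition rdual_hom (P Q : TA) (fP : fg_complex P) (fQ : fg_complex Q) (f : @hom k TA P Q) :
  @hom k TC (rdual_bfd fQ) (rdual_bfd fP) := rdual_map f.

Lemma rdual_hom_iso (P Q : TA) (fP : fg_complex P) (fQ : fg_complex Q) (f : @hom k TA P Q) :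
  quasi_isos f -> is_iso (LC (rdual_hom fP fQ f)).
Proof.
move=> qf; apply: (loc_functor_iso (W := @quasi_isos k (comod_cat C))).
by apply: rdual_map_quasi_iso => //; exact: fg_complex_reflexive.
Qed.

Lemma rdual_hom_comp (P Q R : TA) (fP : fg_complex P) (fQ : fg_complex Q)
    (fR : fg_complex R) (g : @hom k TA Q R) (f : @hom k TA P Q) :
  LC (rdual_hom fP fR (compm g f)) =
  compm (LC (rdual_hom fP fQ f)) (LC (rdual_hom fQ fR g)).
Proof.
rewrite -fmor_comp; congr (fmor _ _); apply: chain_map_ext => i x.
exact: rdual_ext.
Qed.

Lemma rdual_hom_id (P : TA) (fP : fg_complex P) : rdual_hom fP fP (idm P) = idm _.
Proof. by apply: chain_map_ext => i x; exact: rdual_ext. Qed.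

Lemma rdual_hom_add (P Q : TA) (fP : fg_complex P) (fQ : fg_complex Q) (f g : @hom k TA P Q) :
  rdual_hom fP fQ (addm f g) = addm (rdual_hom fP fQ f) (rdual_hom fP fQ g).
Proof.
apply: chain_map_ext => i x; apply: rdual_ext => p.
exact: (linearD (sub_val (x : rdual _) : {linear _ -> k^o})).
Qed.

Lemma rdual_hom_scale (P Q : TA) (fP : fg_complex P) (fQ : fg_complex Q) a
    (f : @hom k TA P Q) :
  rdual_hom fP fQ (scalem a f) = scalem a (rdual_hom fP fQ f).
Proof.
apply: chain_map_ext => i x; apply: rdual_ext => p.
exact: (linearZ_LR (sub_val (x : rdual _) : {linear _ -> k^o})).
Qed.

(** Inclusions are monic among chain maps, before localization, so diagrams of subcomplexes commute
    strictly. *)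
Lemma chain_monic (P Q N : TA) (e : @hom k TA Q N) (a b : @hom k TA P Q) :
  (forall i, injective (e i)) -> compm e a = compm e b -> a = b.
Proof.
move=> eI E; apply: chain_map_ext => i x; apply: eI.
exact: (congr1 (fun h : chain_map P N => h i x) E).
Qed.

Local Notation G0 N := (rdual_bfd (res_fg N)).

(* phi is the morphism induced by f: f maps the chosen resolution of N into
   some larger finitely generated subcomplex R of M containing the chosen
   resolution of M. *)
Definition induced (N M : TA) (f : @hom k TA N M) (phi : @hom k SC (G0 M) (G0 N)) : Prop :=
  exists (R : TA) (fR : fg_complex R) (e : @hom k TA R M)
    (a : @hom k TA (res N) R) (b : @hom k TA (res M) R),
  [/\ (forall i, injective (e i)) /\ quasi_isos e,
      compm e a = compm f (res_map N), compm e b = res_map M &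
      compm phi (LC (rdual_hom (res_fg M) fR b)) = LC (rdual_hom (res_fg N) fR a)].

Lemma induced_b_qi (M R : TA) (e : @hom k TA R M) (b : @hom k TA (res M) R) :
  quasi_isos e -> compm e b = res_map M -> quasi_isos b.
Proof.
move=> qe eb; apply: (quasi_iso_cancel_l qe).
by have := @res_qi M; rewrite -eb.
Qed.

Lemma induced_ex (N M : TA) (f : @hom k TA N M) : exists phi, induced f phi.
Proof.
have [R [e [a [b [fR eI qe ea eb]]]]] :=
  fg_span (compm f (res_map N)) (res_map M) (@res_fg N) (@res_fg M).
(* By two out of three [b] is a quasi-isomorphism, so its finite dual is invertible and the defining
   relation can be solved for [phi]. *)
have [i [ib bi]] := rdual_hom_iso (@res_fg M) fR (induced_b_qi qe eb).
exists (compm (LC (rdual_hom (res_fg N) fR a)) i), R, fR, e, a, b; split => //.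
by rewrite -compmA ib compm_idr.
Qed.

Lemma induced_uniq (N M : TA) (f : @hom k TA N M) phi psi :
  induced f phi -> induced f psi -> phi = psi.
Proof.
move=> [R [fR [e [a [b [[eI qe] ea eb phiE]]]]]].
move=> [R' [fR' [e' [a' [b' [[eI' qe'] ea' eb' psiE]]]]]].
(* The two choices are compared inside a common [R3], where the maps from either resolution agree
   because [e3] is injective. *)
have [R3 [e3 [c [c' [fR3 eI3 qe3 ec ec']]]]] := fg_span e e' fR fR'.
have Ea : compm c a = compm c' a' by apply: (chain_monic eI3); rewrite !compmA ec ec' ea.
have Eb : compm c b = compm c' b' by apply: (chain_monic eI3); rewrite !compmA ec ec' eb.
apply: (iso_epic (rdual_hom_iso (@res_fg M) fR3 (f := compm c b) _)).
  by apply: (induced_b_qi qe3); rewrite compmA ec.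
rewrite (rdual_hom_comp (@res_fg M) fR fR3) compmA phiE.
rewrite -(rdual_hom_comp (@res_fg N) fR fR3) Ea.
rewrite (rdual_hom_comp (@res_fg N) fR' fR3) -psiE.
rewrite -compmA -(rdual_hom_comp (@res_fg M) fR' fR3) -Eb.
by rewrite (rdual_hom_comp (@res_fg M) fR fR3).
Qed.

Lemma LC_comp (X Y Z : TC) (g : hom Y Z) (f : hom X Y) :
  LC (compm g f) = compm (LC g) (LC f).
Proof. exact: fmor_comp. Qed.

Lemma LA_comp (X Y Z : TA) (g : hom Y Z) (f : hom X Y) :
  LA (compm g f) = compm (LA g) (LA f).
Proof. exact: fmor_comp. Qed.

Lemma induced_id (N : TA) : induced (idm N) (idm (G0 N : SC)).
Proof.
have [fN eI qe] := res_mapP N.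
exists (res N), (res_fg N), (res_map N), (idm _), (idm _).
split; [by []|by rewrite compm_idr compm_idl|by rewrite compm_idr|].
by rewrite rdual_hom_id compm_idl.
Qed.

Lemma induced_comp (N M L : TA) (g : @hom k TA M L) (f : @hom k TA N M) phi psi :
  induced f phi -> induced g psi -> induced (compm g f) (compm phi psi).
Proof.
move=> [R [fR [e [a [b [[eI qe] ea eb phiE]]]]]].
move=> [R' [fR' [e' [a' [b' [[eI' qe'] ea' eb' psiE]]]]]].
(* [R3] receives [R] through [g] and contains [R']; in it the two maps from the resolution of [M]
   agree. *)
have [R3 [e3 [c [c' [fR3 eI3 qe3 ec ec']]]]] := fg_span (compm g e) e' fR fR'.
have E : compm c' a' = compm c b.
  by apply: (chain_monic eI3); rewrite !compmA ec ec' ea' -[RHS]compmA eb.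
exists R3, fR3, e3, (compm c a), (compm c' b'); split=> //.
- by rewrite compmA ec -compmA ea compmA.
- by rewrite compmA ec'.
rewrite (rdual_hom_comp (res_fg L) fR' fR3) (rdual_hom_comp (res_fg N) fR fR3).
rewrite -phiE -[in LHS]compmA [compm psi _]compmA psiE -(rdual_hom_comp (res_fg M) fR' fR3).
by rewrite E (rdual_hom_comp (res_fg M) fR fR3) compmA.
Qed.

Lemma induced_add (N M : TA) (f g : @hom k TA N M) phi psi :
  induced f phi -> induced g psi -> induced (addm f g) (addm phi psi).
Proof.
move=> [R [fR [e [a [b [[eI qe] ea eb phiE]]]]]].
move=> [R' [fR' [e' [a' [b' [[eI' qe'] ea' eb' psiE]]]]]].
have [R3 [e3 [c [c' [fR3 eI3 qe3 ec ec']]]]] := fg_span e e' fR fR'.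
have Eb : compm c b = compm c' b' by apply: (chain_monic eI3); rewrite !compmA ec ec' eb.
exists R3, fR3, e3, (addm (compm c a) (compm c' a')), (compm c b); split=> //.
- by rewrite compm_addr !compmA ec ec' ea ea' compm_addl.
- by rewrite compmA ec.
rewrite rdual_hom_add fmor_add (rdual_hom_comp (res_fg N) fR fR3).
rewrite (rdual_hom_comp (res_fg N) fR' fR3) -phiE -psiE compm_addl {2}Eb.
by rewrite (rdual_hom_comp (res_fg M) fR fR3) (rdual_hom_comp (res_fg M) fR' fR3) !compmA.
Qed.

Lemma induced_scale (N M : TA) x (f : @hom k TA N M) phi :
  induced f phi -> induced (scalem x f) (scalem x phi).
Proof.
move=> [R [fR [e [a [b [eI ea eb phiE]]]]]]; exists R, fR, e, (scalem x a), b; split=> //.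
  by rewrite compm_scaler ea compm_scalel.
by rewrite compm_scalel phiE rdual_hom_scale fmor_scale.
Qed.

Lemma induced_iso (N M : TA) (f : @hom k TA N M) phi :
  quasi_isos f -> induced f phi -> is_iso phi.
Proof.
move=> qf [R [fR [e [a [b [[eI qe] ea eb phiE]]]]]].
have qa : quasi_isos a.
  apply: (quasi_iso_cancel_l qe); have := quasi_iso_comp (res_qi N) qf.
  by have -> : chain_comp f (res_map N) = chain_comp e a by rewrite [RHS]ea.
have [i [ib bi]] := rdual_hom_iso (res_fg M) fR (induced_b_qi qe eb).
have [j [ja aj]] := rdual_hom_iso (res_fg N) fR qa.
exists (compm (LC (rdual_hom (res_fg M) fR b)) j); split; last by rewrite compmA phiE aj.
apply: (iso_epic (rdual_hom_iso (res_fg M) fR (induced_b_qi qe eb))).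
by rewrite -compmA phiE -compmA ja compm_idr compm_idl.
Qed.

Definition induced_mor (N M : TA) (f : @hom k TA N M) : @hom k SC (G0 M) (G0 N) :=
  projT1 (cid (induced_ex f)).

Lemma induced_morP N M f : induced f (@induced_mor N M f).
Proof. by rewrite /induced_mor; case: cid. Qed.

Lemma induced_morE N M f phi : induced f phi -> @induced_mor N M f = phi.
Proof. exact: induced_uniq (induced_morP f). Qed.

Lemma induced_mor_id N : induced_mor (idm N) = idm (G0 N : SC).
Proof. exact: induced_morE (induced_id N). Qed.

Lemma induced_mor_comp N M L (g : @hom k TA M L) (f : @hom k TA N M) :
  induced_mor (compm g f) = compm (induced_mor f) (induced_mor g).
Proof. exact: induced_morE (induced_comp (induced_morP f) (induced_morP g)). Qed.

Lemma induced_mor_add N M (f g : @hom k TA N M) :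
  induced_mor (addm f g) = addm (induced_mor f) (induced_mor g).
Proof. exact: induced_morE (induced_add (induced_morP f) (induced_morP g)). Qed.

Lemma induced_mor_scale N M x (f : @hom k TA N M) :
  induced_mor (scalem x f) = scalem x (induced_mor f).
Proof. exact: induced_morE (induced_scale x (induced_morP f)). Qed.

Definition rdual_derived_fun : klinfun TA (op SC) :=
  @contra_fun k TA SC (fun N => G0 N) (fun N M f => @induced_mor N M f)
    induced_mor_id induced_mor_comp induced_mor_add induced_mor_scale.

Lemma rdual_derived_iso (N M : TA) (s : hom N M) :
  quasi_isos s -> is_iso (fmor rdual_derived_fun s).
Proof. by move=> qs; apply: op_iso; exact: induced_iso qs (induced_morP s). Qed.

Definition rdual_derived : klinfun SA (op SC) := loc_lift rdual_derived_iso.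

Lemma rdual_derivedE (N M : TA) (f : hom N M) :
  fmor rdual_derived (LA f) = induced_mor f.
Proof. exact: (loc_liftE rdual_derived_iso f). Qed.

Local Notation D := dual_derived.
Local Notation Dm w := (fmor D w : @hom k SA _ _).
Local Notation Gm v := (fmor rdual_derived v : @hom k SC _ _).

(** * Unit and counit of the duality *)

Definition unit_mor (X : TC) : @hom k TC X (G0 (dual_bfd X)) :=
  adj_map (res_map (dual_bfd X)).

Definition unit_derived (X : SC) : @hom k SC X (rdual_derived (D X : SA)) := LC (unit_mor X).

Lemma unit_derived_iso X : is_iso (unit_derived X).
Proof.
apply: (loc_functor_iso (W := @quasi_isos k (comod_cat C))).
apply: adj_map_quasi_iso; last exact: res_qi.
by apply: (fg_complex_reflexive); exact: res_fg.
Qed.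

Lemma unit_derived_nat_mor (X Y : TC) (f : @hom k TC X Y) :
  compm (Gm (Dm (LC f))) (unit_derived X) = compm (unit_derived Y) (LC f).
Proof.
rewrite (dual_derivedE f) rdual_derivedE.
  have [R [fR [e [a [b [[eI qe] ea eb phiE]]]]]] :=
    induced_morP (dual_map f : @hom k TA (dual_bfd Y) (dual_bfd X)).
  (* Both sides factor through this adjunct of [e]: the unit at [X] by the finite dual of [b], and
     the unit at [Y] after [f] by that of [a]. *)
  pose ad := adj_map e : @hom k TC X (rdual_bfd fR).
  have uX : unit_mor X = compm (rdual_hom (res_fg (dual_bfd X)) fR b) ad.
    by rewrite [RHS]adj_map_rdual /unit_mor -eb.
  have uY : compm (rdual_hom (res_fg (dual_bfd Y)) fR a) ad = compm (unit_mor Y) f.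
    rewrite [LHS]adj_map_rdual -[RHS]adj_map_dual.
    by congr (adj_map _); exact: ea.
  rewrite /unit_derived uX; set u := rdual_hom _ _ _ in phiE *.
  set v := rdual_hom _ _ _ in phiE uY.
  transitivity (compm (compm (induced_mor
    (dual_map f : @hom k TA (dual_bfd Y) (dual_bfd X))) (LC u)) (LC ad)).
    by rewrite -compmA; congr (compm _ _); exact: (LC_comp u ad).
  rewrite [X in compm X _]phiE.
  transitivity (LC (compm v ad)); first exact: (esym (LC_comp v ad)).
  by rewrite uY; exact: (LC_comp (unit_mor Y) f).
Qed.

Lemma unit_derived_nat (X Y : SC) (w : hom X Y) :
  compm (Gm (Dm w)) (unit_derived X) = compm (unit_derived Y) w.
Proof.
move: X Y w; exact: (loc_natural_unit unit_derived_nat_mor).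
Qed.

Definition ev_mor (P : TA) (fP : fg_complex P) : @hom k TA P (dual_bfd (rdual_bfd fP)) :=
  ev_map P.

Lemma ev_mor_iso (P : TA) (fP : fg_complex P) : is_iso (LA (ev_mor fP)).
Proof.
apply: (loc_functor_iso (W := @quasi_isos k (module_cat A))).
by apply: ev_map_quasi_iso; exact: (fg_complex_reflexive).
Qed.

Lemma res_map_iso (N : TA) : is_iso (LA (res_map N)).
Proof.
by apply: (loc_functor_iso (W := @quasi_isos k (module_cat A))); exact: res_qi.
Qed.

(** Evaluation lives on the resolution, whose inclusion in [N] becomes invertible in the derived
    category. *)
Lemma counit_ex (N : TA) : exists s : @hom k SA N (dual_bfd (G0 N)),
  compm s (LA (res_map N)) = LA (ev_mor (res_fg N)).
Proof.
have [i [ir ri]] := res_map_iso N.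
by exists (compm (LA (ev_mor (res_fg N))) i); rewrite -compmA ir compm_idr.
Qed.

Definition counit_derived (N : SA) : @hom k SA N (D (rdual_derived N : SC)) :=
  projT1 (cid (counit_ex N)).

Lemma counit_derivedP (N : TA) :
  compm (counit_derived N) (LA (res_map N)) = LA (ev_mor (res_fg N)).
Proof. exact: (projT2 (cid (counit_ex N))). Qed.

Lemma counit_derived_iso N : is_iso (counit_derived N).
Proof.
apply: (iso_cancel (res_map_iso N)); rewrite counit_derivedP; exact: ev_mor_iso.
Qed.

Lemma ev_mor_nat (P Q : TA) (fP : fg_complex P) (fQ : fg_complex Q) (f : @hom k TA P Q) :
  compm (LA (dual_map (rdual_hom fP fQ f) :
    @hom k TA (dual_bfd (rdual_bfd fP)) (dual_bfd (rdual_bfd fQ))))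
    (LA (ev_mor fP)) =
  compm (LA (ev_mor fQ)) (LA f).
Proof.
have E : compm (dual_map (rdual_hom fP fQ f) :
    @hom k TA (dual_bfd (rdual_bfd fP)) (dual_bfd (rdual_bfd fQ))) (ev_mor fP) =
    compm (ev_mor fQ) f by exact: (esym (ev_map_nat f)).
apply: etrans (esym (LA_comp _ _)) _; apply: etrans (LA_comp _ _).
exact: (congr1 (fun w => LA w) E).
Qed.

Lemma counit_derived_nat_mor (N M : TA) (f : @hom k TA N M) :
  compm (Dm (Gm (LA f))) (counit_derived N) = compm (counit_derived M) (LA f).
Proof.
rewrite (rdual_derivedE f).
have [R [fR [e [a [b [[eI qe] ea eb phiE]]]]]] := induced_morP f.
have qb := induced_b_qi qe eb.
apply: (@counit_square k SA N M (res N) (res M) R _ _ _ (LA f) (LA (res_map N))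
  (LA (res_map M)) (LA a) (LA b) (LA e) _ _ (LA (ev_mor (res_fg N))) (LA (ev_mor (res_fg M)))
  (LA (ev_mor fR))
  (LA (dual_map (rdual_hom (res_fg N) fR a) :
    @hom k TA (dual_bfd (G0 N)) (dual_bfd (rdual_bfd fR))))
  (LA (dual_map (rdual_hom (res_fg M) fR b) :
    @hom k TA (dual_bfd (G0 M)) (dual_bfd (rdual_bfd fR))))).
- exact: res_map_iso.
- exact: (loc_functor_iso (W := @quasi_isos k (module_cat A))).
- apply: (loc_functor_iso (W := @quasi_isos k (module_cat A))).
  apply: dual_map_quasi_iso; apply: rdual_map_quasi_iso => //;
    by apply: (fg_complex_reflexive) => //; exact: res_fg.
- by rewrite -!LA_comp ea.
- by rewrite -LA_comp eb.
- exact: counit_derivedP.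
- exact: counit_derivedP.
- exact: ev_mor_nat.
- exact: ev_mor_nat.
rewrite -(dual_derivedE (rdual_hom (res_fg N) fR a)) -phiE.
by rewrite -(dual_derivedE (rdual_hom (res_fg M) fR b)) (fmor_comp D).
Qed.

Lemma counit_derived_nat (N M : SA) (v : hom N M) :
  compm (Dm (Gm v)) (counit_derived N) = compm (counit_derived M) v.
Proof. by move: N M v; exact: (loc_natural_unit counit_derived_nat_mor). Qed.

(** * Compatibility of the duality with shifts *)

Section Twist.
Variable n : int.

Lemma twist_deg (i : int) : - (i + n) + n = - i.
Proof. by rewrite opprD addrNK. Qed.

Lemma shift_sign_sqr : shift_sign k n * shift_sign k n = 1.
Proof. by rewrite /shift_sign -expfzMl mulrNN mulr1 exp1rz. Qed.

(** Both sides have the same terms, as [- (i + n) + n = - i]. In the target the inner and the outer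
    shift each contribute a sign [(-1)^n] to the differential, and these cancel. *)
Definition twist (X : complex (comod_cat C)) :
  chain_map (dual_complex X) (shift_complex n (dual_complex (shift_complex n X))).
Proof.
exists (fun i => cpull (@dcast _ (comod_cat C) X _ _ (twist_deg i)) :
  {linear und (dual_complex X i) ->
     und (shift_complex n (dual_complex (shift_complex n X)) i)}).
- by move=> i; apply: cpull_hom; exact: (@dcast_hom _ (comod_cat C) X _ _ (twist_deg i)).
- move=> i j phi; apply: forms_ext => x.
  transitivity ((phi : cdual (X (- i))) (dif X (- j) (- i) (dcast X (twist_deg j) x))) => //.
  set psi : resk (cdual (X (- (i + n) + n))) :=
    cpull (@dcast _ (comod_cat C) X _ _ (twist_deg i)) phi.
  have -> : (dif (shift_complex n (dual_complex (shift_complex n X))) i j psi) x =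
     shift_sign k n * (psi : cdual (X (- (i + n) + n)))
        (shift_sign k n *: dif X (- (j + n) + n) (- (i + n) + n) x).
    exact: resk_cdualE.
  rewrite linearZ mulrA shift_sign_sqr mul1r.
  by rewrite dif_dcast -(dcast_dif (twist_deg i)).
Defined.

Lemma twist_quasi_iso X : quasi_iso (twist X).
Proof.
apply: bijective_quasi_iso => [i phi psi E|i psi].
  apply: forms_ext => x.
  rewrite -[x](dcastK (X := X) (esym (twist_deg i)) (twist_deg i)).
  exact: (congr1 (fun h : cdual (X (- (i + n) + n)) => h (dcast X (esym (twist_deg i)) x)) E).
exists (cpull (@dcast _ (comod_cat C) X _ _ (esym (twist_deg i))) psi).
apply: forms_ext => x; congr ((psi : cdual (X (- (i + n) + n))) _).
exact: (dcastK (X := X) (twist_deg i) (esym (twist_deg i))).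
Qed.

Definition twist_mor (X : TC) :
  @hom k TA (dual_bfd X) (shift_bfd n (dual_bfd (shift_bfd n X))) := twist X.

Lemma twist_mor_nat (X Y : TC) (f : @hom k TC X Y) :
  compm (twist_mor X) (dual_map f : @hom k TA (dual_bfd Y) (dual_bfd X)) =
  compm (shift_map n (dual_map (shift_map n f)) :
    @hom k TA (shift_bfd n (dual_bfd (shift_bfd n Y))) (shift_bfd n (dual_bfd (shift_bfd n X))))
    (twist_mor Y).
Proof.
apply: chain_map_ext => i phi; apply: forms_ext => x.
transitivity ((phi : cdual (Y (- i))) (f (- i) (dcast X (twist_deg i) x))) => //.
by rewrite cm_dcast.
Qed.

Definition twist_derived (X : SC) :
  @hom k SA (D X) (derived_shift (module_cat A) n (D (derived_shift (comod_cat C) n X))) :=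
  lift_theta (V := @quasi_isos k (comod_cat C)) (W := @quasi_isos k (module_cat A))
    (F := dual_functor) (s := chain_shift (comod_cat C) n) (t := chain_shift (module_cat A) n)
    dual_derived_iso (@derived_shift_iso k (comod_cat C) n)
    (@derived_shift_iso k (module_cat A) n) twist_mor X.

Lemma twist_derived_iso X : is_iso (twist_derived X).
Proof.
apply: (loc_functor_iso (W := @quasi_isos k (module_cat A))); exact: twist_quasi_iso.
Qed.

Definition twist_derived_nat :=
  lift_theta_nat (V := @quasi_isos k (comod_cat C)) (W := @quasi_isos k (module_cat A))
    (F := dual_functor) (s := chain_shift (comod_cat C) n) (t := chain_shift (module_cat A) n)
    dual_derived_iso (@derived_shift_iso k (comod_cat C) n)
    (@derived_shift_iso k (module_cat A) n) twist_mor_nat.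

Lemma lartinian_CY : coalgebra_CY C n <-> algebra_CY A n.
Proof.
exact: (@calabi_yau_equivalence k (derived_bfd (comod_cat C)) (derived_bfd (module_cat A)) n
  D rdual_derived unit_derived counit_derived unit_derived_iso counit_derived_iso
  unit_derived_nat counit_derived_nat
  (@derived_shift_inj k (module_cat A) n) (@derived_shift_surj k (module_cat A) n)
  twist_derived twist_derived_iso twist_derived_nat).
Qed.

End Twist.
End DerivedDuality.

Theorem corollary1p7 (k : closedFieldType) (char0 : [pchar k]%R =i pred0)
    (C : coalgebra k) (n : int) :
  artinian_coalgebra C ->
  (coalgebra_CY C n <-> algebra_CY (dual_algebra C) n).
Proof. by move=> [Cart _]; exact: lartinian_CY. Qed.
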